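(* Let $g_2^{\mathfrak A}$ be the derivative of $R_2^{\mathfrak A}=\lim_{Q\to\infty}R_Q^{\mathfrak A}$, and $g_2^{\mathfrak A}(0)=\lim_{\xi\to0^+}g_2^{\mathfrak A}(\xi)$. Then $$g_2^{\mathfrak A}(0)=\frac23\sum_{M\in\mathfrak S}\left(\frac{\|M\|^2}{\sqrt{\|M\|^4-4}}-1\right)=\frac83\sum_{\mathcal C}\sum_{n\ge1}\frac{1}{e^{n\ell(\mathcal C)}-1},$$ where $\mathcal C$ runs over the primitive closed geodesics on $X=\mathrm{PSL}_2(\mathbb Z)\backslash\mathbb H$ which pass through the point $\Pi(i)$, and $\ell(\mathcal C)$ is the length of $\mathcal C$.
   Context: $\mathbb H$ is the upper half-plane with the hyperbolic metric, $\Gamma=\mathrm{PSL}_2(\mathbb Z)$, $X=\Gamma\backslash\mathbb H$, $\Pi:\mathbb H\to X$ the projection. For a matrix $g$ with rows $(a,b)$, $(c,d)$: $\|g\|^2=a^2+b^2+c^2+d^2$. For $g\in\Gamma$, $\theta_g\in[-\pi,\pi]$ is the angle at $i$ between the vertical geodesic from $i$ to $0$ and the geodesic ray from $i$ to $gi$. $\Gamma_{\mathbf I}$ is the set of integer matrices $\begin{pmatrix}a&b\\c&d\end{pmatrix}$ of determinant $1$ with $a,b,c,d\ge0$ and $0\le\frac bd<\frac ac\le1$; for such $\gamma$, $\theta_\gamma\in(0,\pi/2)$ and $\tan\theta_\gamma=\frac{2(ac+bd)}{c^2+d^2-a^2-b^2}$. $B_Q=\#\{\gamma\in\Gamma_{\mathbf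 I}:\|\gamma\|\le Q\}$ and $$R_Q^{\mathfrak A}(\xi)=\frac1{B_Q}\#\Big\{(\gamma,\gamma')\in\Gamma_{\mathbf I}^2:\ \|\gamma\|,\|\gamma'\|\le Q,\ \gamma'\ne\gamma,\ 0\le\tfrac2\pi(\theta_{\gamma'}-\theta_\gamma)\le\tfrac{\xi}{B_Q}\Big\}.$$ The limit $R_2^{\mathfrak A}$ exists and is a $C^1$ function on $[0,\infty)$. $\mathfrak S$ is the set of matrices in $\mathrm{SL}_2(\mathbb Z)$ with nonnegative entries, different from the identity. Closed geodesics. Oriented closed geodesics on $X$ are identified with conjugacy classes $\{A\}$ of hyperbolic elements $A\in\Gamma$: the arc from $z_0$ to $Az_0$ of the axis of $A$ in $\mathbb H$ (the geodesic joining its two real fixed points) projects to the closed geodesic. It is primitive if $A$ is not a proper power of another hyperbolic element of $\Gamma$. If the absolute value of the trace of $A$ is $t$, the length is $2\ln N(A)$ with $N(A)=\frac12(t+\sqrt{t^2-4})$. The axis of a hyperbolic $A$ passes through $i$ if and only if $A$ is symmetric, so the closed geodesics through $\Pi(i)$ are those whose conjugacy class contains a symmetric matrix. *)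

(* Defs.v *)
From HB Require Import structures.
From mathcomp Require Import all_boot all_order all_algebra finmap complex.
From mathcomp Require Import all_classical all_reals all_analysis.

Set Implicit Arguments.
Unset Strict Implicit.
Unset Printing Implicit Defensive.

Import Order.TTheory GRing.Theory Num.Theory.
Import numFieldNormedType.Exports.

Local Open Scope classical_set_scope.
Local Open Scope ring_scope.

Definition SL2Z : set 'M[int]_2 := [set g | \det g = 1].

Definition norm_sq (g : 'M[int]_2) : int :=
  g 0 0 ^+ 2 + g 0 1 ^+ 2 + g 1 0 ^+ 2 + g 1 1 ^+ 2.

Definition mxnorm (R : realType) (g : 'M[int]_2) : R :=
  Num.sqrt (norm_sq g)%:~R.

Definition nonneg_entries (g : 'M[int]_2) : Prop := forall i j, 0 <= g i j.

Definition frakS : set 'M[int]_2 :=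
  [set M | [/\ SL2Z M, nonneg_entries M & M != 1]].

(* The convention x / 0 = 0 adds no matrix: given the sign and determinant
   conditions, 0 <= b/d < a/c fails when c = 0, and d = 0 is impossible. *)
Definition GammaI : set 'M[int]_2 :=
  [set g | [/\ SL2Z g, nonneg_entries g &
     [&& 0 <= (g 0 1)%:Q / (g 1 1)%:Q,
         (g 0 1)%:Q / (g 1 1)%:Q < (g 0 0)%:Q / (g 1 0)%:Q &
         (g 0 0)%:Q / (g 1 0)%:Q <= 1]]].

Section HyperbolicPlane.
Variable R : realType.
Local Open Scope complex_scope.

Definition mobius (g : 'M[int]_2) (z : R[i]) : R[i] :=
  ((g 0 0)%:~R * z + (g 0 1)%:~R) / ((g 1 0)%:~R * z + (g 1 1)%:~R).

(* A vector tangent at i to the geodesic ray from i to w.  If Re w <> 0 the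
   geodesic lies on the circle through i and w with centre
   k = (|w|^2 - 1) / (2 Re w) on the real axis.  The directions orthogonal to
   i - k are the multiples of 1 + k i, and (2 Re w)(1 + k i) points towards w.
   If Re w = 0 the ray is vertical and the same formula gives its direction. *)
Definition tangent_at_i (w : R[i]) : R[i] :=
  (2 * complex.Re w) +i* (complex.Re w ^+ 2 + complex.Im w ^+ 2 - 1).

(* The signed angle, counterclockwise, from the downward direction -i to v;
   it is acos of the normalised inner product of v with -i, with the sign
   of Re v. *)
Definition angle_from_down (v : R[i]) : R :=
  let phi := acos (- complex.Im v /
                   Num.sqrt (complex.Re v ^+ 2 + complex.Im v ^+ 2)) in
  if 0 <= complex.Re v then phi else - phi.

(* Conformality of the half-plane model makes the hyperbolic angle at i the
   Euclidean angle between the tangent vectors. *)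
Definition theta (g : 'M[int]_2) : R :=
  angle_from_down (tangent_at_i (mobius g 'i)).

(* A x = x, with the denominator cleared; since det A = 1, the numerator and
   the denominator of A x do not both vanish, so no solution is added. *)
Definition real_fixed_point (A : 'M[int]_2) (x : R) : Prop :=
  (A 0 0)%:~R * x + (A 0 1)%:~R = x * ((A 1 0)%:~R * x + (A 1 1)%:~R).

(* For a hyperbolic integer matrix of determinant 1 neither fixed point is
   infinity, as A 1 0 = 0 forces |tr A| = 2; the axis is thus a half-circle. *)
Definition axis (A : 'M[int]_2) : set R[i] :=
  [set z | 0 < complex.Im z /\
     exists x1 x2 : R,
       [/\ x1 < x2, real_fixed_point A x1, real_fixed_point A x2 &
           (complex.Re z - (x1 + x2) / 2) ^+ 2 + complex.Im z ^+ 2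
           = ((x2 - x1) / 2) ^+ 2]].

(* Pi(i) lies on the projection of the axis of A iff the axis meets the orbit
   of i. *)
Definition passes_through_Pi_i (A : 'M[int]_2) : Prop :=
  exists2 g, SL2Z g & axis A (mobius g 'i).

End HyperbolicPlane.

(* Elements of PSL_2(Z) are represented by their lifts to SL_2(Z). *)
Definition eqPSL (A B : 'M[int]_2) : Prop := A = B \/ A = - B.

Definition hyperbolic (A : 'M[int]_2) : Prop := SL2Z A /\ 2 < `|\tr A|.

Definition primitive (A : 'M[int]_2) : Prop :=
  forall (B : 'M[int]_2) (n : nat),
    hyperbolic B -> (2 <= n)%N -> ~ eqPSL A (B ^+ n).

(* The conjugacy class of the image of A in PSL_2(Z), as the set of all its
   lifts.  For hyperbolic A this set stands for the oriented closed geodesic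
   obtained by projecting the axis of A. *)
Definition conj_class (A : 'M[int]_2) : set 'M[int]_2 :=
  [set B | exists2 g, SL2Z g & eqPSL B (g * A / g)].

Definition prim_geodesics_through_i (R : realType) : set (set 'M[int]_2) :=
  [set conj_class A | A in
    [set A | [/\ hyperbolic A, primitive A & passes_through_Pi_i R A]]].

Definition multiplier (R : realType) (A : 'M[int]_2) : R :=
  let t : R := `|\tr A|%:~R in (t + Num.sqrt (t ^+ 2 - 4)) / 2.

(* The value does not depend on the representative: |tr| is constant on a
   class. *)
Definition geodesic_length (R : realType) (C : set 'M[int]_2) : R :=
  2 * ln (multiplier R (xget 0 C)).

Section PairCorrelation.
Variable R : realType.

Definition ballI (Q : R) : set 'M[int]_2 := [set g | GammaI g /\ mxnorm R g <= Q].

Definition B_ (Q : R) : R := #|` fset_set (ballI Q)|%:R.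

Definition close_pairs (Q xi : R) : set ('M[int]_2 * 'M[int]_2) :=
  [set p | [/\ ballI Q p.1, ballI Q p.2, p.2 != p.1 &
     0 <= 2 / pi * (theta R p.2 - theta R p.1) <= xi / B_ Q]].

Definition RA_ (Q xi : R) : R := #|` fset_set (close_pairs Q xi)|%:R / B_ Q.

Definition RA (xi : R) : R := lim (RA_ Q xi @[Q --> +oo]).

Definition gA : R -> R := derive1 RA.

Definition gA_at0 : R := lim (gA xi @[xi --> 0^'+]).

(* f is C^1 on [0, +oo[; by the mean value theorem the last condition makes
   the right limit of f' at 0 the one-sided derivative of f there. *)
Definition C1_0y (f : R -> R) : Prop :=
  [/\ derivable_oy_Rcontinuous f 0,
      {in `]0, +oo[, continuous (derive1 f)} &
      cvg (derive1 f xi @[xi --> 0^'+])].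

End PairCorrelation.

(* Main.v *)
Require Import Defs.
From HB Require Import structures.
From mathcomp Require Import all_boot all_order all_algebra finmap complex.
From mathcomp Require Import all_classical all_reals all_analysis.
From mathcomp Require Import ring lra zify.

Set Implicit Arguments.
Unset Strict Implicit.
Unset Printing Implicit Defensive.

Import Order.TTheory GRing.Theory Num.Theory.
Import numFieldNormedType.Exports.

Local Open Scope classical_set_scope.
Local Open Scope ring_scope.

(** The matrices of SL2 with nonnegative entries form the free monoid on
    (1 0; 1 1) and (1 1; 0 1), and Gamma_I consists of the (1 0; 1 1) M with M in
    this monoid.  If the angles of gamma and gamma', of norm at most Q, differ by
    less than 1 / (2 Q^2), then one of the two words is a prefix of the other;
    hence for small xi the correlation counts pairs (gamma, gamma M) with M in
    frakS, and its slope at 0 is a sum over M.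

    For a fixed M, the hyperbolic laws of sines and cosines turn the condition on
    the two angles into a condition on the norm and on the angle of gamma^T gamma,
    which cuts out a triangle.  In these two coordinates the elements of Gamma_I
    are equidistributed, so M contributes
    (4/3) / (Lam (Lam - 1/Lam)) = (2/3) (|M|^2 / sqrt (|M|^4 - 4) - 1), where
    Lam > 1 and Lam + 1/Lam = |M|^2.  The pairs with M large are bounded uniformly:
    up to O(1) possibilities for each pair (M, c), they force the second row (c, d)
    of gamma to be close to an eigenvector of M M^T.

    Equidistribution is elementary.  Lattice points in a sector, sorted by their
    gcd, give the count for primitive vectors, because an error term contracts by
    the factor zeta(2) - 1 < 1.  A cell of the tree whose two rows are nearly equal
    is controlled by this count, and every cell splits into such cells up to a
    fixed proportion of its angle, which again makes the error contract.

    For the second equality, M M^T is the word m m^t with m^t the reversed and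
    exchanged word, so M in frakS amounts to a nonempty symmetric word, hence to a
    power r^n of a primitive symmetric word r.  A primitive class through Pi(i)
    contains exactly two such r, namely m m^t and m^t m, and the length l of its
    geodesic satisfies e^(n l) = Lam^2. *)

(** * Words *)

(** A word is used from both ends. Its prefix governs theta, through gamma gamma^T, so close angles
    force one word to extend the other; its suffix governs the axis of gamma^T gamma, which lies
    between the rows of the suffix matrix. Hence close pairs are extensions [w ++ m], while
    equidistribution is proved on cells of words with a common suffix. Counts are linear in X = Q^2:
    Gamma_I has about 3X/8 elements, and M contributes about k0 tau X / (2 Lam (Lam - 1/Lam)) pairs
    for a window tau / X. With tau = xi / k0 the quotient has the constant 4/3. The sum over M and
    the limit in Q do not commute for free: the M outside a box of size Y must cost O(tau X / Y) +
    o(X). The O(1) error for each (M, c) is summable in c only for large c, so the finitely many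
    small gamma are treated apart, with M as the variable. Pairs with equal angles occur in both
    orders. They drop out because the limit correlation vanishes at 0, which is itself extracted
    from the upper bound. *)

(* The letter [false] stands for (1 0; 1 1) and [true] for (1 1; 0 1). *)
Fixpoint wmx (w : seq bool) : nat * nat * nat * nat :=
  if w is b :: v then
    let: (p, q, r, s) := wmx v in
    if b then (p + r, q + s, r, s)%N else (p, q, p + r, q + s)%N
  else (1, 0, 0, 1)%N.

Definition wA w := (wmx w).1.1.1.
Definition wB w := (wmx w).1.1.2.
Definition wC w := (wmx w).1.2.
Definition wD w := (wmx w).2.

Lemma wA_cons b w : wA (b :: w) = if b then (wA w + wC w)%N else wA w.
Proof. by rewrite /wA /wC /=; case: (wmx w) => [[[p q] r] s]; case: b. Qed.
Lemma wB_cons b w : wB (b :: w) = if b then (wB w + wD w)%N else wB w.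
Proof. by rewrite /wB /wD /=; case: (wmx w) => [[[p q] r] s]; case: b. Qed.
Lemma wC_cons b w : wC (b :: w) = if b then wC w else (wA w + wC w)%N.
Proof. by rewrite /wA /wC /=; case: (wmx w) => [[[p q] r] s]; case: b. Qed.
Lemma wD_cons b w : wD (b :: w) = if b then wD w else (wB w + wD w)%N.
Proof. by rewrite /wB /wD /=; case: (wmx w) => [[[p q] r] s]; case: b. Qed.
Definition w_cons := (wA_cons, wB_cons, wC_cons, wD_cons).
Lemma w_nil : (wA [::] = 1%N) * (wB [::] = 0%N) * (wC [::] = 0%N) * (wD [::] = 1%N).
Proof. by []. Qed.

Lemma w_cat u v : [/\ wA (u ++ v) = (wA u * wA v + wB u * wC v)%N,
  wB (u ++ v) = (wA u * wB v + wB u * wD v)%N,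
  wC (u ++ v) = (wC u * wA v + wD u * wC v)%N &
  wD (u ++ v) = (wC u * wB v + wD u * wD v)%N].
Proof.
elim: u => [|b u [IA IB IC ID]]; first by rewrite cat0s !w_nil; split; nia.
by rewrite cat_cons !w_cons IA IB IC ID; case: b; split; nia.
Qed.

Lemma w_det w : (wA w * wD w = wB w * wC w + 1)%N.
Proof. by elim: w => [|b w IH]; rewrite ?w_nil ?w_cons; [nia|case: b; nia]. Qed.

Lemma wA_gt0 w : (0 < wA w)%N.
Proof. by elim: w => [|b w IH]; rewrite ?w_nil ?w_cons //; case: b; lia. Qed.
Lemma wD_gt0 w : (0 < wD w)%N.
Proof. by elim: w => [|b w IH]; rewrite ?w_nil ?w_cons //; case: b; lia. Qed.

(** Row sums, that is the image of the vector (1, 1). The pair ([wX w], [wY w]) is the Calkin-Wilf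
    label of [w]: each coprime pair of positive integers occurs exactly once, so words can be
    counted as primitive lattice points. *)
Definition wX w := (wA w + wB w)%N.
Definition wY w := (wC w + wD w)%N.

Lemma wX_cons b w : wX (b :: w) = if b then (wX w + wY w)%N else wX w.
Proof. by rewrite /wX /wY !w_cons; case: b => //; lia. Qed.
Lemma wY_cons b w : wY (b :: w) = if b then wY w else (wX w + wY w)%N.
Proof. by rewrite /wX /wY !w_cons; case: b => //; lia. Qed.
Lemma wX_gt0 w : (0 < wX w)%N. Proof. by rewrite addn_gt0 wA_gt0. Qed.
Lemma wY_gt0 w : (0 < wY w)%N. Proof. by rewrite addn_gt0 wD_gt0 orbT. Qed.


(** The larger coordinate reveals the first letter, and a subtraction (a step of Euclid's algorithm)
    removes it. The multipliers [g] and [h] ride along, so that the gcd of a lattice point is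
    recovered together with its word. *)
Lemma Calkin_Wilf_inj g h u v : (0 < g)%N -> (0 < h)%N ->
  (g * wX u = h * wX v)%N -> (g * wY u = h * wY v)%N -> g = h /\ u = v.
Proof.
move=> g0 h0; elim: u v => [|b u IH] [|c v]; rewrite ?wX_cons ?wY_cons.
- by rewrite /wX /wY !w_nil; split => //; lia.
- by have := wX_gt0 v; have := wY_gt0 v; rewrite /wX /wY !w_nil; case: c; nia.
- by have := wX_gt0 u; have := wY_gt0 u; rewrite /wX /wY !w_nil; case: b; nia.
- have gX : (0 < g * wX u)%N by rewrite muln_gt0 g0 wX_gt0.
  have gY : (0 < g * wY u)%N by rewrite muln_gt0 g0 wY_gt0.
  case: b c => [] [] /=; rewrite ?(mulnDr _ (wX _) (wY _)) => e1 e2; try (by exfalso; lia).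
  + by have [||-> ->] := IH v; [lia|lia|].
  + by have [||-> ->] := IH v; [lia|lia|].
Qed.

Lemma Calkin_Wilf_surj x y : (0 < x)%N -> (0 < y)%N ->
  exists g w, [/\ (0 < g)%N, x = (g * wX w)%N & y = (g * wY w)%N].
Proof.
have [n] := ubnP (x + y); elim: n x y => // n IH x y; rewrite ltnS => le x0 y0.
case: (ltngtP x y) => xy.
- have [|//||g [w [g0 ex ey]]] := IH x (y - x)%N; [lia|lia|].
  by exists g, (false :: w); rewrite wX_cons wY_cons; split => //; nia.
- have [||//|g [w [g0 ex ey]]] := IH (x - y)%N y; [lia|lia|].
  by exists g, (true :: w); rewrite wX_cons wY_cons; split => //; nia.
- by exists x, [::]; rewrite /wX /wY !w_nil; split => //; lia.
Qed.

Definition wtr (w : seq bool) := rev (map negb w).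

Lemma wtrK : involutive wtr.
Proof. by move=> w; rewrite /wtr map_rev revK -map_comp map_id_in // => b _ /=; rewrite negbK. Qed.

Lemma wtr_cons b w : wtr (b :: w) = wtr w ++ [:: ~~ b].
Proof. by rewrite /wtr /= rev_cons -cats1. Qed.

Lemma w_tr w : [/\ wA (wtr w) = wA w, wB (wtr w) = wC w, wC (wtr w) = wB w
  & wD (wtr w) = wD w].
Proof.
elim: w => [|b w [IA IB IC ID]] //; rewrite wtr_cons.
have [-> -> -> ->] := w_cat (wtr w) [:: ~~ b].
by rewrite IA IB IC ID !w_cons !w_nil; case: b => /=; split; nia.
Qed.

(** These sums are [wX] and [wY] of the transposed word. They form the second row of gamma, so an
    element of Gamma_I is determined by its second row, and counting elements becomes counting
    integer pairs. *)
Lemma row_inj u v : (wA u + wC u = wA v + wC v)%N ->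
  (wB u + wD u = wB v + wD v)%N -> u = v.
Proof.
move=> e1 e2; apply: (can_inj wtrK).
have [//|//|||_ //] := @Calkin_Wilf_inj 1%N 1%N (wtr u) (wtr v).
- by rewrite /wX; have [-> -> _ _] := w_tr u; have [-> -> _ _] := w_tr v; rewrite e1.
- by rewrite /wY; have [_ _ -> ->] := w_tr u; have [_ _ -> ->] := w_tr v; rewrite e2.
Qed.

(** * Counting in finite sets *)

Section Counting.
Context {T : choiceType}.
Implicit Types A B : set T.

(** [fset_set] sends an infinite set to the empty one, so [cnt] is 0 there; this is why the bounds
    below come with finiteness statements. *)
Definition cnt A : nat := #|` fset_set A|.

Lemma cnt_le A B : finite_set B -> A `<=` B -> (cnt A <= cnt B)%N.
Proof.
move=> fB AB; apply: fsubset_leq_card.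
by rewrite -fset_set_sub //; exact: sub_finite_set fB.
Qed.

Lemma cnt0 : cnt set0 = 0%N. Proof. by rewrite /cnt fset_set0 cardfs0. Qed.
Lemma cnt1 x : cnt [set x] = 1%N. Proof. by rewrite /cnt fset_set1 cardfs1. Qed.

Lemma cntU A B : finite_set A -> finite_set B -> A `&` B = set0 ->
  cnt (A `|` B) = (cnt A + cnt B)%N.
Proof.
move=> fA fB AB0; rewrite /cnt fset_setU // cardfsU -fset_setI //.
by rewrite AB0 fset_set0 cardfs0 subn0.
Qed.

Lemma cntU_le A B : finite_set A -> finite_set B ->
  (cnt (A `|` B) <= cnt A + cnt B)%N.
Proof. by move=> fA fB; rewrite /cnt fset_setU // cardfsU leq_subr. Qed.

Lemma cntD A B : finite_set A -> B `<=` A -> cnt A = (cnt B + cnt (A `\` B))%N.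
Proof.
move=> fA BA; rewrite -cntU ?setDUK //.
- exact: sub_finite_set BA fA.
- exact: sub_finite_set (@subDsetl _ _ _) fA.
- by rewrite setDE setIA setIAC setICr set0I.
Qed.
End Counting.

Lemma inj_finite {T U : Type} (A : set T) (B : set U) (f : T -> U) :
  finite_set B -> (forall x, A x -> B (f x)) -> {in A &, injective f} ->
  finite_set A.
Proof.
move=> fB fAB fI; have /eq_finite_set <- := inj_card_eq fI.
by apply: sub_finite_set fB => _ [x Ax <-]; exact: fAB.
Qed.

Lemma cnt_image {T U : choiceType} (A : set T) (f : T -> U) :
  finite_set A -> {in A &, injective f} -> cnt (f @` A) = cnt A.
Proof.
move=> fA fI; have fI' := inj_card_eq fI.
by apply/fcard_eq => //; exact: finite_image.
Qed.

Lemma cnt_inj {T U : choiceType} (A : set T) (B : set U) (f : T -> U) :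
  finite_set B -> (forall x, A x -> B (f x)) -> {in A &, injective f} ->
  (cnt A <= cnt B)%N.
Proof.
move=> fB fAB fI; rewrite -(cnt_image (inj_finite fB fAB fI) fI).
by apply: cnt_le fB _ => _ [x Ax <-]; exact: fAB.
Qed.

Lemma cnt_fibers {T U : choiceType} (A : set T) (f : T -> U) (s : seq U) :
  finite_set A -> uniq s -> (forall x, A x -> f x \in s) ->
  cnt A = (\sum_(i <- s) cnt (A `&` f @^-1` [set i]))%N.
Proof.
elim: s A => [|i s IH] A fA /=.
  move=> _ fs; rewrite big_nil (_ : A = set0) ?cnt0 //.
  by apply/seteqP; split => // x /fs.
case/andP=> nis us fs; rewrite big_cons (@cntD _ A (A `&` f @^-1` [set i])) //.
congr addn; rewrite (IH (A `\` (A `&` f @^-1` [set i]))) //.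
- rewrite !big_seq; apply: eq_bigr => j js; congr cnt; apply/seteqP; split => x /=.
    by move=> [[Ax _] fx]; split.
  by move=> [Ax fx]; split => //; split => // -[_ fi]; move: nis; rewrite -fi fx js.
- exact: sub_finite_set (@subDsetl _ _ _) fA.
- move=> x [Ax nx]; have := fs _ Ax; rewrite inE => /orP[/eqP fi|//].
  by case: nx.
Qed.

Lemma cnt_seq {T : choiceType} (A : set T) (s : seq T) :
  (forall x, A x -> x \in s) -> (cnt A <= size s)%N /\ finite_set A.
Proof.
move=> As; have fA : finite_set A by apply: sub_finite_set (finite_seq s) => x /As.
split=> //; apply: uniq_leq_size => [|x]; first exact: fset_uniq.
by rewrite in_fset_set // inE => /As.
Qed.

Section RealCounting.
Variable R : realType.
Implicit Types x y z : R.

Lemma cnt_nat_near (A : set nat) z y : 0 <= y ->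
  (forall n, A n -> `|n%:R - z| <= y) ->
  (cnt A)%:R <= 2 * y + 1 /\ finite_set A.
Proof.
move=> y0 Ay; have [[n0 An0]|A0] := pselect (exists n, A n); last first.
  have -> : A = set0 by apply/seteqP; split => // n An; apply: A0; exists n.
  by rewrite cnt0; split=> //; lra.
have exA : exists n, `[< A n >] by exists n0; apply/asboolP.
case: (ex_minnP exA) => m /asboolP Am mmin.
have [le1 fA] : (cnt A <= size (iota m (Num.trunc (2 * y)).+1))%N /\ finite_set A.
  apply: cnt_seq => n An; have mn : (m <= n)%N by apply/mmin/asboolP.
  rewrite mem_iota mn /= addnS ltnS -leq_subLR truncn_ge_nat; last by lra.
  by rewrite natrB //; have := Ay _ An; have := Ay _ Am; rewrite !ler_norml; lra.
split=> //; apply: le_trans (_ : (size (iota m (Num.trunc (2 * y)).+1))%:R <= _).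
  by rewrite ler_nat.
by rewrite size_iota -natr1 lerD2r truncn_le; lra.
Qed.

Lemma cnt_nat_le (A : set nat) x : 0 <= x ->
  (forall n, A n -> (0 < n)%N /\ n%:R <= x) ->
  (cnt A)%:R <= x /\ finite_set A.
Proof.
move=> x0 Ax.
have [le1 fA] : (cnt A <= size (iota 1 (Num.trunc x)))%N /\ finite_set A.
  apply: cnt_seq => n /Ax[n0 nx].
  by rewrite mem_iota n0 /= add1n ltnS truncn_ge_nat.
by split=> //; rewrite size_iota in le1; rewrite -(truncn_ge_nat _ x0).
Qed.

Lemma cnt_dep (T : choiceType) (A : set T) (f : T -> nat) (g : T -> nat) x k :
  0 <= x -> 0 <= k ->
  (forall t, A t -> (0 < f t)%N /\ (f t)%:R <= x) ->
  {in A &, forall s t, f s = f t -> g s = g t -> s = t} ->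
  (forall n, finite_set [set g t | t in A `&` [set t | f t = n]] /\
    (cnt [set g t | t in A `&` [set t | f t = n]])%:R <= k) ->
  (cnt A)%:R <= x * k /\ finite_set A.
Proof.
move=> x0 k0 Af inj Ak.
have fA : finite_set A.
  have fB : finite_set [set n | (0 < n)%N /\ n%:R <= x].
    by have [] := @cnt_nat_le [set n | (0 < n)%N /\ n%:R <= x] _ x0 (fun n h => h).
  apply: (@inj_finite _ _ _ (\bigcup_(n in [set n | (0 < n)%N /\ n%:R <= x])
    ((fun m => (n, m)) @` [set g t | t in A `&` [set t | f t = n]])) (fun t => (f t, g t))).
  - by apply: bigcup_finite => // n _; apply: finite_image; case: (Ak n).
  - by move=> t At; exists (f t); [exact: Af|exists (g t) => //; exists t].
  - by move=> s t sA tA [] h1 h2; apply: inj.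
split=> //.
have := @cnt_fibers _ _ A f (iota 1 (Num.trunc x)) fA (iota_uniq _ _).
move=> -> => [|t /Af[f0 fx]]; last by rewrite mem_iota f0 /= add1n ltnS truncn_ge_nat.
rewrite natr_sum; apply: le_trans (_ : \sum_(i <- iota 1 (Num.trunc x)) k <= _).
  apply: ler_sum => i _; apply: le_trans (Ak i).2.
  rewrite ler_nat -(@cnt_image _ _ (A `&` f @^-1` [set i]) g) //.
    by apply: sub_finite_set fA => ? [].
  by move=> s t /set_mem[As fs] /set_mem[At ft]; apply: inj; rewrite ?inE // fs ft.
rewrite big_const_seq count_predT size_iota iter_addr_0 -mulr_natl.
by apply: ler_wpM2r => //; rewrite truncn_le.
Qed.

Lemma cnt_box (T : choiceType) (A : set T) (f g : T -> nat) x y :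
  0 <= x -> 0 <= y ->
  (forall t, A t -> [/\ (0 < f t)%N, (f t)%:R <= x, (0 < g t)%N & (g t)%:R <= y]) ->
  {in A &, forall s t, f s = f t -> g s = g t -> s = t} ->
  (cnt A)%:R <= x * y /\ finite_set A.
Proof.
move=> x0 y0 Afg inj; apply: (@cnt_dep _ A f g) => // [t At|n].
  by have [] := Afg _ At.
have [] := @cnt_nat_le [set g t | t in A `&` [set t | f t = n]] _ y0 => // m [t [At _] <-].
by have [] := Afg _ At.
Qed.

End RealCounting.

(** * Norms of products and the cells of words *)

Section PairCorrelationAtZero.
Variable R : realType.
Implicit Types (X x y e : R) (u v w m : seq bool).

Definition ra w : R := (wA w)%:R.
Definition rb w : R := (wB w)%:R.
Definition rc w : R := (wC w)%:R.
Definition rd w : R := (wD w)%:R.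

Lemma ra_ge1 w : 1 <= ra w. Proof. by rewrite ler1n wA_gt0. Qed.
Lemma rd_ge1 w : 1 <= rd w. Proof. by rewrite ler1n wD_gt0. Qed.
Lemma rb_ge0 w : 0 <= rb w. Proof. by []. Qed.
Lemma rc_ge0 w : 0 <= rc w. Proof. by []. Qed.
Lemma r_det w : ra w * rd w - rb w * rc w = 1.
Proof. by rewrite -!natrM w_det natrD addrC addKr. Qed.

Lemma r_cons b w : [/\ ra (b :: w) = if b then ra w + rc w else ra w,
  rb (b :: w) = if b then rb w + rd w else rb w,
  rc (b :: w) = if b then rc w else ra w + rc w &
  rd (b :: w) = if b then rd w else rb w + rd w].
Proof. by rewrite /ra /rb /rc /rd !w_cons; case: b; rewrite ?natrD. Qed.

Lemma r_cat u v : [/\ ra (u ++ v) = ra u * ra v + rb u * rc v,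
  rb (u ++ v) = ra u * rb v + rb u * rd v,
  rc (u ++ v) = rc u * ra v + rd u * rc v &
  rd (u ++ v) = rc u * rb v + rd u * rd v].
Proof.
rewrite /ra /rb /rc /rd; have [-> -> -> ->] := w_cat u v.
by rewrite !natrD !natrM.
Qed.

(* [g11], [g12], [g22] are the entries of [gamma^T gamma], where
   [gamma = (1 0; 1 1) (ra rb; rc rd)] is the matrix of Gamma_I attached to
   [w]; [n11], [n12], [n22] are those of [M M^T] for [M = (ra rb; rc rd)]. *)
Definition g11 w := ra w ^+ 2 + (ra w + rc w) ^+ 2.
Definition g12 w := ra w * rb w + (ra w + rc w) * (rb w + rd w).
Definition g22 w := rb w ^+ 2 + (rb w + rd w) ^+ 2.
Definition n11 w := ra w ^+ 2 + rb w ^+ 2.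
Definition n12 w := ra w * rc w + rb w * rd w.
Definition n22 w := rc w ^+ 2 + rd w ^+ 2.
(** Traces of these Gram matrices: the squared norms of M and, for [gT], of gamma. *)
Definition nT w := n11 w + n22 w.
Definition gT w := g11 w + g22 w.

Lemma g_det w : g11 w * g22 w - g12 w ^+ 2 = 1.
Proof.
rewrite -[1]mulr1 -{1}(r_det w) -(r_det w) /g11 /g12 /g22; ring.
Qed.

Lemma n_det w : n11 w * n22 w - n12 w ^+ 2 = 1.
Proof.
rewrite -[1]mulr1 -{1}(r_det w) -(r_det w) /n11 /n12 /n22; ring.
Qed.

Lemma g12_ge1 w : 1 <= g12 w.
Proof.
by have := ra_ge1 w; have := rd_ge1 w; have := rb_ge0 w; have := rc_ge0 w;
  rewrite /g12; nra.
Qed.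

Lemma n12_ge0 w : 0 <= n12 w.
Proof. by rewrite /n12 addr_ge0 ?mulr_ge0. Qed.

Lemma n11_ge1 w : 1 <= n11 w.
Proof. by have := ra_ge1 w; have := sqr_ge0 (rb w); rewrite /n11; nra. Qed.
Lemma n22_ge1 w : 1 <= n22 w.
Proof. by have := rd_ge1 w; have := sqr_ge0 (rc w); rewrite /n22; nra. Qed.

(** Each letter put in front adds [n11] or [n22], hence at least 1, to [n12]. Through [al_le] this
    makes the cells of long words narrow. *)
Lemma n12_ge w : (size w)%:R <= n12 w.
Proof.
elim: w => [|b w IH]; first exact: n12_ge0.
have [e1 e2 e3 e4] := r_cons b w.
rewrite /= -natr1 /n12 e1 e2 e3 e4.
have := n11_ge1 w; have := n22_ge1 w; move: IH; rewrite /n11 /n12 /n22.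
by case: b {e1 e2 e3 e4}; nra.
Qed.

(** This is the trace of gamma^T gamma times M M^T, with gamma attached to [w] and M to [u]: the
    norm of a product sees only these two Gram matrices. *)
Lemma gT_cat w u : gT (w ++ u) = g11 w * n11 u + 2 * g12 w * n12 u + g22 w * n22 u.
Proof.
rewrite /gT /g11 /g12 /g22; have [-> -> -> ->] := r_cat w u.
by rewrite /n11 /n12 /n22; ring.
Qed.

Lemma gT_ge w u :
  (ra w + rc w) ^+ 2 * n11 u + (rb w + rd w) ^+ 2 * n22 u <= gT (w ++ u).
Proof.
rewrite gT_cat; have := n12_ge0 u; have := g12_ge1 w.
have := n11_ge1 u; have := n22_ge1 u; rewrite /g11 /g22.
have := sqr_ge0 (ra w); have := sqr_ge0 (rb w); nra.
Qed.

(** The elements of squared norm at most [X] whose word ends with [u], listed by the remaining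
    prefix [w]: the cell of [u]. *)
Definition ball u X := [set w | gT (w ++ u) <= X].
Definition N u X : R := (cnt (ball u X))%:R.

Lemma le_sqrt x y : 0 <= x -> x ^+ 2 <= y -> x <= Num.sqrt y.
Proof. by move=> x0 xy; rewrite -(ger0_norm x0) -sqrtr_sqr ler_wsqrtr. Qed.

(** By [gT_ge] the second row of the gamma of [w] lies in a box with sides sqrt(X / n11) and sqrt(X
    / n22), and this row determines [w]. *)
Lemma N_trivial u X : 0 <= X ->
  N u X <= X / Num.sqrt (n11 u * n22 u) /\ finite_set (ball u X).
Proof.
move=> X0; have n1 := n11_ge1 u; have n2 := n22_ge1 u.
have inj : {in ball u X &, forall v w : seq bool,
  (wA v + wC v = wA w + wC w)%N -> (wB v + wD v = wB w + wD w)%N -> v = w}.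
  by move=> v w _ _; exact: row_inj.
have [] := @cnt_box R _ (ball u X) _ _ (Num.sqrt (X / n11 u)) (Num.sqrt (X / n22 u))
   _ _ _ inj; rewrite ?sqrtr_ge0 //.
- move=> w wX; have le1 := le_trans (gT_ge w u) wX.
  rewrite !addn_gt0 wA_gt0 wD_gt0 orbT !natrD; split => //.
    apply: le_sqrt; first by rewrite addr_ge0.
    rewrite ler_pdivlMr; last by lra.
    by apply: le_trans le1; rewrite lerDl mulr_ge0 ?sqr_ge0 //; lra.
  apply: le_sqrt; first by rewrite addr_ge0.
  rewrite ler_pdivlMr; last by lra.
  by apply: le_trans le1; rewrite lerDr mulr_ge0 ?sqr_ge0 //; lra.
- rewrite -/(N u X) -sqrtrM ?divr_ge0 //; last by lra.
  move=> le1 fb; split => //; apply: le_trans le1 _.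
  rewrite mulf_div sqrtrM ?mulr_ge0 // -expr2 sqrtr_sqr ger0_norm // sqrtrV //.
  by rewrite mulr_ge0 //; lra.
Qed.

Lemma ball_finite u X : finite_set (ball u X).
Proof.
have [X0|X0] := leP 0 X; first by have [] := N_trivial u X0.
rewrite (_ : ball u X = set0) //; apply/seteqP; split => // w wX.
have := le_trans (gT_ge w u) wX; have := n11_ge1 u; have := n22_ge1 u.
by have := sqr_ge0 (ra w + rc w); have := sqr_ge0 (rb w + rd w); nra.
Qed.

Lemma N_ge0 u X : 0 <= N u X. Proof. by []. Qed.


Definition rx w : R := (wX w)%:R.
Definition ry w : R := (wY w)%:R.
Lemma rxE w : rx w = ra w + rb w. Proof. by rewrite /rx natrD. Qed.
Lemma ryE w : ry w = rc w + rd w. Proof. by rewrite /ry natrD. Qed.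
Lemma rx_ge1 w : 1 <= rx w. Proof. by rewrite ler1n wX_gt0. Qed.
Lemma ry_ge1 w : 1 <= ry w. Proof. by rewrite ler1n wY_gt0. Qed.

(** The squared length of gamma (1, 1)^T. Thus [P X] counts primitive vectors in a sector of angle
    pi/4 and radius sqrt X. *)
Definition xyT w := rx w ^+ 2 + (rx w + ry w) ^+ 2.
Definition Pset X := [set w | xyT w <= X].
Definition P X : R := (cnt (Pset X))%:R.

Lemma P_trivial X : 0 <= X -> P X <= X /\ finite_set (Pset X).
Proof.
move=> X0.
have inj : {in Pset X &, forall v w : seq bool, wX v = wX w -> wY v = wY w -> v = w}.
  move=> v w _ _ e1 e2.
  by have [//|//|||_ //] := @Calkin_Wilf_inj 1%N 1%N v w; rewrite ?e1 ?e2.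
have [] := @cnt_box R _ (Pset X) _ _ (Num.sqrt X) (Num.sqrt X) _ _ _ inj;
  rewrite ?sqrtr_ge0 //.
- move=> w; rewrite /Pset /xyT /= -/(rx w) -/(ry w) wX_gt0 wY_gt0 => wX.
  by have := rx_ge1 w; have := ry_ge1 w => *; split => //; apply: le_sqrt; nra.
- by rewrite -expr2 sqr_sqrtr.
Qed.

Lemma Pset_finite X : finite_set (Pset X).
Proof.
have [X0|X0] := leP 0 X; first by have [] := P_trivial X0.
rewrite (_ : Pset X = set0) //; apply/seteqP; split => // w; rewrite /Pset /xyT /=.
by have := sqr_ge0 (rx w); have := sqr_ge0 (rx w + ry w); lra.
Qed.

(** If both rows of the matrix of [u] are close to (x, y), that matrix is close to the rank one
    matrix (1, 1)^T (x, y), and [gT (w ++ u)] is close to [xyT w] times x^2 + y^2. Entrywise lower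
    bounds on the rows give one inequality here, upper bounds give the other in [N_good_ge]. *)
Lemma N_good_le u X x y : 0 <= x -> 0 <= y -> x <= ra u -> x <= rc u ->
  y <= rb u -> y <= rd u -> 0 < x ^+ 2 + y ^+ 2 ->
  N u X <= P (X / (x ^+ 2 + y ^+ 2)).
Proof.
move=> x0 y0 xa xc yb yd q0; rewrite ler_nat; apply: cnt_le (Pset_finite _) _ => w.
rewrite /ball /Pset /= => wX; rewrite ler_pdivlMr //; apply: le_trans wX.
rewrite gT_cat /xyT rxE ryE /g11 /g12 /g22 /n11 /n12 /n22.
set a := ra w; set b := rb w; set c := rc w; set d := rd w.
have [a0 b0 c0 d0] : [/\ 0 <= a, 0 <= b, 0 <= c & 0 <= d] by [].
have h (p q : R) : 0 <= p -> 0 <= q ->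
  (p + q) ^+ 2 * (x ^+ 2 + y ^+ 2) <=
  (p * ra u + q * rc u) ^+ 2 + (p * rb u + q * rd u) ^+ 2.
  move=> p0 q0'; rewrite mulrDr -!exprMn; apply: lerD; rewrite ler_sqr ?nnegrE ?addr_ge0 ?mulr_ge0 //;
    first [by rewrite addr_ge0 | nra].
have := h a b a0 b0; have := h (a + c) (b + d); rewrite !addr_ge0 // => /(_ isT isT).
by lra.
Qed.

Lemma N_good_ge u X x y : ra u <= x -> rc u <= x ->
  rb u <= y -> rd u <= y -> P (X / (x ^+ 2 + y ^+ 2)) <= N u X.
Proof.
move=> xa xc yb yd; rewrite ler_nat; apply: cnt_le (ball_finite _ _) _ => w.
have x0 : 1 <= x by apply: le_trans (ra_ge1 u) xa.
rewrite /ball /Pset /= ler_pdivlMr; last by have := sqr_ge0 y; nra.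
apply: le_trans; rewrite gT_cat /xyT rxE ryE /g11 /g12 /g22 /n11 /n12 /n22.
set a := ra w; set b := rb w; set c := rc w; set d := rd w.
have [a0 b0 c0 d0] : [/\ 0 <= a, 0 <= b, 0 <= c & 0 <= d] by [].
have y0 : 0 <= y by apply: le_trans yb.
have h (p q : R) : 0 <= p -> 0 <= q ->
  (p * ra u + q * rc u) ^+ 2 + (p * rb u + q * rd u) ^+ 2 <=
  (p + q) ^+ 2 * (x ^+ 2 + y ^+ 2).
  move=> p0 q0'; rewrite mulrDr -!exprMn; apply: lerD; rewrite ler_sqr ?nnegrE ?addr_ge0 ?mulr_ge0 ?addr_ge0 //;
    first [by rewrite addr_ge0 | nra].
have := h a b a0 b0; have := h (a + c) (b + d); rewrite !addr_ge0 // => /(_ isT isT).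
by lra.
Qed.

Definition ballS (S : set (seq bool)) u X := ball u X `&` [set w | S (w ++ u)].
Definition NS S u X : R := (cnt (ballS S u X))%:R.

Lemma ballS_finite S u X : finite_set (ballS S u X).
Proof. by apply: sub_finite_set (ball_finite u X) => w []. Qed.

(** The prefix [w] is either empty, which costs at most 1, or its last letter can be moved to the
    front of the suffix [u]. *)
Lemma NS_split S u X : `|NS S u X - (NS S (false :: u) X + NS S (true :: u) X)| <= 1.
Proof.
pose S0 := [set w : seq bool | w = [::] /\ (gT u <= X /\ S u)].
have injr b : injective (rcons^~ b : seq bool -> seq bool) by move=> s t /rcons_inj[].
have imf b : finite_set ((rcons^~ b) @` ballS S (b :: u) X).
  exact/finite_image/ballS_finite.
have fS : finite_set S0 by apply: sub_finite_set (finite_set1 [::]) => w [->].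
have E : ballS S u X = S0 `|` ((rcons^~ false) @` ballS S (false :: u) X `|`
   (rcons^~ true) @` ballS S (true :: u) X).
  apply/seteqP; split => w; rewrite /ballS /ball /=.
    case: (lastP w) => [|s b]; first by left.
    by rewrite cat_rcons => h; right; case: b h => h; [right|left]; exists s.
  by case=> [[->]//|[|] [s]]; rewrite /ballS /ball /= => h <-; rewrite cat_rcons.
have c1 : cnt (ballS S u X) = (cnt S0 + (cnt (ballS S (false :: u) X) + cnt (ballS S (true :: u) X)))%N.
  rewrite E !cntU ?cnt_image //; try by [exact: ballS_finite | move=> ? ? _ _ /injr |
      rewrite finite_setU].
    by apply/seteqP; split => // w [[s _ <-] [t _]] /rcons_inj[].
  by apply/seteqP; split => // w [[-> _]] [] [s _]; case: s.
have c2 : (cnt S0 <= 1)%N by rewrite -(cnt1 ([::] : seq bool)); apply: cnt_le => // w [->].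
rewrite /NS c1 !natrD -addrA; move: c2; rewrite -(ler_nat R).
by rewrite ler_norml => c2; have : 0 <= (cnt S0)%:R :> R by []; lra.
Qed.

Lemma N_split u X : `|N u X - (N (false :: u) X + N (true :: u) X)| <= 1.
Proof.
have e v : N v X = NS setT v X.
  by rewrite /N /NS /ballS (_ : [set w | setT _] = setT) ?setIT //; apply/seteqP; split.
by rewrite !e; exact: NS_split.
Qed.

(** * Angles between the rows of a matrix *)

Lemma sin_le x : 0 <= x -> sin x <= x.
Proof.
rewrite le_eqVlt => /predU1P[<-|x0]; first by rewrite sin0.
have [|c _] := @MVT R sin cos 0 x x0.
  by apply: continuous_subspaceT => z; exact: continuous_sin.
by rewrite sin0 !subr0 => ->; have := cos_le1 c; nra.
Qed.

Lemma atan_le x : 0 <= x -> atan x <= x.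
Proof.
rewrite le_eqVlt => /predU1P[<-|x0]; first by rewrite atan0.
have [|c _] := @MVT R atan (fun z => (1 + z ^+ 2)^-1) 0 x x0.
  by apply: continuous_subspaceT => z; exact: continuous_atan.
rewrite atan0 !subr0 => ->; apply: ler_piMl; first exact: ltW.
by rewrite invf_le1; have := sqr_ge0 c; lra.
Qed.

Lemma le_tan x : 0 <= x < pi / 2 -> x <= tan x.
Proof.
move=> /andP[x0 xpi]; rewrite -{1}(@tanK R x); last first.
  by rewrite in_itv /= xpi andbT; have := pi_gt0 R; lra.
apply: atan_le; rewrite /tan divr_ge0 //.
  by apply: sin_ge0_pi; rewrite x0; have := pi_gt0 R; lra.
by apply: cos_ge0_pihalf; rewrite (ltW xpi) andbT; have := pi_gt0 R; lra.
Qed.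

(** The polar angle of (x, y), for y >= 0 and (x, y) nonzero. *)
Definition ang x y := acos (x / Num.sqrt (x ^+ 2 + y ^+ 2)).

Lemma ang_cos_sin x y : 0 <= x -> 0 <= y -> 0 < x ^+ 2 + y ^+ 2 ->
  [/\ cos (ang x y) = x / Num.sqrt (x ^+ 2 + y ^+ 2),
      sin (ang x y) = y / Num.sqrt (x ^+ 2 + y ^+ 2),
      0 <= ang x y & ang x y <= pi / 2].
Proof.
move=> x0 y0 q0; set s := Num.sqrt _.
have s0 : 0 < s by rewrite sqrtr_gt0.
have s2 : s ^+ 2 = x ^+ 2 + y ^+ 2 by rewrite sqr_sqrtr // ltW.
have xs : 0 <= x / s <= 1.
  by rewrite (divr_ge0 x0 (ltW s0)) /= ler_pdivrMr // mul1r -ler_sqr ?nnegrE ?(ltW s0) // s2 lerDl sqr_ge0.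
have xs1 : -1 <= x / s <= 1 by lra.
have c : cos (ang x y) = x / s by rewrite acosK // in_itv.
have g : 0 <= ang x y by exact: acos_ge0.
split=> //.
  rewrite /ang -/s sin_acos // expr_div_n s2.
  rewrite (_ : 1 - _ = (y / s) ^+ 2); last first.
    by rewrite expr_div_n s2; field; lra.
  by rewrite sqrtr_sqr ger0_norm // divr_ge0 // ltW.
rewrite leNgt; apply/negP => h; have := @ltr_cos R (pi / 2) (ang x y).
rewrite !in_itv /= h c cos_pihalf; have := acos_lepi xs1; have := pi_gt0 R => p0 al.
by rewrite g al => /(_ _ isT); lra.
Qed.

Lemma ang_sinB x y x' y' : 0 <= x -> 0 <= y -> 0 < x ^+ 2 + y ^+ 2 ->
  0 <= x' -> 0 <= y' -> 0 < x' ^+ 2 + y' ^+ 2 ->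
  sin (ang x' y' - ang x y) = (x * y' - y * x') /
    (Num.sqrt (x ^+ 2 + y ^+ 2) * Num.sqrt (x' ^+ 2 + y' ^+ 2)).
Proof.
move=> h1 h2 h3 h4 h5 h6; have [c s _ _] := ang_cos_sin h1 h2 h3.
have [c' s' _ _] := ang_cos_sin h4 h5 h6.
rewrite sinB c s c' s'; field.
by rewrite !lt0r_neq0 // sqrtr_gt0.
Qed.

Lemma angB_ge x y x' y' : 0 <= x -> 0 <= y -> 0 < x ^+ 2 + y ^+ 2 ->
  0 <= x' -> 0 <= y' -> 0 < x' ^+ 2 + y' ^+ 2 -> 0 <= x * y' - y * x' ->
  (x * y' - y * x') / (Num.sqrt (x ^+ 2 + y ^+ 2) * Num.sqrt (x' ^+ 2 + y' ^+ 2))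
  <= ang x' y' - ang x y.
Proof.
move=> h1 h2 h3 h4 h5 h6 d0; rewrite -ang_sinB //.
have [_ _ a0 a1] := ang_cos_sin h1 h2 h3; have [_ _ a0' a1'] := ang_cos_sin h4 h5 h6.
have p0 := pi_gt0 R.
have s0 : 0 <= sin (ang x' y' - ang x y).
  by rewrite ang_sinB // divr_ge0 // mulr_ge0 // sqrtr_ge0.
have [le|lt] := leP 0 (ang x' y' - ang x y); first exact: sin_le.
have : 0 < sin (ang x y - ang x' y') by apply: sin_gt0_pi; lra.
by rewrite -opprB sinN; lra.
Qed.

Definition al1 u := ang (ra u) (rb u).
Definition al2 u := ang (rc u) (rd u).
(** The angle between the two rows of the matrix of [u], which serves as the width of its cell. *)
Definition al u := al2 u - al1 u.

Lemma al1P u : [/\ cos (al1 u) = ra u / Num.sqrt (n11 u),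
  sin (al1 u) = rb u / Num.sqrt (n11 u), 0 <= al1 u & al1 u <= pi / 2].
Proof. by apply: ang_cos_sin => //; rewrite -/(n11 u); have := n11_ge1 u; lra. Qed.
Lemma al2P u : [/\ cos (al2 u) = rc u / Num.sqrt (n22 u),
  sin (al2 u) = rd u / Num.sqrt (n22 u), 0 <= al2 u & al2 u <= pi / 2].
Proof. by apply: ang_cos_sin => //; rewrite -/(n22 u); have := n22_ge1 u; lra. Qed.

(** Since the determinant is 1, the sine of [al u] is the inverse of the product of the two row
    lengths, and sin x <= x. In [al_le] the tangent is 1 / n12, and x <= tan x. *)
Lemma al_ge u : (Num.sqrt (n11 u * n22 u))^-1 <= al u.
Proof.
have n1 := n11_ge1 u; have n2 := n22_ge1 u.
rewrite sqrtrM; last by lra.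
rewrite -[leLHS]mul1r -(r_det u); apply: angB_ge => //; first by rewrite -/(n11 u); lra.
  by rewrite -/(n22 u); lra.
by rewrite r_det.
Qed.

Lemma al_gt0 u : 0 < al u.
Proof.
apply: lt_le_trans (al_ge u); have := n11_ge1 u; have := n22_ge1 u => *.
by rewrite invr_gt0 sqrtr_gt0; nra.
Qed.

Lemma al_le u : 0 < n12 u -> al u <= (n12 u)^-1.
Proof.
move=> p0; have n1 := n11_ge1 u; have n2 := n22_ge1 u.
have [c1 s1 a1 b1] := al1P u; have [c2 s2 a2 b2] := al2P u.
have q1 : 0 < Num.sqrt (n11 u) by rewrite sqrtr_gt0; lra.
have q2 : 0 < Num.sqrt (n22 u) by rewrite sqrtr_gt0; lra.
have C : cos (al u) = n12 u / (Num.sqrt (n11 u) * Num.sqrt (n22 u)).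
  by rewrite /al cosB c1 c2 s1 s2 /n12; field; rewrite !lt0r_neq0.
have S : sin (al u) = 1 / (Num.sqrt (n11 u) * Num.sqrt (n22 u)).
  by rewrite /al sinB c1 c2 s1 s2 -{1}(r_det u); field; rewrite !lt0r_neq0.
have cp : 0 < cos (al u) by rewrite C divr_gt0 // mulr_gt0.
have := le_tan; move=> /(_ (al u)); rewrite /tan C S.
rewrite (_ : _ / _ / _ = (n12 u)^-1); last by field; rewrite !lt0r_neq0.
apply; rewrite ltW ?al_gt0 //= lt_neqAle; apply/andP; split.
  by apply/eqP => h; move: cp; rewrite h cos_pihalf ltxx.
by rewrite /al; lra.
Qed.

(** A letter put in front replaces one row by the sum of the two rows, whose ray cuts the sector in
    two. *)
Lemma al_cons u : al u = al (false :: u) + al (true :: u).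
Proof.
rewrite /al /al1 /al2; have [-> -> -> ->] := r_cons false u.
have [-> -> -> ->] := r_cons true u; lra.
Qed.

Lemma al_nil : al [::] = pi / 2.
Proof.
rewrite /al /al1 /al2 /ang /ra /rb /rc /rd !w_nil /=.
by rewrite expr0n expr1n /= addr0 sqrtr1 divr1 acos1 mul0r acos0 subr0.
Qed.

(* The density [pi / 8] of the lattice points, divided by [zeta(2) = pi^2 / 6]. *)
Definition k0 : R := 3 / (4 * pi).

Lemma k0_gt0 : 0 < k0.
Proof. by rewrite divr_gt0 // mulr_gt0 // pi_gt0. Qed.

Lemma near_scale (Q : R -> Prop) t : 0 < t ->
  (\forall X \near +oo, Q X) -> \forall X \near +oo, Q (X * t).
Proof.
move=> t0 [M [Mr QM]]; exists (M / t); split; first by rewrite num_real.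
by move=> X MX; apply: QM; rewrite -ltr_pdivrMr.
Qed.

(** * The value of zeta(2) and primitive lattice points *)

(** The identity 4 / sin^2 (2y) = 1 / sin^2 y + 1 / cos^2 y. Iterated from the angle pi/2 it gives
    the exact sum [basel_sin], whence an elementary evaluation of zeta(2). *)
Lemma inv_sin_sqr_half x : sin x != 0 ->
  (sin x ^+ 2)^-1 = ((sin (x / 2) ^+ 2)^-1 + (sin (pi / 2 - x / 2) ^+ 2)^-1) / 4.
Proof.
have {1 2}-> : x = x / 2 *+ 2 by rewrite mulr2n; lra.
rewrite sin_mulr2n sinB sin_pihalf cos_pihalf mul1r mul0r subr0.
have := cos2Dsin2 (x / 2); set s := sin _; set c := cos _ => E nz.
have c0 : c != 0 by apply: contraNneq nz => ->; rewrite mul0r mul0rn.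
have s0 : s != 0 by apply: contraNneq nz => ->; rewrite mulr0 mul0rn.
rewrite mulr2n; apply: (@mulIf _ (4 * c ^+ 2 * s ^+ 2)); first by rewrite !mulf_neq0 ?expf_neq0.
have -> : c * s + c * s = 2 * c * s by ring.
transitivity (1 : R); first by field; rewrite ?c0 ?s0.
by rewrite -[LHS]E; field; rewrite ?c0 ?s0.
Qed.

Definition basel_arg n k : R := (2 * k%:R + 1) * pi / 2 ^+ (n + 2).

Lemma basel_arg_bnd n k : (k < 2 ^ n)%N -> 0 < basel_arg n k < pi / 2.
Proof.
move=> kn; have p0 := pi_gt0 R; have e0 : 0 < 2 ^+ n :> R by rewrite exprn_gt0.
have kn' : k%:R + 1 <= 2 ^+ n :> R by rewrite natr1 -natrX ler_nat.
have k0' : 0 <= k%:R :> R by [].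
have k1 : 0 < 2 * k%:R + 1 :> R by lra.
have e4 : 2 ^+ (n + 2) = 4 * 2 ^+ n :> R by rewrite exprD mulrC expr2; ring.
rewrite /basel_arg e4 divr_gt0 ?mulr_gt0 //= ltr_pdivrMr ?mulr_gt0 //; nra.
Qed.

Lemma basel_sin n : \sum_(k < 2 ^ n) (sin (basel_arg n k) ^+ 2)^-1 = 2 * 4 ^+ n.
Proof.
have p0 := pi_gt0 R.
elim: n => [|n IH].
  rewrite expn0 big_ord1 expr0 mulr1 /basel_arg mulr0 add0r mul1r.
  have h : pi / 2 ^+ (0 + 2) = pi / 2 / 2 :> R by rewrite /= expr2; field.
  have : sin (pi / 2) != 0 :> R by rewrite sin_pihalf oner_neq0.
  move/inv_sin_sqr_half; rewrite sin_pihalf expr1n invr1 h.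
  by rewrite (_ : pi / 2 - pi / 2 / 2 = pi / 2 / 2); lra.
have E : forall k : 'I_(2 ^ n), (sin (basel_arg n k) ^+ 2)^-1 =
   ((sin (basel_arg n.+1 k) ^+ 2)^-1 + (sin (basel_arg n.+1 (2 ^ n.+1 - k.+1)) ^+ 2)^-1) / 4.
  move=> k; rewrite inv_sin_sqr_half; last first.
    by apply/lt0r_neq0/sin_gt0_pi; have := basel_arg_bnd (ltn_ord k); lra.
  congr (((sin _ ^+ 2)^-1 + (sin _ ^+ 2)^-1) / 4).
    by rewrite /basel_arg addSn exprS; field; rewrite expf_neq0.
  rewrite /basel_arg natrB; last by rewrite expnS; have := ltn_ord k; lia.
  rewrite -natr1 natrX addSn !exprS exprD; field; rewrite expf_neq0 //.
rewrite (eq_bigr _ (fun k _ => E k)) -mulr_suml big_split /= in IH.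
have -> : \sum_(k < 2 ^ n.+1) (sin (basel_arg n.+1 k) ^+ 2)^-1 =
  \sum_(i < 2 ^ n) (sin (basel_arg n.+1 i) ^+ 2)^-1 +
  \sum_(i < 2 ^ n) (sin (basel_arg n.+1 (2 ^ n.+1 - i.+1)) ^+ 2)^-1.
  pose F k := (sin (basel_arg n.+1 k) ^+ 2)^-1.
  rewrite -(big_mkord xpredT F) -(big_mkord xpredT (fun i => F (2 ^ n.+1 - i.+1)%N)) -(big_mkord xpredT F).
  rewrite (@big_cat_nat _ _ _ (2 ^ n)%N) //=; last by rewrite leq_exp2l.
  congr (_ + _); rewrite [RHS]big_nat_rev /= -{1}[(2 ^ n)%N]add0n big_addn.
  rewrite (_ : (2 ^ n.+1 - 2 ^ n = 2 ^ n)%N); last by rewrite expnS; lia.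
  rewrite big_nat [RHS]big_nat; apply: eq_bigr => i /andP[_ i2]; congr F.
  by rewrite add0n expnS; lia.
by rewrite exprS; lra.
Qed.

(** From sin x <= x <= tan x, the number 1 / x^2 lies between 1 / sin^2 x - 1 and 1 / sin^2 x.
    Summed over the 2^n angles, the loss 2^n is small against the exact value 2 * 4^n. *)
Lemma basel_odd n : (pi : R) ^+ 2 / 16 * (2 - (2 ^+ n)^-1) <=
  \sum_(k < 2 ^ n) ((2 * k%:R + 1) ^+ 2)^-1 <= (pi ^+ 2 / 8 : R).
Proof.
have p0 := pi_gt0 R; have e0 : 0 < 2 ^+ n :> R by rewrite exprn_gt0.
have C : 0 < pi ^+ 2 / (16 * 4 ^+ n) :> R by rewrite divr_gt0 ?mulr_gt0 ?exprn_gt0.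
have E k : ((2 * k%:R + 1) ^+ 2)^-1 = pi ^+ 2 / (16 * 4 ^+ n) * (basel_arg n k ^+ 2)^-1 :> R.
  have -> : 4 ^+ n = (2 ^+ n) ^+ 2 :> R by rewrite -exprM mulnC exprM; congr (_ ^+ n); rewrite expr2; ring.
  have k0' : 0 <= k%:R :> R by [].
  rewrite /basel_arg exprD; field; rewrite !lt0r_neq0 //; lra.
have S := basel_sin n.
have four : 4 ^+ n = 2 ^+ n * 2 ^+ n :> R by rewrite -exprMn; congr (_ ^+ n); ring.
under eq_bigr => k _ do rewrite E.
rewrite -mulr_sumr; apply/andP; split.
  apply: le_trans (_ : pi ^+ 2 / (16 * 4 ^+ n) * (2 * 4 ^+ n - 2 ^+ n) <= _).
    by rewrite four le_eqVlt; apply/orP; left; apply/eqP; field; rewrite lt0r_neq0.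
  have -> : 2 ^+ n = \sum_(k < 2 ^ n) 1 :> R by rewrite sumr_const card_ord natrX.
  rewrite ler_pM2l // -S -sumrB.
  apply: ler_sum => k _; have := basel_arg_bnd (ltn_ord k); set a := basel_arg n k => /andP[a0 a1].
  have s0 : 0 < sin a by apply: sin_gt0_pi; lra.
  have c0 : 0 < cos a by apply: cos_gt0_pihalf; lra.
  have : a <= tan a by apply: le_tan; lra.
  rewrite /tan ler_pdivlMr // => h.
  rewrite lerBlDr -[leLHS]div1r ler_pdivrMr ?exprn_gt0 // mulrDl mul1r.
  rewrite -(cos2Dsin2 a) lerD2r mulrC ler_pdivlMr ?exprn_gt0 // -exprMn mulrC.
  by rewrite ler_sqr ?nnegrE ?mulr_ge0 // ltW.
apply: le_trans (_ : pi ^+ 2 / (16 * 4 ^+ n) * (2 * 4 ^+ n) <= _); last first.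
  by rewrite four le_eqVlt; apply/orP; left; apply/eqP; field; rewrite lt0r_neq0.
rewrite ler_pM2l // -S; apply: ler_sum => k _.
have := basel_arg_bnd (ltn_ord k); set a := basel_arg n k => /andP[a0 a1].
have s0 : 0 < sin a by apply: sin_gt0_pi; lra.
rewrite lef_pV2 ?posrE ?exprn_gt0 // ler_sqr ?nnegrE; [|exact: ltW|exact: ltW].
by apply: sin_le; exact: ltW.
Qed.

Definition zeta2 (m : nat) : R := \sum_(1 <= g < m.+1) (g%:R ^+ 2)^-1.

Lemma zeta2S k : zeta2 k.+1 = zeta2 k + (k.+1%:R ^+ 2)^-1.
Proof. by rewrite /zeta2 big_nat_recr. Qed.
Lemma zeta2_0 : zeta2 0 = 0. Proof. by rewrite /zeta2 big_geq. Qed.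

Lemma zeta2_double (m : nat) : zeta2 m.*2 = \sum_(k < m) ((2 * k%:R + 1) ^+ 2)^-1 + zeta2 m / 4.
Proof.
elim: m => [|m IH]; first by rewrite /zeta2 !big_geq // big_ord0 mul0r addr0.
rewrite doubleS !zeta2S IH big_ord_recr /=.
have m0 : 0 <= m%:R :> R by [].
rewrite -!natr1 -!addnn !natrD.
field; lra.
Qed.

Lemma zeta2_bnd n : (pi : R) ^+ 2 / 6 - pi ^+ 2 / 4 / 2 ^+ n <= zeta2 (2 ^ n) <= pi ^+ 2 / 6.
Proof.
have p0 : 4 <= pi ^+ 2 :> R by have := pi_ge2 R; nra.
elim: n => [|n IH].
  have := basel_odd 0; rewrite big_ord1 mulr0 add0r expr1n invr1.
  by rewrite expn0 /zeta2 big_nat1 expr1n invr1; lra.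
have := basel_odd n; rewrite expnS mul2n zeta2_double (exprS 2 n) invfM; move: IH.
move: (zeta2 _) (\sum_(_ < _) _) ((2 ^+ n)^-1) => z o i; lra.
Qed.

Lemma exp2_large x e : 0 <= x -> 0 < e -> exists n, x / 2 ^+ n <= e.
Proof.
move=> x0 e0; exists (Num.trunc (x / e)).+1.
rewrite ler_pdivrMr ?exprn_gt0 // [leRHS]mulrC -ler_pdivrMr //.
have /andP[_ /ltW h] := truncn_itv (divr_ge0 x0 (ltW e0)).
by apply: le_trans h _; rewrite -natrX ler_nat ltnW // ltn_expl.
Qed.

(** Comparison of the terms of zeta(2) from the third on with the telescoping 1/(k-1) - 1/k. It
    provides the contraction factor zeta(2) - 1 <= 3/4. *)
Lemma pi_sqr_bnd : pi ^+ 2 / 6 <= 7 / 4 :> R.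
Proof.
have Z (m : nat) : zeta2 m.+2 <= 7 / 4 - m.+2%:R^-1.
  elim: m => [|m IH].
    by rewrite !zeta2S zeta2_0 add0r expr1n invr1; lra.
  rewrite zeta2S.
  have m0 : 0 <= m%:R :> R by [].
  have : (m.+3%:R ^+ 2)^-1 <= m.+2%:R^-1 - m.+3%:R^-1 :> R.
    rewrite -!natr1 (_ : _ - _ = ((m%:R + 1 + 1) * (m%:R + 1 + 1 + 1))^-1); last by field; lra.
    by rewrite lef_pV2 ?posrE; nra.
  by move: IH; move: (m.+2%:R^-1) (m.+3%:R ^- 2) (m.+3%:R^-1) => *; lra.
apply/ler_addgt0Pr => e e0; have p0 := pi_ge2 R.
have q0 : 0 <= pi ^+ 2 / 4 :> R by rewrite divr_ge0 // sqr_ge0.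
have [n hn] := exp2_large q0 e0.
have := zeta2_bnd n.+1; have := Z (2 ^ n.+1 - 2)%N.
have n2 : (2 <= 2 ^ n.+1)%N by rewrite expnS leq_pmulr // expn_gt0.
have : 0 <= ((2 ^ n.+1 - 2).+2)%:R^-1 :> R by [].
rewrite -addn2 subnK // (exprS 2 n) invfM => i0 z1 z2; move: hn.
have : 0 <= pi ^+ 2 / 4 / 2 ^+ n :> R by rewrite divr_ge0.
by move: z1 z2 i0; move: (zeta2 _) ((2 ^ n.+1)%:R^-1) ((2 ^+ n)^-1) => *; lra.
Qed.

(** * Lattice points in a sector *)

Definition lattice X := [set t : nat * nat | [/\ (0 < t.1)%N, (0 < t.2)%N &
  (t.1%:R : R) ^+ 2 + (t.1 + t.2)%:R ^+ 2 <= X]].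

Lemma lattice_finite X : finite_set (lattice X).
Proof.
have [X0|X0] := leP 0 X; last first.
  rewrite (_ : lattice X = set0) //; apply/seteqP; split => // t [_ _].
  by have := sqr_ge0 (t.1%:R : R); have := sqr_ge0 ((t.1 + t.2)%:R : R); lra.
have [] // := @cnt_box R _ (lattice X) fst snd (Num.sqrt X) (Num.sqrt X);
  rewrite ?sqrtr_ge0 //.
  move=> [p q] [/= p0 q0 le]; rewrite p0 q0; move: le; rewrite natrD => le.
  have p1 : 0 <= p%:R :> R by []. have q1 : 0 <= q%:R :> R by [].
  by split => //; apply: le_sqrt => //; nra.
by move=> [p q] [p' q'] _ _ /= -> ->.
Qed.

Lemma cnt_nat_itv_ge (A : set nat) x y : 0 <= x ->
  finite_set A -> (forall n, x < n%:R -> n%:R <= y -> A n) ->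
  y - x - 1 <= (cnt A)%:R.
Proof.
move=> x0 fA hA; have [yx|xy] := leP y x; first by apply: le_trans (ler0n _ _); lra.
have y0 : 0 <= y by lra.
have /andP[x1 x2] := truncn_itv x0; have /andP[y1 y2] := truncn_itv y0.
have : (size (iota (Num.trunc x).+1 (Num.trunc y - Num.trunc x)) <= cnt A)%N.
  apply: uniq_leq_size; first exact: iota_uniq.
  move=> n; rewrite mem_iota in_fset_set // inE => /andP[n1 n2].
  apply: hA; first by apply: lt_le_trans x2 _; rewrite ler_nat.
  by apply: le_trans y1; rewrite ler_nat; have := le_truncn (ltW xy); lia.
rewrite size_iota -(ler_nat R) natrB; last exact/le_truncn/ltW.
by move: x2 y2; rewrite -!natr1; lra.
Qed.

Lemma sum_iota_lin (M : nat) x y :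
  \sum_(q <- iota 1 M) (q%:R * x + y) = M%:R * (M%:R + 1) / 2 * x + M%:R * y.
Proof.
elim: M => [|M IH]; first by rewrite big_nil !mul0r addr0.
have -> : iota 1 M.+1 = iota 1 M ++ [:: M.+1] by rewrite -{1}(addn1 M) iotaD.
by rewrite big_cat IH /= big_seq1 -natr1; field.
Qed.

Lemma div1sqr_le X z : 0 <= X -> X / (1 + z ^+ 2) <= X.
Proof.
move=> X0; have z0 := sqr_ge0 z; rewrite ler_pdivrMr; last by lra.
by rewrite mulrDr mulr1 lerDl mulr_ge0.
Qed.

Section Strip.
Variables (n i : nat) (X : R).
Hypotheses (n0 : (0 < n)%N) (ile : (i < n)%N) (X0 : 0 <= X).
(** With q = x + y, the strip collects the points with i/n < x/q <= (i+1)/n; the predecessor closes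
    the interval on the right. There x^2 + q^2 lies between q^2 (1 + (i/n)^2) and q^2 (1 +
    ((i+1)/n)^2), and each admissible q contributes q/n points up to O(1). So the squared range of q
    is between [hi] and [lo], and the count is half of it divided by n, up to O(sqrt X). *)
Let strip := lattice X `&` [set t | ((n * t.1).-1 %/ (t.1 + t.2))%N = i].
Let lo : R := X / (1 + (i%:R / n%:R) ^+ 2).
Let hi : R := X / (1 + (i.+1%:R / n%:R) ^+ 2).

Let n1' : 1 <= n%:R :> R. Proof. by rewrite ler1n. Qed.
Let lo0 : 0 <= lo. Proof. by rewrite divr_ge0 // addr_ge0 // sqr_ge0. Qed.
Let hi0 : 0 <= hi. Proof. by rewrite divr_ge0 // addr_ge0 // sqr_ge0. Qed.

Let mem_strip (x y : nat) : (0 < x)%N -> (0 < y)%N ->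
  (((n * x).-1 %/ (x + y))%N = i <->
  ((x + y)%:R * i%:R < n%:R * x%:R :> R /\ n%:R * x%:R <= (x + y)%:R * i.+1%:R :> R)).
Proof.
move=> x0 y0; rewrite -!natrM ltr_nat ler_nat.
have nx : (0 < n * x)%N by rewrite muln_gt0 n0.
have xy : (0 < x + y)%N by rewrite addn_gt0 x0.
split=> [<-|[h1 h2]].
  have := divn_eq (n * x).-1 (x + y); have := ltn_pmod (n * x).-1 xy.
  by set d := (_ %/ _)%N; set r := (_ %% _)%N => h1 h2; split; nia.
by apply/eqP; rewrite eqn_leq -ltnS ltn_divLR // leq_divRL //; apply/andP; split; nia.
Qed.

Let strip_finite : finite_set strip.
Proof. by apply: sub_finite_set (lattice_finite X) => t []. Qed.

Lemma strip_le : (cnt strip)%:R <= lo / (2 * n%:R) + 2 * Num.sqrt X.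
Proof.
have n1 : 1 <= n%:R :> R := n1'.
set m := Num.sqrt lo; have m0 : 0 <= m by exact: sqrtr_ge0.
have m2 : m ^+ 2 = lo by rewrite sqr_sqrtr.
have mX : m <= Num.sqrt X.
  by rewrite ler_wsqrtr // div1sqr_le.
have tr := truncn_itv m0; set M := Num.trunc m in tr.
rewrite (@cnt_fibers _ _ strip (fun t => t.1 + t.2)%N (iota 1 M)) ?iota_uniq //; last first.
  move=> [x y] [[/= x0 y0 le] /(mem_strip x0 y0)[h1 h2]].
  rewrite mem_iota addn_gt0 x0 /= add1n ltnS truncn_ge_nat // le_sqrt //.
  rewrite ler_pdivlMr; last by rewrite ltr_wpDr ?sqr_ge0.
  apply: le_trans le; rewrite mulrDr mulr1 [leRHS]addrC lerD2l -exprMn ler_sqr ?nnegrE ?mulr_ge0 //.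
  rewrite mulrA ler_pdivrMr; last by lra.
  by rewrite [leRHS]mulrC ltW.
rewrite natr_sum; apply: le_trans (_ : \sum_(q <- iota 1 M) (q%:R * n%:R^-1 + 1) <= _).
  apply: ler_sum => q _.
  have [] // := @cnt_nat_near R (fst @` (strip `&` (fun t => t.1 + t.2)%N @^-1` [set q]))
    (q%:R * (i%:R + 1 / 2) / n%:R) (q%:R / (2 * n%:R)).
  - move=> _ [[x y] [[[/= x0 y0 le] /(mem_strip x0 y0)[h1 h2]] /= xyq] <-] /=.
    rewrite xyq in h1 h2; rewrite -natr1 in h2.
    rewrite (_ : x%:R = n%:R * x%:R / n%:R); last by field; lra.
    rewrite invfM mulrA -mulrBl normrM [X in _ * X]ger0_norm ?invr_ge0 ?ler0n //.
    by apply: ler_wpM2r; rewrite ?invr_ge0 // ler_norml; lra.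
  - have fS : finite_set (strip `&` (fun t => t.1 + t.2)%N @^-1` [set q]).
      by apply: sub_finite_set strip_finite => t [].
    rewrite cnt_image //; last first.
      move=> [x y] [x' y'] /set_mem[_ /= e] /set_mem[_ /= e'] /= exx.
      by congr pair => //; lia.
    move=> h _; apply: le_trans h _; rewrite lerD2r le_eqVlt; apply/orP; left; apply/eqP.
    by field; lra.
rewrite sum_iota_lin mulr1 -m2.
have {tr} /andP[Mm _] := tr.
have M0 : 0 <= M%:R :> R by [].
have i1 : 0 <= (n%:R^-1 : R) <= 1 by rewrite invr_ge0 invf_le1; lra.
rewrite invfM; move: i1; set j : R := n%:R^-1 => /andP[j0 j1].
have : M%:R * (M%:R + 1) <= m * (m + 1) by apply: ler_pM; lra.
have := mulr_ge0 m0 j0 => mj0.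
have mj1 : m * j <= m by rewrite ler_piMr.
have mm : m * (m + 1) / 2 * j <= m ^+ 2 * (j / 2) + m / 2 by lra.
move=> h; have : M%:R * (M%:R + 1) / 2 * j <= m * (m + 1) / 2 * j.
  by rewrite ler_wpM2r // ler_pM2r.
lra.
Qed.

Lemma strip_ge : hi / (2 * n%:R) - 3 * Num.sqrt X - 3 <= (cnt strip)%:R.
Proof.
have n1 : 1 <= n%:R :> R := n1'.
set m := Num.sqrt hi; have m0 : 0 <= m by exact: sqrtr_ge0.
have m2 : m ^+ 2 = hi by rewrite sqr_sqrtr.
have mX : m <= Num.sqrt X.
  by rewrite ler_wsqrtr // div1sqr_le.
have tr := truncn_itv m0; set M := Num.trunc m in tr.
pose S := strip `&` [set t | (t.1 + t.2 <= M)%N].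
have fS : finite_set S by apply: sub_finite_set strip_finite => t [].
apply: le_trans (_ : (cnt S)%:R <= _); last by rewrite ler_nat; apply: cnt_le => // t [].
rewrite (@cnt_fibers _ _ S (fun t => t.1 + t.2)%N (iota 1 M)) ?iota_uniq //; last first.
  by move=> [x y] [[[/= x0 _ _] _] le]; rewrite mem_iota addn_gt0 x0 /= add1n ltnS.
rewrite natr_sum; apply: le_trans (_ : \sum_(q <- iota 1 M) (q%:R * n%:R^-1 + - 2) <= _); last first.
  rewrite !big_seq; apply: ler_sum => q; rewrite mem_iota add1n ltnS => /andP[q0 qM].
  pose Aq := [set x : nat | q%:R * i%:R / n%:R < x%:R :> R /\ x%:R <= q%:R * i.+1%:R / n%:R - 1 :> R].
  have q1 : 1 <= q%:R :> R by rewrite ler1n.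
  have in1 : i.+1%:R <= n%:R :> R by rewrite ler_nat.
  have AqS (x : nat) : Aq x -> [/\ (0 < x)%N, (x < q)%N & (strip `&` [set t | (t.1 + t.2 <= M)%N]) (x, (q - x)%N)].
    move=> [h1' h2'].
    have h1 : q%:R * i%:R / n%:R < x%:R :> R := h1'.
    have h2 : x%:R <= q%:R * i.+1%:R / n%:R - 1 :> R := h2'.
    have x0 : (0 < x)%N.
      by rewrite -(ltr_nat R); apply: le_lt_trans h1; rewrite divr_ge0 // mulr_ge0.
    have h3 : q%:R * i.+1%:R / n%:R <= q%:R :> R by rewrite ler_pdivrMr ?ler_wpM2l //; lra.
    have xq : (x < q)%N by rewrite -(ler_nat R) -natr1; lra.
    split => //; split; [split|by rewrite /= subnKC // ltnW].
      split; rewrite /= ?subn_gt0 // subnKC ?(ltnW xq) //.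
      have hx : x%:R <= q%:R * (i.+1%:R / n%:R) :> R by lra.
      have qm : q%:R <= m by rewrite -truncn_ge_nat.
      have : q%:R ^+ 2 <= hi by rewrite -m2 ler_sqr ?nnegrE.
      rewrite ler_pdivlMr; last by rewrite ltr_wpDr ?sqr_ge0.
      apply: le_trans; rewrite mulrDr mulr1 addrC lerD2l -exprMn ler_sqr ?nnegrE //.
    apply/mem_strip; rewrite ?subn_gt0 // subnKC ?(ltnW xq) //; split.
      by rewrite [ltRHS]mulrC -ltr_pdivrMr //; lra.
    by rewrite [leLHS]mulrC -ler_pdivlMr; lra.
  have fA : finite_set Aq.
    apply: (@sub_finite_set _ _ [set` iota 0 q]); last exact: finite_seq.
    by move=> x /AqS[_ xq _]; rewrite /= mem_iota.
  have := @cnt_nat_itv_ge Aq (q%:R * i%:R / n%:R) (q%:R * i.+1%:R / n%:R - 1) _ fA (fun _ => @conj _ _).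
  rewrite divr_ge0 ?mulr_ge0 // => /(_ isT) h.
  apply: le_trans (_ : (cnt Aq)%:R <= _).
    by apply: le_trans h; rewrite le_eqVlt; apply/orP; left; apply/eqP; rewrite -natr1; field; lra.
  rewrite ler_nat; apply: (@cnt_inj nat (nat * nat)%type Aq _ (fun x : nat => (x, (q - x)%N))).
  - by apply: sub_finite_set fS => t [].
  - by move=> x /AqS[_ xq h']; split => //=; rewrite subnKC // ltnW.
  - by move=> x y _ _ [].
rewrite sum_iota_lin -m2.
have {tr} /andP[Mm mM] := tr; rewrite -natr1 in mM.
have M0 : 0 <= M%:R :> R by [].
have i1 : 0 <= (n%:R^-1 : R) <= 1 by rewrite invr_ge0 invf_le1; lra.
rewrite invfM; move: i1; set j : R := n%:R^-1 => /andP[j0 j1].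
have h1 : m * (m - 1) <= M%:R * (M%:R + 1).
  by have [h|h] := leP 1 m; [rewrite mulrC; apply: ler_pM; lra|nra].
have h2 : m * (m - 1) / 2 * j <= M%:R * (M%:R + 1) / 2 * j.
  by rewrite ler_wpM2r // ler_pM2r.
have mj1 : m * j <= m by rewrite ler_piMr.
lra.
Qed.
End Strip.

Lemma near_sqrt (k e : R) : 0 < e -> \forall X \near +oo, k * Num.sqrt X <= e * X.
Proof.
move=> e0; near=> X.
have X0 : 0 < X by near: X; exact: nbhs_pinfty_gt.
have s0 : 0 < Num.sqrt X by rewrite sqrtr_gt0.
rewrite -[X in _ <= _ * X](sqr_sqrtr (ltW X0)) expr2 mulrA ler_pM2r //.
apply: le_trans (ler_norm _) _; rewrite -ler_pdivrMl //.
apply: le_sqrt; first by rewrite mulr_ge0 // invr_ge0 ltW.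
by near: X; apply: nbhs_pinfty_ge; exact: num_real.
Unshelve. all: by end_near. Qed.

Lemma near_cst (k e : R) : 0 < e -> \forall X \near +oo, k <= e * X.
Proof.
move=> e0; near=> X; rewrite -ler_pdivrMl //; near: X; apply: nbhs_pinfty_ge; exact: num_real.
Unshelve. all: by end_near. Qed.

Lemma atanB_bnd x y : 0 <= x -> x <= y ->
  (y - x) / (1 + y ^+ 2) <= atan y - atan x <= (y - x) / (1 + x ^+ 2).
Proof.
move=> x0; rewrite le_eqVlt => /predU1P[->|xy]; first by rewrite !subrr !mul0r lexx.
have [|c] := @MVT R atan (fun z => (1 + z ^+ 2)^-1) x y xy.
  by apply: continuous_subspaceT => z; exact: continuous_atan.
rewrite in_itv /= => /andP[xc cy] ->; rewrite [_^-1 * _]mulrC.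
have sq z : 0 < 1 + z ^+ 2 :> R by have := sqr_ge0 z; lra.
by rewrite !ler_pM2l ?subr_gt0 // !lef_pV2 ?posrE // !lerD2l !ler_sqr ?nnegrE; lra.
Qed.

Lemma riemann_atan (n : nat) : (0 < n)%N ->
  (pi : R) / 4 - n%:R^-1 <= \sum_(i < n) (1 + (i.+1%:R / n%:R) ^+ 2)^-1 / n%:R /\
  \sum_(i < n) (1 + (i%:R / n%:R) ^+ 2)^-1 / n%:R <= (pi : R) / 4 + n%:R^-1.
Proof.
move=> n0; have n1 : 1 <= n%:R :> R by rewrite ler1n.
pose h i : R := (1 + (i%:R / n%:R) ^+ 2)^-1 / n%:R.
have sq z : 1 <= 1 + z ^+ 2 :> R by have := sqr_ge0 z; lra.
have h0 i : 0 <= h i <= n%:R^-1.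
  have i0 : 0 <= ((1 + (i%:R / n%:R) ^+ 2)^-1 : R) <= 1.
    have s1 := sq (i%:R / n%:R); have s2 : 0 <= 1 + (i%:R / n%:R) ^+ 2 :> R by lra.
    by rewrite invr_ge0 s2 invf_le1 //; lra.
  rewrite /h; have : 0 <= n%:R^-1 :> R by [].
  by move: i0 => /andP[a0 a1] b0; rewrite mulr_ge0 // ler_piMl.
have T : \sum_(i < n) (atan (i.+1%:R / n%:R) - atan (i%:R / n%:R)) = pi / 4 :> R.
  rewrite -(big_mkord xpredT (fun i => atan (i.+1%:R / n%:R) - atan (i%:R / n%:R))).
  rewrite telescope_sumr // mul0r atan0 subr0 divff ?atan1 //.
  by rewrite pnatr_eq0 -lt0n.
have D (i : nat) : h i.+1 <= atan (i.+1%:R / n%:R) - atan (i%:R / n%:R) <= h i.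
  have d : i.+1%:R / n%:R - i%:R / n%:R = n%:R^-1 :> R by rewrite -natr1; field; lra.
  have := @atanB_bnd (i%:R / n%:R) (i.+1%:R / n%:R); rewrite d /h ![n%:R^-1 * _]mulrC.
  by apply; [rewrite divr_ge0|rewrite ler_pM2r ?invr_gt0 ?ltr0n // ler_nat].
have E : \sum_(i < n) h i - \sum_(i < n) h i.+1 <= n%:R^-1.
  rewrite -sumrB -(big_mkord xpredT (fun i => h i - h i.+1)).
  under eq_bigr do rewrite -opprB.
  rewrite sumrN telescope_sumr // opprB.
  by have /andP[] := h0 0%N; have /andP[] := h0 n; lra.
have U : \sum_(i < n) h i.+1 <= pi / 4 by rewrite -T; apply: ler_sum => i _; case/andP: (D i).
have L : pi / 4 <= \sum_(i < n) h i by rewrite -T; apply: ler_sum => i _; case/andP: (D i).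
by rewrite -/(h _); split; lra.
Qed.

(** Summing over the strips gives X/2 times a Riemann sum of 1 / (1 + z^2) on [0, 1], whose limit is
    pi/4. The number n of strips is fixed before X grows, so the errors O(n sqrt X) are
    negligible. *)
Lemma lattice_asymp e : 0 < e ->
  \forall X \near +oo, `|(cnt (lattice X))%:R - pi / 8 * X| <= e * X.
Proof.
move=> e0; pose n := (Num.trunc e^-1).+1.
have n0 : (0 < n)%N by [].
have n1 : 1 <= n%:R :> R by rewrite ler1n.
have ne : n%:R^-1 <= e.
  rewrite -[leRHS]invrK lef_pV2 ?posrE ?invr_gt0 ?ltr0n // ltW //.
  have ei : 0 <= e^-1 by rewrite invr_ge0 ltW.
  by have /andP[] := truncn_itv ei.
have [R1 R2] := riemann_atan n0; clearbody n.
have e4 : 0 < e / 4 by lra.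
near=> X.
have X0 : 0 < X by near: X; exact: nbhs_pinfty_gt.
have s1 : (3 * n%:R) * Num.sqrt X <= e / 4 * X by near: X; exact: near_sqrt.
have s2 : (3 * n%:R) <= e / 4 * X by near: X; exact: near_cst.
pose f (t : nat * nat) := ((n * t.1).-1 %/ (t.1 + t.2))%N.
have E : (cnt (lattice X))%:R = \sum_(i < n) (cnt (lattice X `&` f @^-1` [set (i : nat)]))%:R :> R.
  rewrite (@cnt_fibers _ _ _ f (iota 0 n)) ?iota_uniq //.
  - rewrite natr_sum -(big_mkord xpredT (fun i => (cnt (lattice X `&` f @^-1` [set i]))%:R)).
    by rewrite /index_iota subn0.
  - exact: lattice_finite.
  - move=> [x y] [/= x0 y0 _]; rewrite mem_iota /= add0n /f /= ltn_divLR ?addn_gt0 ?x0 //.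
    have nx : (0 < n * x)%N by rewrite muln_gt0 n0.
    by apply: (@leq_trans (n * x)); rewrite ?prednK // leq_mul2l leq_addr orbT.
have s0 : 0 <= Num.sqrt X by exact: sqrtr_ge0.
have up : (cnt (lattice X))%:R <= X / 2 * (pi / 4 + n%:R^-1) + 3 * n%:R * Num.sqrt X.
  rewrite E; apply: le_trans (_ : \sum_(i < n) (X / 2 * ((1 + (i%:R / n%:R) ^+ 2)^-1 / n%:R) + 2 * Num.sqrt X) <= _).
    apply: ler_sum => i _; apply: le_trans (strip_le n0 (ltn_ord i) (ltW X0)) _.
    by rewrite lerD2r invfM le_eqVlt; apply/orP; left; apply/eqP; ring.
  rewrite big_split /= -mulr_sumr sumr_const card_ord -[(_ * _) *+ n]mulr_natl lerD //.
    by rewrite ler_pM2l //; lra.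
  by have : 0 <= n%:R * Num.sqrt X by [rewrite mulr_ge0]; lra.
have lo : X / 2 * (pi / 4 - n%:R^-1) - 3 * n%:R * Num.sqrt X - 3 * n%:R <= (cnt (lattice X))%:R.
  rewrite E; apply: le_trans (_ : \sum_(i < n) (X / 2 * ((1 + (i.+1%:R / n%:R) ^+ 2)^-1 / n%:R) - (3 * Num.sqrt X + 3)) <= _).
    rewrite sumrB -mulr_sumr sumr_const card_ord -[(_ + _) *+ n]mulr_natl.
    have : X / 2 * (pi / 4 - n%:R^-1) <= X / 2 * \sum_(i < n) (1 + (i.+1%:R / n%:R) ^+ 2)^-1 / n%:R.
      by rewrite ler_pM2l //; lra.
    lra.
  apply: ler_sum => i _; apply: le_trans (strip_ge n0 (ltn_ord i) (ltW X0)).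
  by rewrite opprD addrA !lerD2r invfM le_eqVlt; apply/orP; left; apply/eqP; ring.
have : X / 2 * n%:R^-1 <= X / 2 * e by rewrite ler_pM2l //; lra.
by move: up lo s1 s2; move: (Num.sqrt X) (n%:R^-1) => *; rewrite ler_norml; apply/andP; split; lra.
Unshelve. all: by end_near. Qed.

Lemma coprime_XY w : gcdn (wX w) (wY w) = 1%N.
Proof.
elim: w => [|b w IH] //; rewrite wX_cons wY_cons; case: b.
  by rewrite gcdnC gcdnDr gcdnC.
by rewrite gcdnDl.
Qed.

Lemma lattice_gcd X (m : nat) : X <= m%:R ->
  (cnt (lattice X))%:R = \sum_(1 <= g < m.+1) P (X / g%:R ^+ 2) :> R.
Proof.
move=> Xm; rewrite (@cnt_fibers _ _ (lattice X) (fun t => gcdn t.1 t.2) (iota 1 m)) ?iota_uniq //.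
- rewrite natr_sum /index_iota subn1 big_seq [RHS]big_seq.
  apply: eq_bigr => g; rewrite mem_iota => /andP[g1 _]; congr (_%:R).
  have gR : 0 < g%:R :> R by rewrite ltr0n.
  rewrite -(@cnt_image _ _ (Pset (X / g%:R ^+ 2)) (fun w => (g * wX w, g * wY w)%N)); first last.
  + by move=> u v _ _ [e1 e2]; have [] := Calkin_Wilf_inj g1 g1 e1 e2.
  + exact: Pset_finite.
  congr cnt; apply/seteqP; split => [[x y] [[/= x0 y0 le] gE]|_ [w wX' <-]].
    have [h [w [h0 ex ey]]] := Calkin_Wilf_surj x0 y0.
    have gh : h = g by rewrite -gE ex ey -muln_gcdr coprime_XY muln1.
    subst h; exists w; last by rewrite ex ey.
    rewrite /Pset /xyT /= ler_pdivlMr ?exprn_gt0 //; apply: le_trans le.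
    by rewrite ex ey natrD !natrM /rx /ry le_eqVlt; apply/orP; left; apply/eqP; ring.
  split; last by rewrite /= -muln_gcdr coprime_XY muln1.
  split; rewrite /= ?muln_gt0 ?g1 ?wX_gt0 ?wY_gt0 //.
  move: wX'; rewrite /Pset /xyT /= ler_pdivlMr ?exprn_gt0 //; apply: le_trans.
  by rewrite natrD !natrM /rx /ry le_eqVlt; apply/orP; left; apply/eqP; ring.
- exact: lattice_finite.
- move=> [x y] [/= x0 y0 le]; rewrite mem_iota gcdn_gt0 x0 /= add1n ltnS.
  apply: (@leq_trans x); first by rewrite dvdn_leq // dvdn_gcdl.
  rewrite -(ler_nat R); apply: le_trans Xm; apply: le_trans le.
  have x1 : 1 <= x%:R :> R by rewrite ler1n.
  by have := sqr_ge0 ((x + y)%:R : R); nra.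
Qed.

Lemma zeta2_tail n (m : nat) : (2 ^ n <= m)%N ->
  \sum_((2 ^ n).+1 <= g < m.+1) (g%:R ^+ 2)^-1 <= pi ^+ 2 / 4 / 2 ^+ n :> R.
Proof.
move=> nm; have mm : (m <= 2 ^ m)%N by rewrite ltnW // ltn_expl.
have E (k : nat) : (2 ^ n <= k)%N ->
  \sum_((2 ^ n).+1 <= g < k.+1) (g%:R ^+ 2)^-1 = zeta2 k - zeta2 (2 ^ n).
  by move=> nk; rewrite /zeta2 [X in _ = X - _](@big_cat_nat _ _ _ (2 ^ n).+1) //= addrAC subrr add0r.
have mono (k : nat) : zeta2 k <= zeta2 k.+1 by rewrite zeta2S lerDl invr_ge0 sqr_ge0.
have Zm : zeta2 m <= zeta2 (2 ^ m).
  rewrite -(subnKC mm); elim: (_ - _)%N => [|k IH]; first by rewrite addn0.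
  by rewrite addnS; apply: le_trans IH (mono _).
by rewrite E //; have := zeta2_bnd n; have := zeta2_bnd m; lra.
Qed.

(* The lattice points with gcd [g] are counted by [P (X / g^2)], and the terms
   with [g >= 2] carry the weight [zeta(2) - 1 <= 3/4]. *)
Lemma P_asymp_step r : 0 <= r ->
  (forall e, 0 < e -> \forall X \near +oo, `|P X - k0 * X| <= (r + e) * X) ->
  forall e, 0 < e -> \forall X \near +oo, `|P X - k0 * X| <= (3 / 4 * r + e) * X.
Proof.
move=> r0 hr e e0; have kp := k0_gt0.
have q0 : 0 <= (1 + k0) * (pi ^+ 2 / 4) by rewrite mulr_ge0 ?divr_ge0 ?sqr_ge0 //; lra.
have e3 : 0 < e / 4 by lra.
(* Only the gcds up to K use the hypothesis, so that finitely many conditions on X are intersected.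
   Beyond K the trivial bound P Z <= Z and the small tail of zeta(2) suffice. *)
have [n hn] := exp2_large q0 e3; set K := (2 ^ n)%N.
have zK := zeta2_bnd n; rewrite -/K in zK.
have pb := pi_sqr_bnd.
have near1 : forall g : nat, (0 < g)%N -> \forall X \near +oo,
    `|P (X / g%:R ^+ 2) - k0 * (X / g%:R ^+ 2)| <= (r + e / 4) * (X / g%:R ^+ 2).
  move=> g g0; apply: (@near_scale (fun Z => `|P Z - k0 * Z| <= (r + e / 4) * Z)).
    by rewrite invr_gt0 exprn_gt0 // ltr0n.
  exact: hr.
have near2 : \forall X \near +oo, forall g : 'I_K, (0 < g.+1)%N ->
    `|P (X / g.+1%:R ^+ 2) - k0 * (X / g.+1%:R ^+ 2)| <= (r + e / 4) * (X / g.+1%:R ^+ 2).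
  apply: filter_forall => g; near do move=> _; exact: near1.
near=> X.
have X0 : 0 < X by near: X; exact: nbhs_pinfty_gt.
have lat : `|(cnt (lattice X))%:R - pi / 8 * X| <= e / 4 * X by near: X; exact: lattice_asymp.
have hg : forall g : 'I_K, (0 < g.+1)%N ->
    `|P (X / g.+1%:R ^+ 2) - k0 * (X / g.+1%:R ^+ 2)| <= (r + e / 4) * (X / g.+1%:R ^+ 2).
  by near: X; exact: near2.
pose m := (K + (Num.trunc X).+1)%N.
have Xm : X <= m%:R.
  have /andP[_ /ltW h] := truncn_itv (ltW X0); apply: le_trans h _.
  by rewrite ler_nat leq_addl.
have Km : (K <= m)%N by exact: leq_addr.
have K1 : (0 < K)%N by rewrite expn_gt0.
have L := lattice_gcd Xm; rewrite (@big_cat_nat _ _ _ K.+1) //= in L.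
rewrite big_ltn // expr1n divr1 in L.
have T : \sum_(K.+1 <= g < m.+1) P (X / g%:R ^+ 2) <= X * (pi ^+ 2 / 4 / 2 ^+ n).
  apply: le_trans (_ : \sum_(K.+1 <= g < m.+1) X * (g%:R ^+ 2)^-1 <= _).
    apply: ler_sum => g _; have [] := @P_trivial (X / g%:R ^+ 2) => //.
    by rewrite divr_ge0 ?sqr_ge0 // ltW.
  by rewrite -mulr_sumr ler_pM2l // zeta2_tail.
have T0 : 0 <= \sum_(K.+1 <= g < m.+1) P (X / g%:R ^+ 2) by apply: sumr_ge0.
have Z1 : zeta2 K = 1 + \sum_(2 <= g < K.+1) (g%:R ^+ 2)^-1.
  by rewrite /zeta2 big_ltn // expr1n invr1.
have M : `|\sum_(2 <= g < K.+1) P (X / g%:R ^+ 2) - k0 * X * (zeta2 K - 1)| <= (r + e / 4) * X * (zeta2 K - 1).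
  rewrite Z1 addrAC subrr add0r !mulr_sumr -sumrB.
  apply: le_trans (ler_norm_sum _ _ _) _; rewrite big_nat [leRHS]big_nat.
  apply: ler_sum => g /andP[g2 gK]; rewrite -![_ * X * _]mulrA.
  case: g g2 gK => // g _; rewrite ltnS => gK.
  exact: (hg (Ordinal gK)).
have k0z : k0 * (pi ^+ 2 / 6) = pi / 8 by rewrite /k0; have := pi_gt0 R; move: (pi : R) => p p0; field; rewrite gt_eqF.
set Z := zeta2 K in M zK *; set d := pi ^+ 2 / 4 / 2 ^+ n in T zK hn *.
have d4 : (1 + k0) * d <= e / 4 by rewrite /d mulrA; exact: hn.
have z1 : Z - 1 <= 3 / 4 by case/andP: zK => _ zK2; clear -zK2 pb; lra.
have z0 : 0 <= Z - 1.
  by rewrite /Z Z1 addrAC subrr add0r sumr_ge0 // => g _; rewrite invr_ge0 sqr_ge0.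
have M' : `|\sum_(2 <= g < K.+1) P (X / g%:R ^+ 2) - k0 * X * (Z - 1)| <= (3 / 4 * r + e / 4) * X.
  apply: le_trans M _; rewrite mulrAC ler_pM2r //.
  by have := ler_wpM2l r0 z1; have := ler_wpM2l (ltW e3) z1; clear -e0; lra.
have j1 : 0 <= k0 * X * (pi ^+ 2 / 6 - Z) <= k0 * X * d.
  have kX : 0 < k0 * X by rewrite mulr_gt0.
  by case/andP: zK => zK1 zK2; rewrite mulr_ge0 ?(ltW kX) ?subr_ge0 // ler_pM2l //=; clear -zK1; lra.
have j2 : k0 * X * (pi ^+ 2 / 6) = pi / 8 * X by rewrite -k0z; ring.
have j3 : (1 + k0) * d * X <= e / 4 * X by rewrite ler_pM2r.
have d0 : 0 <= X * d by rewrite mulr_ge0 ?(ltW X0) // divr_ge0 ?exprn_ge0 // divr_ge0 ?sqr_ge0.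
move: lat M' L; rewrite !ler_norml.
move: (\sum_(2 <= g < _) _) (\sum_(_ <= g < _) _) T T0 => S1 S2 T T0 lat M' L.
clear -lat M' L T T0 j1 j2 j3 d0; apply/andP; split; lra.
Unshelve. all: by end_near. Qed.

Lemma P_asymp e : 0 < e -> \forall X \near +oo, `|P X - k0 * X| <= e * X.
Proof.
move=> e0; have kp := k0_gt0.
have H (n : nat) : forall e, 0 < e -> \forall X \near +oo,
    `|P X - k0 * X| <= ((3 / 4) ^+ n * (1 + k0) + e) * X.
  elim: n => [|n IH].
    move=> e' e'0; near=> X.
    have X0 : 0 < X by near: X; exact: nbhs_pinfty_gt.
    have [PX _] := P_trivial (ltW X0); have : 0 <= P X by [].
    by rewrite expr0 mul1r ler_norml => ?; apply/andP; split; nra.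
  have r0 : 0 <= (3 / 4) ^+ n * (1 + k0) by rewrite mulr_ge0 ?exprn_ge0 //; lra.
  by have := P_asymp_step r0 IH; rewrite mulrA -exprS.
have [n hn] : exists n : nat, (3 / 4) ^+ n * (1 + k0) <= e / 2.
  have c : (fun n => (3 / 4 : R) ^+ n) @ \oo --> (0 : R).
    by apply: cvg_expr; rewrite ger0_norm; lra.
  have d0 : 0 < e / 2 / (1 + k0) by rewrite !divr_gt0 //; lra.
  have /cvgrPdist_le /(_ _ d0) [N' _ hN] := c.
  exists N'; have p34 : 0 <= (3 / 4) ^+ N' :> R by apply: exprn_ge0; lra.
  have := hN N' (leqnn N'); rewrite /= sub0r normrN ger0_norm //.
  by rewrite ler_pdivlMr //; lra.
have e2 : 0 < e / 2 by lra.
near=> X.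
have X0 : 0 < X by near: X; exact: nbhs_pinfty_gt.
apply: le_trans (_ : ((3 / 4) ^+ n * (1 + k0) + e / 2) * X <= _).
  by near: X; exact: H.
by rewrite ler_pM2r //; lra.
Unshelve. all: by end_near. Qed.

(** * Equidistribution of the cells *)

(** The limsup of |N u X / X - k0 al u| at +oo is at most [a]. *)
Definition dev u (a : R) := forall e, 0 < e ->
  \forall X \near +oo, `|N u X - k0 * al u * X| <= (a + e) * X.

Lemma dev_le u a b : a <= b -> dev u a -> dev u b.
Proof.
move=> ab ua e e0; near=> X.
have X0 : 0 < X by near: X; exact: nbhs_pinfty_gt.
apply: le_trans (_ : (a + e) * X <= _); last by rewrite ler_pM2r //; lra.
by near: X; exact: ua.
Unshelve. all: by end_near. Qed.

Lemma dev_trivial u : dev u ((1 + k0) * al u).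
Proof.
move=> e e0; near=> X.
have X0 : 0 < X by near: X; exact: nbhs_pinfty_gt.
have [le1 _] := N_trivial u (ltW X0).
have le2 : N u X <= al u * X.
  apply: le_trans le1 _; by rewrite [leLHS]mulrC ler_pM2r // al_ge.
have := al_gt0 u; have := k0_gt0; have := N_ge0 u X; rewrite ler_norml => *.
by apply/andP; split; nra.
Unshelve. all: by end_near. Qed.

Lemma inv_sqr_bnd (t : R) : 0 <= t <= 1 ->
  1 <= (1 + t) ^+ 2 <= 1 + 3 * t /\ 1 - 3 * t <= ((1 + t) ^+ 2)^-1.
Proof.
move=> /andP[t0 t1]; have h : 1 <= (1 + t) ^+ 2 <= 1 + 3 * t by apply/andP; split; nra.
split=> //; rewrite -[leRHS]mul1r ler_pdivlMr; last by lra.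
apply: le_trans (_ : (1 - 3 * t) * (1 + 3 * t) + 9 * t ^+ 2 <= _); last by lra.
by have [h0|h0] := leP 0 (1 - 3 * t); nra.
Qed.

(** With q = x^2 + y^2 and q2 = (1 + t)^2 q, the count [N u X] lies between P(X / q2) and P(X / q),
    and [al u] lies between 1 / q2 and 1 / q. The asymptotics of [P] then leave only the relative
    gap of order t. *)
Lemma dev_good u x y t : 0 <= t <= 1 -> 0 <= x -> 0 <= y -> 0 < x ^+ 2 + y ^+ 2 ->
  x <= ra u <= (1 + t) * x -> x <= rc u <= (1 + t) * x ->
  y <= rb u <= (1 + t) * y -> y <= rd u <= (1 + t) * y ->
  dev u (3 * t * k0 * al u).
Proof.
move=> /andP[t0 t1] x0 y0 q0 /andP[a1 a2] /andP[c1 c2] /andP[b1 b2] /andP[d1 d2].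
set q := x ^+ 2 + y ^+ 2 in q0 *.
have [|tt c1'] := @inv_sqr_bnd t; first by rewrite t0.
have hq : q <= n12 u by rewrite /q /n12; nra.
have lea : al u <= q^-1.
  apply: le_trans (al_le _) _; first by lra.
  by rewrite lef_pV2 // posrE; lra.
have gea : q^-1 <= (1 + t) ^+ 2 * al u.
  apply: le_trans (_ : (1 + t) ^+ 2 * (Num.sqrt (n11 u * n22 u))^-1 <= _); last first.
    by rewrite ler_pM2l ?al_ge //; lra.
  have n1 := n11_ge1 u; have n2 := n22_ge1 u.
  have s0 : 0 < Num.sqrt (n11 u * n22 u) by rewrite sqrtr_gt0; nra.
  rewrite ler_pdivlMr // mulrC ler_pdivrMr //.
  have u1 : n11 u <= (1 + t) ^+ 2 * q by rewrite /n11 /q; nra.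
  have u2 : n22 u <= (1 + t) ^+ 2 * q by rewrite /n22 /q; nra.
  have z0 : 0 <= (1 + t) ^+ 2 * q by rewrite mulr_ge0 ?ltW //; lra.
  rewrite -[leRHS]ger0_norm // -sqrtr_sqr ler_wsqrtr // expr2.
  by apply: ler_pM => //; [exact: le_trans ler01 n1 | exact: le_trans ler01 n2].
pose q2 := ((1 + t) * x) ^+ 2 + ((1 + t) * y) ^+ 2.
have q2E : q2 = (1 + t) ^+ 2 * q by rewrite /q2 /q; ring.
have q20 : 0 < q2 by rewrite q2E mulr_gt0 //; lra.
have kp := k0_gt0; have ap := al_gt0 u.
move=> e e0; near=> X.
have X0 : 0 < X by near: X; exact: nbhs_pinfty_gt.
have up : `|P (X * q^-1) - k0 * (X * q^-1)| <= (e * q) * (X * q^-1).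
  near: X; apply: (@near_scale (fun Z => `|P Z - k0 * Z| <= (e * q) * Z)).
    by rewrite invr_gt0.
  by apply: P_asymp; rewrite mulr_gt0.
have lo : `|P (X * q2^-1) - k0 * (X * q2^-1)| <= (e * q) * (X * q2^-1).
  near: X; apply: (@near_scale (fun Z => `|P Z - k0 * Z| <= (e * q) * Z)).
    by rewrite invr_gt0.
  by apply: P_asymp; rewrite mulr_gt0.
have Nle : N u X <= P (X / q) by apply: N_good_le.
have Nge : P (X / q2) <= N u X by apply: N_good_ge.
have eX1 : e * q * (X * q^-1) = e * X by field; rewrite gt_eqF.
have /andP[t2 t3] := tt.
have qq : q <= q2 by rewrite q2E ler_peMl ?(ltW q0).
have eX2 : e * q * (X * q2^-1) <= e * X.
  rewrite (_ : _ * (X / q2) = e * X * (q / q2)); last by ring.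
  by rewrite ler_piMr ?mulr_ge0 ?(ltW e0) ?(ltW X0) // ler_pdivrMr // mul1r.
have i1 : X / q <= (1 + 3 * t) * al u * X.
  by rewrite [leLHS]mulrC ler_pM2r //; apply: le_trans gea _; rewrite ler_pM2r.
have i2 : (1 - 3 * t) * al u * X <= X / q2.
  rewrite [leRHS]mulrC ler_pM2r // q2E invfM.
  have c0 : 0 <= ((1 + t) ^+ 2)^-1 by rewrite invr_ge0 sqr_ge0.
  apply: le_trans (_ : ((1 + t) ^+ 2)^-1 * al u <= _).
    by rewrite ler_pM2r.
  exact: ler_wpM2l.
have j1 : k0 * (X / q) <= k0 * ((1 + 3 * t) * al u * X) by rewrite ler_pM2l.
have j2 : k0 * ((1 - 3 * t) * al u * X) <= k0 * (X / q2) by rewrite ler_pM2l.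
move: up lo; rewrite eX1 !ler_norml => up lo; clear -up lo j1 j2 Nle Nge eX2; apply/andP; split; lra.
Unshelve. all: by end_near. Qed.

Lemma dev_split u a b : dev (false :: u) a -> dev (true :: u) b -> dev u (a + b).
Proof.
move=> da db e e0; have e3 : 0 < e / 3 by lra.
near=> X.
have X0 : 0 < X by near: X; exact: nbhs_pinfty_gt.
have h1 : `|N (false :: u) X - k0 * al (false :: u) * X| <= (a + e / 3) * X.
  by near: X; exact: da.
have h2 : `|N (true :: u) X - k0 * al (true :: u) * X| <= (b + e / 3) * X.
  by near: X; exact: db.
have h3 : 1 <= e / 3 * X.
  rewrite mulrC -ler_pdivrMr // mul1r; near: X; exact: nbhs_pinfty_ge.
have := N_split u X; rewrite (al_cons u) mulrDr mulrDl.
by move: h1 h2; rewrite !ler_norml; lra.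
Unshelve. all: by end_near. Qed.

Lemma r_nseq b k u :
  [/\ ra (nseq k b ++ u) = if b then ra u + k%:R * rc u else ra u,
  rb (nseq k b ++ u) = if b then rb u + k%:R * rd u else rb u,
  rc (nseq k b ++ u) = if b then rc u else rc u + k%:R * ra u &
  rd (nseq k b ++ u) = if b then rd u else rd u + k%:R * rb u].
Proof.
elim: k => [|k [IA IB IC ID]].
  by rewrite /= !mul0r !addr0; case: b.
rewrite [nseq _ _ ++ _]/=; have [-> -> -> ->] := r_cons b (nseq k b ++ u).
by rewrite IA IB IC ID -natr1; case: b {IA IB IC ID}; split; ring.
Qed.

(** Along the chain u, bu, bbu, ... one row s is added again and again to the other row r.
    [cell b k u] is the piece split off at step k; its rows are r + ks and r + (k+1)s in some order,
    equal up to a ratio 1 + 1/k. *)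
Definition cell b k u := ~~ b :: nseq k b ++ u.

Lemma al_cell b k u : al (cell b k u) = al (nseq k b ++ u) - al (nseq k.+1 b ++ u).
Proof. by rewrite (al_cons (nseq k b ++ u)) /cell /=; case: b => /=; lra. Qed.

Lemma dev_chain b k u x y : dev (cell b k u) x -> dev (nseq k.+1 b ++ u) y ->
  dev (nseq k b ++ u) (x + y).
Proof.
by case: b => h1 h2; [|rewrite addrC]; apply: dev_split.
Qed.

Lemma dev_cell b k u : (0 < k)%N -> dev (cell b k u) (3 * k%:R^-1 * k0 * al (cell b k u)).
Proof.
move=> k0'; have kp : 1 <= k%:R :> R by rewrite ler1n.
have [eA eB eC eD] := r_nseq b k u; have [eA' eB' eC' eD'] := r_cons (~~ b) (nseq k b ++ u).
have i1 : 0 <= (k%:R^-1 : R) <= 1 by rewrite invr_ge0 invf_le1; lra.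
have h (p q : R) : 0 <= p -> 0 <= q -> p + k%:R * q + q <= (1 + k%:R^-1) * (p + k%:R * q).
  move=> p0 q0; rewrite mulrDl mul1r lerD2l mulrDr mulrA mulVf; last by lra.
  by rewrite mul1r lerDr mulr_ge0 //; lra.
have h1 (p q : R) : 0 <= p -> 0 <= q -> p + k%:R * q <= (1 + k%:R^-1) * (p + k%:R * q).
  by move=> p0 q0; apply: le_trans (h _ _ p0 q0); rewrite lerDl.
have [ga gd] := (ra_ge1 u, rd_ge1 u); have [gb gc] := (rb_ge0 u, rc_ge0 u).
have [ga' gd'] : 0 <= ra u /\ 0 <= rd u by split.
have l1 (p q : R) : 0 <= p -> 0 <= q -> 0 <= p + k%:R * q by move=> *; rewrite addr_ge0 // mulr_ge0.
rewrite /cell; case: b eA eB eC eD eA' eB' eC' eD' => /= -> -> -> -> eA eB eC eD.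
- apply: (@dev_good _ (ra u + k%:R * rc u) (rb u + k%:R * rd u));
    rewrite ?eA ?eB ?eC ?eD ?lexx ?h1 ?l1 //=.
  + by have := sqr_ge0 (rb u + k%:R * rd u); have := mulr_ge0 (_ : 0 <= k%:R) gc; nra.
  + by rewrite lerDl h ?andbT.
  + by rewrite lerDl h ?andbT.
- apply: (@dev_good _ (rc u + k%:R * ra u) (rd u + k%:R * rb u));
    rewrite ?eA ?eB ?eC ?eD ?lexx ?h1 ?l1 //=.
  + by have := sqr_ge0 (rc u + k%:R * ra u); have := mulr_ge0 (_ : 0 <= k%:R) gb; nra.
  + by rewrite lerDr ga' addrC h.
  + by rewrite lerDr gb addrC h.
Qed.

Lemma dev_good_chain b k j r u : (0 < k)%N -> 0 <= r ->
  (forall v, v != [::] -> dev v (r * al v)) -> (nseq (k + j) b ++ u != [::]) ->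
  dev (nseq k b ++ u) (3 * k%:R^-1 * k0 *
     (al (nseq k b ++ u) - al (nseq (k + j) b ++ u)) + r * al (nseq (k + j) b ++ u)).
Proof.
move=> kp r0 hr; elim: j => [|j IH] in k kp *.
  by rewrite addn0 subrr mulr0 add0r => /hr.
move=> nn; have dc := dev_cell b u kp.
have k1 : 1 <= k%:R :> R by rewrite ler1n.
have := IH k.+1 isT; rewrite addSnnS => /(_ nn) IH1.
apply: dev_le (dev_chain dc IH1); rewrite al_cell.
have ii : (k.+1%:R)^-1 <= k%:R^-1 :> R by rewrite lef_pV2 ?posrE ?ltr0n // ler_nat.
have dd : 0 <= al (nseq k.+1 b ++ u) - al (nseq (k + j.+1) b ++ u).
  rewrite -addSnnS; elim: j {IH nn IH1} => [|j IHj]; first by rewrite addn0 subrr.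
  have := al_cell b (k.+1 + j) u; have := al_gt0 (cell b (k.+1 + j) u); rewrite addnS.
  lra.
have := k0_gt0; have : (k.+1%:R)^-1 * (k0 * (al (nseq k.+1 b ++ u) - al (nseq (k + j.+1) b ++ u)))
   <= k%:R^-1 * (k0 * (al (nseq k.+1 b ++ u) - al (nseq (k + j.+1) b ++ u))).
  by apply: ler_wpM2r => //; rewrite mulr_ge0 // ltW // k0_gt0.
move: (k.+1%:R^-1) (k%:R^-1) (al (nseq k b ++ u)) (al (nseq k.+1 b ++ u))
  (al (nseq (k + j.+1) b ++ u)) => *.
lra.
Qed.

Lemma dev_prefix_chain b k r c u :
  (forall v, v != [::] -> dev v (r * al v)) -> dev (nseq k b ++ u) c ->
  dev u (r * (al u - al (nseq k b ++ u)) + c).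
Proof.
move=> hr; elim: k c => [|k IH] c dc; first by rewrite subrr mulr0 add0r.
apply: dev_le (IH _ (dev_chain (hr (cell b k u) isT) dc)).
by rewrite al_cell; lra.
Qed.

Lemma ang_gain (x1 y1 x2 y2 m n d : R) : 0 <= x1 -> 0 <= y1 -> 0 <= x2 -> 0 <= y2 ->
    1 <= x1 ^+ 2 + y1 ^+ 2 -> 1 <= x2 ^+ 2 + y2 ^+ 2 ->
    x1 * y2 - y1 * x2 = d -> 0 <= d ->
    Num.sqrt (x1 ^+ 2 + y1 ^+ 2) <= m -> Num.sqrt (x2 ^+ 2 + y2 ^+ 2) <= n ->
    d / (m * n) <= ang x2 y2 - ang x1 y1.
Proof.
  move=> hx1 hy1 hx2 hy2 s1 s2 <- d0 m1 m2.
  apply: le_trans (angB_ge _ _ _ _ _ _ _) => //; try lra.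
  have t1 : 0 < Num.sqrt (x1 ^+ 2 + y1 ^+ 2) by rewrite sqrtr_gt0; lra.
  have t2 : 0 < Num.sqrt (x2 ^+ 2 + y2 ^+ 2) by rewrite sqrtr_gt0; lra.
  apply: ler_wpM2l => //; rewrite lef_pV2 ?posrE ?mulr_gt0 //; try lra.
  by apply: ler_pM => //; exact: ltW.
Qed.

Lemma sqr_shift_ge1 (s t k : R) : 0 <= k -> 0 <= t -> 1 <= s -> 1 <= (s + k * t) ^+ 2.
Proof.
  by move=> k0' t0 s1; rewrite expr_ge1 //; have := mulr_ge0 k0' t0; lra.
Qed.

Lemma trunc_mul_ge (x y : R) : 0 < x -> 0 < y -> x <= ((Num.trunc (x / y)).+1)%:R * y.
Proof.
  move=> x0 y0; rewrite -ler_pdivrMr // ltW //.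
  by have /andP[] := truncn_itv (divr_ge0 (ltW x0) (ltW y0)).
Qed.

(** The shorter row is added to the longer one; let their lengths be y <= x, and let j be just above
    x/y. The moving row has length at most (K+1)x at step K and (K+2)jy at step K + j, and these two
    vectors have determinant j up to sign. They enclose an angle of at least 1 / ((K+1)(K+2)xy),
    whereas [al u] is at most 2/(xy) because n12 >= 1 for a nonempty [u]. *)
Lemma chain_gain u (K : nat) : (0 < K)%N -> u != [::] -> exists b j,
  (0 < j)%N /\
  (2 * (K%:R + 1) * (K%:R + 2))^-1 * al u <= al (nseq K b ++ u) - al (nseq (K + j) b ++ u).
Proof.
move=> K0 u0; have n0 : 1 <= n12 u.
  by apply: le_trans (n12_ge u); rewrite ler1n lt0n size_eq0.
have K1 : 1 <= K%:R :> R by rewrite ler1n.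
have n1 := n11_ge1 u; have n2 := n22_ge1 u; have nd := n_det u.
set p := Num.sqrt (n11 u); set q := Num.sqrt (n22 u).
have p0 : 0 < p by rewrite sqrtr_gt0; lra.
have q0 : 0 < q by rewrite sqrtr_gt0; lra.
have p2 : p ^+ 2 = n11 u by rewrite sqr_sqrtr //; lra.
have q2 : q ^+ 2 = n22 u by rewrite sqr_sqrtr //; lra.
have pq : n12 u <= p * q.
  rewrite -ler_sqr ?nnegrE ?mulr_ge0 ?ltW //; last by lra.
  by rewrite exprMn p2 q2; lra.
have alu : al u <= 2 / (p * q).
  apply: le_trans (al_le _) _; first by lra.
  rewrite ler_pdivlMr ?mulr_gt0 // mulrC ler_pdivrMr; last by lra.
  rewrite -ler_sqr ?nnegrE ?mulr_ge0 ?ltW // ; try lra.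
  by rewrite !exprMn p2 q2; nra.
have nrm (x y z t : R) : 0 < x -> 0 < y -> x ^+ 2 = z -> y ^+ 2 = t -> n12 u <= x * y ->
   forall k : nat, Num.sqrt (z + 2 * k%:R * n12 u + k%:R ^+ 2 * t) <= x + k%:R * y.
  move=> x0 y0 <- <- xy k; rewrite -[leRHS]ger0_norm; last first.
    by rewrite addr_ge0 ?mulr_ge0 // ltW.
  rewrite -sqrtr_sqr ler_wsqrtr //.
  have : k%:R * n12 u <= k%:R * (x * y) by apply: ler_wpM2l.
  lra.
have main (x y : R) (j : nat) : 0 < x -> 0 < y -> x * y = p * q -> (0 < j)%N ->
   j%:R * y >= x -> y <= x ->
   (2 * (K%:R + 1) * (K%:R + 2))^-1 * al u <=
   j%:R / ((x + K%:R * y) * (x + (K + j)%:R * y)).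
  move=> x0 y0 xy j0 jxy yx.
  apply: le_trans (_ : ((K%:R + 1) * (K%:R + 2) * (p * q))^-1 <= _).
    apply: le_trans (_ : (2 * (K%:R + 1) * (K%:R + 2))^-1 * (2 / (p * q)) <= _).
      by apply: ler_wpM2l alu; rewrite invr_ge0 !mulr_ge0 //; lra.
    rewrite le_eqVlt; apply/orP; left; apply/eqP; field.
    by rewrite !lt0r_neq0 //; lra.
  rewrite -xy ler_pdivlMr; last by rewrite mulr_gt0 // addr_gt0 // mulr_gt0 // ltr0n // addn_gt0 K0.
  rewrite mulrC ler_pdivrMr; last by rewrite !mulr_gt0 //; lra.
  rewrite natrD.
  apply: le_trans (_ : ((K%:R + 1) * x) * ((K%:R + 2) * (j%:R * y)) <= _); last by lra.
  apply: ler_pM; first by rewrite addr_ge0 ?mulr_ge0 // ltW.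
  - by rewrite addr_ge0 ?mulr_ge0 ?addr_ge0 // ltW.
  - by rewrite mulrDl mul1r [leRHS]addrC lerD2l ler_wpM2l.
  - have : K%:R * y <= K%:R * (j%:R * y) by apply: ler_wpM2l => //; lra.
    lra.
have [ga gd] := (ra_ge1 u, rd_ge1 u); have [gb gc] := (rb_ge0 u, rc_ge0 u).
have [ga' gd'] : 0 <= ra u /\ 0 <= rd u by split.
have rdet := r_det u.
have sub1 (s t z : R) : (s - t) - (s - z) = z - t by ring.
have sub2 (s t z : R) : (t - s) - (z - s) = t - z by ring.
have [qp|pq'] := leP q p.
- exists true, (Num.trunc (p / q)).+1; split=> //.
  set j := (Num.trunc (p / q)).+1.
  apply: le_trans (main p q j p0 q0 erefl isT (trunc_mul_ge p0 q0) qp) _.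
  have [a1 b1 c1 d1] := r_nseq true K u; have [a2 b2 c2 d2] := r_nseq true (K + j) u.
  rewrite /al /al1 /al2 a1 b1 c1 d1 a2 b2 c2 d2 sub1.
  apply: ang_gain; rewrite ?addr_ge0 ?mulr_ge0 //.
  + by rewrite ler_wpDr ?sqr_ge0 ?sqr_shift_ge1.
  + by rewrite ler_wpDr ?sqr_ge0 ?sqr_shift_ge1.
  + by rewrite natrD -[RHS]mulr1 -rdet; ring.
  + by apply: le_trans (nrm _ _ _ _ p0 q0 p2 q2 pq K); rewrite ler_wsqrtr // le_eqVlt; apply/orP; left; apply/eqP; rewrite /n11 /n12 /n22; ring.
  + by apply: le_trans (nrm _ _ _ _ p0 q0 p2 q2 pq (K + j)%N); rewrite ler_wsqrtr // le_eqVlt; apply/orP; left; apply/eqP; rewrite /n11 /n12 /n22; ring.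
- exists false, (Num.trunc (q / p)).+1; split=> //.
  set j := (Num.trunc (q / p)).+1.
  apply: le_trans (main q p j q0 p0 (mulrC _ _) isT (trunc_mul_ge q0 p0) (ltW pq')) _.
  have [a1 b1 c1 d1] := r_nseq false K u; have [a2 b2 c2 d2] := r_nseq false (K + j) u.
  rewrite /al /al1 /al2 a1 b1 c1 d1 a2 b2 c2 d2 sub2 [_ * (_ + (K + j)%:R * _)]mulrC.
  apply: ang_gain; rewrite ?addr_ge0 ?mulr_ge0 //.
  + by rewrite ler_wpDl ?sqr_ge0 ?sqr_shift_ge1.
  + by rewrite ler_wpDl ?sqr_ge0 ?sqr_shift_ge1.
  + by rewrite natrD -[RHS]mulr1 -rdet; ring.
  + by apply: le_trans (nrm _ _ _ _ q0 p0 q2 p2 _ (K + j)%N); rewrite ?[q * p]mulrC // ler_wsqrtr // le_eqVlt; apply/orP; left; apply/eqP; rewrite /n11 /n12 /n22; ring.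
  + by apply: le_trans (nrm _ _ _ _ q0 p0 q2 p2 _ K); rewrite ?[q * p]mulrC // ler_wsqrtr // le_eqVlt; apply/orP; left; apply/eqP; rewrite /n11 /n12 /n22; ring.
Qed.

(* If the error constant [r] works for all cells, cutting [u] along a long chain
   leaves cells with nearly equal rows, where the error is [O(k0 / K)], together
   with cells that miss a fixed proportion of the angle. *)
Lemma dev_contract (K : nat) r : (0 < K)%N -> 3 * k0 / K%:R <= r ->
  (forall v, v != [::] -> dev v (r * al v)) ->
  forall u, u != [::] ->
  dev u ((r - (r - 3 * k0 / K%:R) / (2 * (K%:R + 1) * (K%:R + 2))) * al u).
Proof.
move=> K0 rK hr u u0; have [b [j [j0 hj]]] := chain_gain K0 u0.
have K1 : 1 <= K%:R :> R by rewrite ler1n.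
have kp := k0_gt0.
have r0 : 0 <= r.
  by apply: le_trans rK; rewrite divr_ge0 // mulr_ge0 // ltW.
have nn : nseq (K + j) b ++ u != [::] by case: (K) K0.
apply: dev_le (dev_prefix_chain hr (dev_good_chain K0 r0 hr nn)).
have -> : 3 / K%:R * k0 = 3 * k0 / K%:R by ring.
have h : 0 <= r - 3 * k0 / K%:R by lra.
have := ler_wpM2l h hj; move: (al (nseq K b ++ u)) (al (nseq (K + j) b ++ u)) => x y.
move: (3 * k0 / K%:R) (_^-1) => z c; lra.
Qed.

(** The constants r with an error r [al v] for all nonempty [v] have an infimum, which is itself
    such a constant. Were it positive, [dev_contract] with K so large that 3 k0 / K lies below it
    would produce a smaller one. The empty word is reached by one splitting. *)
Lemma equidistribution_cell u : dev u 0.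
Proof.
suff H v : v != [::] -> dev v 0.
  have := dev_split (H (false :: u) isT) (H (true :: u) isT); by rewrite addr0.
pose S := [set r : R | 0 <= r /\ forall v, v != [::] -> dev v (r * al v)].
have kp := k0_gt0.
have S1 : S (1 + k0) by split; [lra | move=> w _; exact: dev_trivial].
have lbS : has_lbound S by exists 0 => r [].
have hS : has_inf S by split => //; exists (1 + k0).
have i0 : 0 <= inf S by apply: lb_le_inf; [exists (1 + k0)|move=> r []].
have Si : S (inf S).
  split=> // w w0 e e0; have [r [r0 hr] rlt] := inf_adherent (divr_gt0 e0 (addr_gt0 (al_gt0 w) (@ltr01 R))) hS.
  have e2 : 0 < e / (al w + 1) by rewrite divr_gt0 // addr_gt0 // al_gt0.
  have := al_gt0 w => alp.
  near=> X.
  have X0 : 0 < X by near: X; exact: nbhs_pinfty_gt.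
  apply: le_trans (_ : (r * al w + e / (al w + 1)) * X <= _); last first.
    rewrite ler_pM2r //.
    have : r * al w <= (inf S + e / (al w + 1)) * al w by rewrite ler_pM2r // ltW.
    have : e / (al w + 1) * (al w + 1) = e by field; lra.
    move: (e / (al w + 1)) => z; lra.
  by near: X; exact: hr.
move=> v0; have [p0|] := ltP 0 (inf S); last first.
  move=> le0; have E : inf S = 0 by apply: le_anti; rewrite le0 i0.
  by case: Si => _ /(_ v v0); rewrite E mul0r.
have tr := truncn_itv (ltW (divr_gt0 (mulr_gt0 (ltr0n R 3) kp) p0)).
set K := (Num.trunc (3 * k0 / inf S)).+1.
have Klt : 3 * k0 / K%:R < inf S.
  rewrite ltr_pdivrMr ?ltr0n // [ltRHS]mulrC -ltr_pdivrMr //.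
  by move/andP: tr => [].
have [_ hS'] := Si.
have K1 : 1 <= K%:R :> R by rewrite ler1n.
have := dev_contract (isT : (0 < K)%N) (ltW Klt) hS'.
set c := (2 * (K%:R + 1) * (K%:R + 2)); set r' := (_ - _) => hr'.
have c1 : 1 <= c by rewrite /c; nra.
have q0 : 0 <= 3 * k0 / K%:R by rewrite divr_ge0 // mulr_ge0 // ltW.
have d0 : 0 < (inf S - 3 * k0 / K%:R) / c by rewrite divr_gt0 //; lra.
have d1 : (inf S - 3 * k0 / K%:R) / c <= inf S - 3 * k0 / K%:R.
  by rewrite ler_pdivrMr ?ler_peMr //; lra.
have : inf S <= r' by apply: ge_inf => //; split => //; rewrite /r'; lra.
rewrite /r'; lra.
Unshelve. all: by end_near. Qed.

(** * Joint distribution of the norm and the axis of gamma^T gamma *)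

Lemma ang_cos_sin_up x y : 0 < y ->
  [/\ cos (ang x y) = x / Num.sqrt (x ^+ 2 + y ^+ 2),
      sin (ang x y) = y / Num.sqrt (x ^+ 2 + y ^+ 2),
      0 < ang x y & ang x y < pi].
Proof.
move=> y0; have q0 : 0 < x ^+ 2 + y ^+ 2 by have := sqr_ge0 x; have := exprn_gt0 2 y0; lra.
set s := Num.sqrt _; have s0 : 0 < s by rewrite sqrtr_gt0.
have s2 : s ^+ 2 = x ^+ 2 + y ^+ 2 by rewrite sqr_sqrtr // ltW.
have y2 : 0 < y ^+ 2 by rewrite exprn_gt0.
have xs1 : -1 < x / s < 1.
  by rewrite ltr_pdivlMr // ltr_pdivrMr // mul1r mulN1r; apply/andP; split; nra.
have xs : -1 <= x / s <= 1 by lra.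
have c : cos (ang x y) = x / s by rewrite acosK // in_itv.
split=> //.
- rewrite /ang -/s sin_acos // expr_div_n s2.
  rewrite (_ : 1 - _ = (y / s) ^+ 2); last first.
    by rewrite expr_div_n s2; field; lra.
  by rewrite sqrtr_sqr ger0_norm // divr_ge0 // ltW.
- by apply: acos_gt0; lra.
- by apply: acos_ltpi; lra.
Qed.

(** The direction of the eigenvector of gamma^T gamma for its larger eigenvalue, obtained from the
    doubled angle. With d the distance from i to gamma i, [gT] is 2 cosh d, and the eigenvalue gap
    [gS] is 2 sinh d. *)
Definition psi w := ang (g11 w - g22 w) (2 * g12 w) / 2.
Definition gS w := Num.sqrt (gT w ^+ 2 - 4).

Lemma gS_E w : gS w = Num.sqrt ((g11 w - g22 w) ^+ 2 + (2 * g12 w) ^+ 2).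
Proof. by congr Num.sqrt; rewrite /gT; have := g_det w; lra. Qed.

Lemma gT_ge3 w : 3 <= gT w.
Proof.
have := ra_ge1 w; have := rd_ge1 w; have := rb_ge0 w; have := rc_ge0 w.
rewrite /gT /g11 /g22; nra.
Qed.

Lemma gS_gt0 w : 0 < gS w.
Proof. by rewrite sqrtr_gt0; have := gT_ge3 w; nra. Qed.

Lemma psiP w : [/\ cos (2 * psi w) = (g11 w - g22 w) / gS w,
  sin (2 * psi w) = 2 * g12 w / gS w, 0 < psi w & psi w < pi / 2].
Proof.
have q0 : 0 < 2 * g12 w by have := g12_ge1 w; lra.
have [c s a b] := ang_cos_sin_up (g11 w - g22 w) q0.
have -> : 2 * psi w = ang (g11 w - g22 w) (2 * g12 w) by rewrite /psi; lra.
rewrite gS_E; split => //; rewrite /psi; lra.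
Qed.

Lemma g_cat w u :
  [/\ g11 (w ++ u) = (ra w * ra u + rb w * rc u) ^+ 2 +
        ((ra w + rc w) * ra u + (rb w + rd w) * rc u) ^+ 2,
      g12 (w ++ u) = (ra w * ra u + rb w * rc u) * (ra w * rb u + rb w * rd u) +
        ((ra w + rc w) * ra u + (rb w + rd w) * rc u) *
        ((ra w + rc w) * rb u + (rb w + rd w) * rd u) &
      g22 (w ++ u) = (ra w * rb u + rb w * rd u) ^+ 2 +
        ((ra w + rc w) * rb u + (rb w + rd w) * rd u) ^+ 2].
Proof.
by rewrite /g11 /g12 /g22; have [-> -> -> ->] := r_cat w u; split; ring.
Qed.

Lemma sin_ge0_le x y : 0 < x < pi -> 0 <= y <= pi ->
  (0 <= sin (x - y) -> y <= x) /\ (0 <= sin (y - x) -> x <= y).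
Proof.
move=> x0 y0; split=> s0; rewrite leNgt; apply/negP => xy.
  have : 0 < sin (y - x) by apply: sin_gt0_pi; lra.
  by rewrite -opprB sinN; lra.
have : 0 < sin (x - y) by apply: sin_gt0_pi; lra.
by rewrite -opprB sinN; lra.
Qed.

Lemma double_angle x : (cos (2 * x) = cos x ^+ 2 - sin x ^+ 2) /\
  (sin (2 * x) = 2 * sin x * cos x).
Proof.
have -> : 2 * x = x + x by lra.
by rewrite cosD sinD !expr2; split; ring.
Qed.

(** For G the Gram matrix of [w ++ u] and v the first row of the matrix of [u], the sine of twice
    the angle difference has the sign of the determinant of v and Gv. Now Gv is the sum of the (rho
    . v) rho over rows rho that are nonnegative combinations of the two rows of [u], so it lies on
    the correct side of v. The second row is treated likewise. *)
Lemma psi_cell w u : al1 u <= psi (w ++ u) <= al2 u.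
Proof.
have [cp sp p0 p1] := psiP (w ++ u); have q := gS_gt0 (w ++ u).
have [c1 s1 a1 b1] := al1P u; have [c2 s2 a2 b2] := al2P u.
have n1 := n11_ge1 u; have n2 := n22_ge1 u; have pp := pi_gt0 R.
have [e1 e2 e3] := g_cat w u; have dt := r_det u.
have q1 : 0 < Num.sqrt (n11 u) by rewrite sqrtr_gt0; lra.
have q2 : 0 < Num.sqrt (n22 u) by rewrite sqrtr_gt0; lra.
have p2 : 0 < 2 * psi (w ++ u) < pi by lra.
have r1 : 0 <= 2 * al1 u <= pi by lra.
have r2 : 0 <= 2 * al2 u <= pi by lra.
have [ga gd gb gc] : [/\ 1 <= ra u, 1 <= rd u, 0 <= rb u & 0 <= rc u].
  by split => //; [exact: ra_ge1|exact: rd_ge1].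
have [wa wd wb wc] : [/\ 0 <= ra w, 0 <= rd w, 0 <= rb w & 0 <= rc w] by [].
have ga0 : 0 <= ra u by [].
have gd0 : 0 <= rd u by [].
have key x y z t p r p' r' : 0 <= x -> 0 <= y -> 0 <= z -> 0 <= t ->
    0 <= p -> 0 <= r -> 0 <= p' -> 0 <= r' ->
    0 <= p * ((r * x + p * z) * x + (r * y + p * t) * y) +
         p' * ((r' * x + p' * z) * x + (r' * y + p' * t) * y) :> R.
  by move=> *; rewrite !(addr_ge0, mulr_ge0).
apply/andP; split.
- have [h _] := sin_ge0_le p2 r1; suff: 2 * al1 u <= 2 * psi (w ++ u) by rewrite ler_pM2l.
  apply: h; rewrite sinB cp sp; have [-> ->] := double_angle (al1 u); rewrite c1 s1.
  rewrite (_ : _ - _ = 2 * (g12 (w ++ u) * (ra u ^+ 2 - rb u ^+ 2) -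
    (g11 (w ++ u) - g22 (w ++ u)) * (ra u * rb u)) / (gS (w ++ u) * Num.sqrt (n11 u) ^+ 2)); last first.
    by field; rewrite !lt0r_neq0.
  have K := key _ _ _ _ _ _ _ _ ga0 gb gc gd0 wb wa (addr_ge0 wb wd) (addr_ge0 wa wc).
  rewrite divr_ge0 ?mulr_ge0 ?exprn_ge0 ?(ltW q) ?(ltW q1) //.
  by apply: le_trans K _; rewrite -[leLHS]mulr1 -dt e1 e2 e3; clear; lra.
- have [_ h] := sin_ge0_le p2 r2; suff: 2 * psi (w ++ u) <= 2 * al2 u by rewrite ler_pM2l.
  apply: h; rewrite sinB cp sp; have [-> ->] := double_angle (al2 u); rewrite c2 s2.
  rewrite (_ : _ - _ = 2 * ((g11 (w ++ u) - g22 (w ++ u)) * (rc u * rd u) -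
    g12 (w ++ u) * (rc u ^+ 2 - rd u ^+ 2)) / (gS (w ++ u) * Num.sqrt (n22 u) ^+ 2)); last first.
    by field; rewrite !lt0r_neq0.
  have K := key _ _ _ _ _ _ _ _ gc gd0 ga0 gb wa wb (addr_ge0 wa wc) (addr_ge0 wb wd).
  rewrite divr_ge0 ?mulr_ge0 ?exprn_ge0 ?(ltW q) ?(ltW q2) //.
  by apply: le_trans K _; rewrite -[leLHS]mulr1 -dt e1 e2 e3; clear; lra.
Qed.

Definition F u x X : R := NS [set w | psi w <= x] u X.

Lemma F_le u x X : 0 <= F u x X <= N u X.
Proof.
by rewrite /F /NS /N ler0n ler_nat /=; apply: cnt_le (ball_finite u X) _ => w [].
Qed.

Lemma F_full u x X : al2 u <= x -> F u x X = N u X.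
Proof.
move=> h; rewrite /F /NS /N /ballS; congr (cnt _)%:R; apply/seteqP; split => [w []//|w hw].
by split => //=; have := psi_cell w u; lra.
Qed.

Lemma F_empty u x X : x < al1 u -> F u x X = 0.
Proof.
move=> h; rewrite /F /NS (_ : ballS _ _ _ = set0) ?cnt0 //.
by apply/seteqP; split => // w [_ /=]; have := psi_cell w u; lra.
Qed.

(** The length of the part of [al1 u, al2 u] to the left of [x]. *)
Definition clip u x := if x < al1 u then 0 else if x < al2 u then x - al1 u else al u.

Lemma al_mid u : al2 (false :: u) = al1 (true :: u) /\
  al1 (false :: u) = al1 u /\ al2 (true :: u) = al2 u.
Proof.
rewrite /al1 /al2; have [-> -> -> ->] := r_cons false u.
by have [-> -> -> ->] := r_cons true u.
Qed.

Lemma clip_cons u x : clip u x = clip (false :: u) x + clip (true :: u) x.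
Proof.
have [e1 [e2 e3]] := al_mid u; have := al_gt0 (false :: u); have := al_gt0 (true :: u).
rewrite /clip /al e2 e3 e1 => h1 h2.
case: (ltP x (al1 u)) => ?; case: (ltP x (al1 (true :: u))) => ?;
  case: (ltP x (al2 u)) => ?; lra.
Qed.

(** Of the two subcells, one lies entirely below or entirely above [x], so its count is known from
    [equidistribution_cell] or is 0; the descent continues in the other. After n levels the only
    unknown part is a cell whose word has length size u + n, of width at most the inverse of that
    length. *)
Lemma cell_size_dev n u x e : (0 < size u + n)%N -> 0 < e ->
  \forall X \near +oo, `|F u x X - k0 * clip u x * X| <= (k0 / (size u + n)%:R + e) * X.
Proof.
have kp := k0_gt0.
have full v : al2 v <= x -> clip v x = al v.
  by move=> h; rewrite /clip !ltNge h /=; have := al_gt0 v; rewrite /al => ?; case: ifP => //; lra.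
elim: n u e => [|n IH] u e; rewrite ?addn0 => n0 e0.
  have [xl|xl] := ltP x (al1 u).
    near=> X; have X0 : 0 < X by near: X; exact: nbhs_pinfty_gt.
    rewrite F_empty // /clip xl mulr0 mul0r subr0 normr0.
    by rewrite mulr_ge0 ?(ltW X0) // addr_ge0 ?(ltW e0) // divr_ge0 // ltW.
  near=> X.
  have X0 : 0 < X by near: X; exact: nbhs_pinfty_gt.
  have h : `|N u X - k0 * al u * X| <= (0 + e) * X by near: X; exact: equidistribution_cell.
  have := F_le u x X.
  have c : 0 <= clip u x <= al u.
    rewrite /clip ltNge xl /=; have := al_gt0 u; rewrite /al.
    by case: (ltP x (al2 u)) => ? ?; lra.
  have au : al u <= (size u)%:R^-1.
    apply: le_trans (al_le _) _; last rewrite lef_pV2 ?posrE ?n12_ge ?ltr0n //.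
      by apply: lt_le_trans (n12_ge u); rewrite ltr0n.
    by apply: lt_le_trans (n12_ge u); rewrite ltr0n.
  case/andP: c => c0 c1.
  have h1 : k0 * clip u x * X <= k0 * al u * X by rewrite ler_pM2r // ler_pM2l.
  have h2 : 0 <= k0 * clip u x * X by rewrite mulr_ge0 ?(ltW X0) // mulr_ge0 ?(ltW kp).
  have h3 : k0 * al u * X <= k0 / (size u)%:R * X by rewrite ler_pM2r // ler_pM2l.
  by move: h; rewrite !ler_norml; clear -h1 h2 h3; move: ((size u)%:R^-1) h3 => i h3; lra.
have e3 : 0 < e / 3 by lra.
have [e1 [e2 e4]] := al_mid u.
have comb b : (forall e, 0 < e -> \forall X \near +oo,
    `|F (b :: u) x X - k0 * clip (b :: u) x * X| <= e * X) -> 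
   \forall X \near +oo, `|F u x X - k0 * clip u x * X| <= (k0 / (size u + n.+1)%:R + e) * X.
  move=> hb; near=> X.
  have X0 : 0 < X by near: X; exact: nbhs_pinfty_gt.
  have h1 : `|F (b :: u) x X - k0 * clip (b :: u) x * X| <= e / 3 * X by near: X; exact: hb.
  have h2 : `|F (~~ b :: u) x X - k0 * clip (~~ b :: u) x * X| <= (k0 / (size (~~ b :: u) + n)%:R + e / 3) * X.
    by near: X; apply: IH => //; rewrite addSn.
  have h3 : 1 <= e / 3 * X by near: X; exact: near_cst.
  have := NS_split [set w | psi w <= x] u X; rewrite -/(F _ _ _) -/(F _ _ _) -/(F _ _ _).
  move: h2; rewrite /= addSn -addnS (clip_cons u); move: h1 h3.
  move: ((size u + n.+1)%:R^-1) => i; clear.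
  by case: b; rewrite !ler_norml /=; lra.
have [xm|xm] := ltP x (al1 (true :: u)).
  apply: (comb true) => e' e'0; near=> X.
  have X0 : 0 < X by near: X; exact: nbhs_pinfty_gt.
  by rewrite F_empty // /clip xm mulr0 mul0r subr0 normr0 mulr_ge0 ?(ltW e'0) ?(ltW X0).
apply: (comb false) => e' e'0; have := equidistribution_cell (false :: u) e'0.
by rewrite add0r full ?e1 //; apply: filterS => X; rewrite F_full ?e1.
Unshelve. all: by end_near. Qed.

Lemma F_asymp x e : 0 <= x <= pi / 2 -> 0 < e ->
  \forall X \near +oo, `|F [::] x X - k0 * x * X| <= e * X.
Proof.
move=> /andP[x0 x1] e0; have kp := k0_gt0.
have c : clip [::] x = x.
  have a2 : al2 [::] = pi / 2.
    by rewrite /al2 /ang /rc /rd !w_nil mul0r acos0.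
  have a1 : al1 [::] = 0 by have := al_nil; rewrite /al a2; lra.
  rewrite /clip a1 a2 ltNge x0 /= al_nil; case: ltP => ?; lra.
have e2 : 0 < e / 2 by lra.
pose n := (Num.trunc (k0 / (e / 2))).+1.
have kn : k0 / n%:R <= e / 2.
  rewrite ler_pdivrMr ?ltr0n // [leRHS]mulrC -ler_pdivrMr // ltW //.
  by have /andP[] := truncn_itv (divr_ge0 (ltW kp) (ltW e2)).
have n0 : (0 < n)%N by [].
clearbody n; near=> X.
have X0 : 0 < X by near: X; exact: nbhs_pinfty_gt.
apply: le_trans (_ : (k0 / n%:R + e / 2) * X <= _); last by rewrite ler_pM2r //; lra.
by near: X; have := @cell_size_dev n [::] x (e / 2) n0 e2; rewrite c.
Unshelve. all: by end_near. Qed.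

Definition dens (f : R -> R) x := forall e, 0 < e ->
  \forall X \near +oo, `|f X - x * X| <= e * X.

Lemma dens_ext f g x : f =1 g -> dens f x -> dens g x.
Proof. by move=> fg df e e0; have := df _ e0; apply: filterS => X; rewrite fg. Qed.

Lemma densD f g x y : dens f x -> dens g y -> dens (fun X => f X + g X) (x + y).
Proof.
move=> df dg e e0; have e2 : 0 < e / 2 by lra.
have := dg _ e2; have := df _ e2; apply: filterS2 => X; rewrite !ler_norml; lra.
Qed.

Lemma densN f x : dens f x -> dens (fun X => - f X) (- x).
Proof.
move=> df e e0; have := df _ e0; apply: filterS => X; rewrite !ler_norml; lra.
Qed.

Lemma dens0 : dens (fun=> 0) 0.
Proof.
move=> e e0; have := @nbhs_pinfty_ge R 0 (num_real _); apply: filterS => X X0.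
by rewrite mul0r subr0 normr0 mulr_ge0 ?(ltW e0).
Qed.

Lemma dens_sum (n : nat) (f : nat -> R -> R) (x : nat -> R) :
  (forall i, (i < n)%N -> dens (f i) (x i)) ->
  dens (fun X => \sum_(i < n) f i X) (\sum_(i < n) x i).
Proof.
elim: n => [|n IH] h.
  by rewrite big_ord0; apply: dens_ext dens0 => X; rewrite big_ord0.
rewrite big_ord_recr /=; apply: dens_ext (densD (IH _) (h n _)) => //.
  by move=> X; rewrite big_ord_recr.
by move=> i ilt; apply: h; exact: ltnW.
Qed.

Lemma dens_scale f x t : 0 < t -> dens f x -> dens (fun X => f (X * t)) (x * t).
Proof.
move=> t0 df e e0; have et : 0 < e / t by rewrite divr_gt0.
have := @near_scale (fun Z => `|f Z - x * Z| <= e / t * Z) t t0 (df _ et).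
apply: filterS => X; rewrite (_ : e / t * (X * t) = e * X); last by field; lra.
by rewrite (_ : x * (X * t) = x * t * X) //; ring.
Qed.

Definition cdf x X : R := (cnt [set w | gT w <= X /\ psi w <= x])%:R.

Lemma dens_cdf x : 0 <= x <= pi / 2 -> dens (cdf x) (k0 * x).
Proof.
move=> xb e e0; have := F_asymp xb e0; apply: filterS => X.
rewrite /F /NS /cdf /ballS /ball (_ : _ `&` _ = [set w | gT w <= X /\ psi w <= x]) //.
by apply/seteqP; split => w /=; rewrite cats0.
Qed.

Lemma gT_ball_finite X (S : set (seq bool)) : finite_set [set w | gT w <= X /\ S w].
Proof. by apply: sub_finite_set (ball_finite [::] X) => w []; rewrite /ball /= cats0. Qed.

Definition box x y s t X :=
  [set w | gT w <= X * t /\ (X * s < gT w /\ (x < psi w /\ psi w <= y))].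

Lemma box_finite x y s t X : finite_set (box x y s t X).
Proof. exact: gT_ball_finite. Qed.

Lemma cnt_box_cdf x y s t X : x <= y -> X * s <= X * t ->
  (cnt (box x y s t X))%:R =
  (cdf y (X * t) - cdf x (X * t)) - (cdf y (X * s) - cdf x (X * s)).
Proof.
move=> xy st.
have E Z : (cnt [set w | gT w <= Z /\ (x < psi w /\ psi w <= y)])%:R = cdf y Z - cdf x Z.
  rewrite /cdf (@cntD _ [set w | gT w <= Z /\ psi w <= y] [set w | gT w <= Z /\ psi w <= x]).
  - rewrite natrD addrAC subrr add0r; congr (cnt _)%:R; apply/seteqP; split => w /=.
      move=> [h1 [h2 h3]]; split => //; move=> [_ h4]; lra.
    by move=> [[h1 h2] h3]; split => //; split => //; rewrite ltNge; apply/negP => h4; apply: h3.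
  - exact: gT_ball_finite.
  - by move=> w [h1 h2]; split => //=; lra.
rewrite -!E (@cntD _ [set w | gT w <= X * t /\ (x < psi w /\ psi w <= y)]
  [set w | gT w <= X * s /\ (x < psi w /\ psi w <= y)]).
- rewrite natrD addrAC subrr add0r; congr (cnt _)%:R; apply/seteqP; split => w /=.
    move=> [h1 [h2 [h3 h4]]]; split => //; move=> [h5 _]; lra.
  by move=> [[h1 h2] h3]; do 2!split => //; rewrite ltNge; apply/negP => h4; apply: h3.
- exact: gT_ball_finite.
- by move=> w [h1 h2]; split => //=; lra.
Qed.

Lemma dens_box x y s t : 0 <= x -> x <= y -> y <= pi / 2 -> 0 <= s -> s < t ->
  dens (fun X => (cnt (box x y s t X))%:R) (k0 * (y - x) * (t - s)).
Proof.
move=> x0 xy y1 s0 st.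
have d z r : 0 <= z <= pi / 2 -> 0 <= r -> dens (fun X => cdf z (X * r)) (k0 * z * r).
  move=> zb; rewrite le_eqVlt => /predU1P[<-|r0]; last exact/dens_scale/dens_cdf.
  rewrite mulr0; apply: dens_ext dens0 => X; rewrite mulr0 /cdf.
  rewrite (_ : [set w | _] = set0) ?cnt0 //; apply/seteqP; split => // w /= [].
  by have := gT_ge3 w; lra.
have dx r : 0 <= r -> dens (fun X => cdf y (X * r) - cdf x (X * r)) (k0 * y * r - k0 * x * r).
  by move=> r0; apply/densD/densN; apply: d => //; lra.
have t0 : 0 <= t by lra.
have := densD (dx _ t0) (densN (dx _ s0)).
rewrite [X in dens _ X -> _](_ : _ = k0 * (y - x) * (t - s)); last by ring.
move=> h e e0; have := h _ e0; have := @nbhs_pinfty_gt R 0 (num_real _).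
apply: filterS2 => X X0; rewrite cnt_box_cdf //.
by rewrite ler_pM2l // ltW.
Qed.

Lemma cnt_layers (S : set (seq bool)) (n : nat) (rho : nat -> R) :
  rho 0 <= 0 -> (forall i, rho i <= rho i.+1) ->
  cnt [set w | gT w <= rho n /\ S w] =
  (\sum_(i < n) cnt [set w | gT w <= rho i.+1 /\ (rho i < gT w /\ S w)]%R)%N.
Proof.
move=> r0 rm; elim: n => [|n IH].
  rewrite big_ord0 (_ : [set w | _] = set0) ?cnt0 //.
  by apply/seteqP; split => // w [h _]; have := gT_ge3 w; lra.
rewrite big_ord_recr /= -IH (@cntD _ _ [set w | gT w <= rho n /\ S w]).
- congr addn; congr cnt; apply/seteqP; split => w /=.
    by move=> [[h1 h2] h3]; do 2!split => //; rewrite ltNge; apply/negP => h; apply: h3.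
  by move=> [h1 [h2 h3]]; split => //; move=> [h4 _]; lra.
- exact: gT_ball_finite.
- by move=> w [h1 h2]; split => //=; have := rm n; lra.
Qed.

Definition triangle x h omega X :=
  [set w | gT w <= X * h /\ `|2 * psi w - 2 * x| <= omega * gT w / X].

(* The triangle is sandwiched between two staircases of [n] boxes. *)
Lemma dens_triangle x h omega : 0 < h -> 0 < omega ->
  0 <= x - omega * h -> x + omega * h <= pi / 2 ->
  dens (fun X => (cnt (triangle x h omega X))%:R) (k0 * omega * h ^+ 2 / 2).
Proof.
move=> h0 o0 xl xr e e0; have kp := k0_gt0.
have c0 : 0 < k0 * omega * h ^+ 2 * 4.
  by rewrite mulr_gt0 // mulr_gt0 ?exprn_gt0 // mulr_gt0.
have c0' : 0 <= k0 * omega * h ^+ 2 by lra.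
have e2 : 0 < e / 2 by lra.
pose n := (Num.trunc (k0 * omega * h ^+ 2 * 4 / (e / 2))).+1.
have n0 : (0 < n)%N by [].
have n1 : 1 <= n%:R :> R by rewrite ler1n.
have nb : k0 * omega * h ^+ 2 * 4 / n%:R <= e / 2.
  rewrite ler_pdivrMr ?ltr0n // [leRHS]mulrC -ler_pdivrMr // ltW //.
  by have /andP[] := truncn_itv (divr_ge0 (ltW c0) (ltW e2)).
clearbody n.
have i1 : 0 < n%:R^-1 :> R by rewrite invr_gt0; lra.
(* Half-width of the triangle, in the coordinate psi, at height k h / n. *)
pose st (k : nat) : R := omega * (k%:R * h / n%:R) / 2.
have stb k : (k <= n.+1)%N -> 0 <= st k <= omega * h.
  move=> kn; have kn' : k%:R <= 2 * n%:R :> R.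
    by rewrite -natrM ler_nat (leq_trans kn) // mul2n -addnn -addn1 leq_add2l.
  rewrite /st; apply/andP; split; first by rewrite !(divr_ge0, mulr_ge0) // ltW.
  have : k%:R / n%:R <= 2 :> R by rewrite ler_pdivrMr; lra.
  have oh : 0 < omega * h by rewrite mulr_gt0.
  rewrite -(ler_pM2l oh); lra.
(* The shift d = 0 gives boxes inside the triangle, d = 2 boxes covering it. A shift by 1 is not
   enough for the cover, since a box excludes its left end in psi. *)
pose bx d i X : R := (cnt (box (x - st (i + d)%N) (x + st (i + d)%N) (i%:R * h / n%:R) (i.+1%:R * h / n%:R) X))%:R.
have dbx d : (d <= 2)%N -> dens (fun X => \sum_(i < n) bx d i X)
    (\sum_(i < n) (k0 * omega * h ^+ 2 / n%:R ^+ 2 * (i + d)%:R)).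
  move=> d2; apply: (@dens_sum n (bx d) (fun i => k0 * omega * h ^+ 2 / n%:R ^+ 2 * (i + d)%:R)) => i ilt.
  have idn : (i + d <= n.+1)%N.
    by apply: (@leq_trans (i + 2)); rewrite ?leq_add2l // addn2 ltnS.
  have /andP[s0 s1] := stb _ idn.
  rewrite (_ : _ * _%:R = k0 * ((x + st (i + d)%N) - (x - st (i + d)%N)) * (i.+1%:R * h / n%:R - i%:R * h / n%:R)).
    apply: dens_box; try lra.
      by rewrite !(divr_ge0, mulr_ge0) // ltW.
    by rewrite ltr_pM2r // ltr_pM2r // ltr_nat.
  by rewrite /st -[i.+1%:R]natr1; field; lra.
have sumd d : \sum_(i < n) (k0 * omega * h ^+ 2 / n%:R ^+ 2 * (i + d)%:R) =
    k0 * omega * h ^+ 2 / 2 + k0 * omega * h ^+ 2 / n%:R * (d%:R - 1 / 2).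
  rewrite -mulr_sumr (_ : \sum_(i < n) _ = n%:R * (n%:R - 1) / 2 + n%:R * d%:R).
    by field; lra.
  elim: (n) => [|m IH]; first by rewrite big_ord0 !mul0r addr0.
  by rewrite big_ord_recr /= IH natrD -natr1; field.
have e4 : 0 < e / 4 by lra.
have D0 := dbx 0%N isT _ e4; have D2 := dbx 2%N isT _ e4.
rewrite !sumd in D0 D2.
near=> X.
have X0 : 0 < X by near: X; exact: nbhs_pinfty_gt.
have L : `|\sum_(i < n) bx 0%N i X - (k0 * omega * h ^+ 2 / 2 + k0 * omega * h ^+ 2 / n%:R * (0 - 1 / 2)) * X| <= e / 4 * X.
  by near: X.
have U : `|\sum_(i < n) bx 2 i X - (k0 * omega * h ^+ 2 / 2 + k0 * omega * h ^+ 2 / n%:R * (2 - 1 / 2)) * X| <= e / 4 * X.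
  by near: X.
pose rho (i : nat) := X * (i%:R * h / n%:R).
have rho0 : rho 0%N <= 0 by rewrite /rho !mul0r mulr0.
have rhoS i : rho i <= rho i.+1.
  by rewrite /rho ler_pM2l // ler_pM2r // ler_pM2r // ler_nat.
have rhon : rho n = X * h by rewrite /rho mulrAC divff ?mul1r // gt_eqF // ltr0n.
have := @cnt_layers [set w | `|2 * psi w - 2 * x| <= omega * gT w / X] n rho rho0 rhoS.
rewrite rhon => E.
have rho_lt (i : nat) w : rho i < gT w -> 2 * st i <= omega * gT w / X.
  rewrite /rho /st => hlt; rewrite ler_pdivlMr //.
  by have := ler_wpM2l (ltW o0) (ltW hlt); clear; lra.
have rho_le (i : nat) w : gT w <= rho i.+1 -> omega * gT w / X < 2 * st (i + 2)%N.
  rewrite /rho /st => hle; rewrite ltr_pdivrMr //.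
  have := ler_wpM2l (ltW o0) hle.
  have : 0 < omega * (h * n%:R^-1) * X by rewrite !mulr_gt0.
  by rewrite natrD -[i.+1%:R]natr1; clear; lra.
have lo : \sum_(i < n) bx 0%N i X <= (cnt (triangle x h omega X))%:R.
  rewrite E natr_sum; apply: ler_sum => i _; rewrite ler_nat; apply: cnt_le.
    exact: gT_ball_finite.
  move=> w [h1 [h2 [h3 h4]]] /=; do 2!split => //.
  by have := rho_lt _ _ h2; rewrite addn0 in h3 h4; rewrite ler_norml; clear -h3 h4; lra.
have up : (cnt (triangle x h omega X))%:R <= \sum_(i < n) bx 2 i X.
  rewrite E natr_sum; apply: ler_sum => i _; rewrite ler_nat; apply: cnt_le.
    exact: box_finite.
  move=> w [h1 [h2 h3]]; do 2!split => //=.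
  by have := rho_le _ _ h1; move: h3 => /=; rewrite ler_norml; clear; lra.
have nbX : k0 * omega * h ^+ 2 * 4 / n%:R * X <= e / 2 * X by rewrite ler_pM2r.
have c1 : 0 <= k0 * omega * h ^+ 2 / n%:R * X.
  exact: mulr_ge0 (mulr_ge0 c0' (ltW i1)) (ltW X0).
move: (\sum_(i < n) bx 0%N i X) (\sum_(i < n) bx 2%N i X) L U lo up => S0 S2.
move: nbX c1; rewrite (_ : k0 * omega * h ^+ 2 * 4 / n%:R * X = 4 * (k0 * omega * h ^+ 2 / n%:R * X)); last by ring.
rewrite !mulrDl ![k0 * omega * h ^+ 2 / n%:R * _ * X]mulrAC.
move: (k0 * omega * h ^+ 2 / n%:R * X) (k0 * omega * h ^+ 2 / 2 * X) ((cnt _)%:R) => p q c.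
by clear; rewrite !ler_norml; lra.
Unshelve. all: by end_near. Qed.

(** * The angle theta and the hyperbolic triangle *)

(** Entries of gamma gamma^T, in contrast with gamma^T gamma above. They determine theta, whose
    tangent is 2 p12 / (p22 - p11); [theta_gam] identifies [th] with it. *)
Definition p11 w := ra w ^+ 2 + rb w ^+ 2.
Definition p12 w := ra w * (ra w + rc w) + rb w * (rb w + rd w).
Definition p22 w := (ra w + rc w) ^+ 2 + (rb w + rd w) ^+ 2.
Definition th w := ang (p22 w - p11 w) (2 * p12 w).

Lemma gT_p w : gT w = p11 w + p22 w.
Proof. by rewrite /gT /g11 /g22 /p11 /p22; ring. Qed.

Lemma p_det w : p11 w * p22 w - p12 w ^+ 2 = 1.
Proof. by rewrite -[1]mulr1 -{1}(r_det w) -(r_det w) /p11 /p12 /p22; ring. Qed.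

Lemma p12_ge1 w : 1 <= p12 w.
Proof.
by have := ra_ge1 w; have := rd_ge1 w; have := rb_ge0 w; have := rc_ge0 w;
  rewrite /p12; nra.
Qed.

Lemma p11_le w : p11 w <= p22 w.
Proof.
have := rb_ge0 w; have := rc_ge0 w; have := ra_ge1 w; have := rd_ge1 w.
by rewrite /p11 /p22; nra.
Qed.

Lemma thP w : [/\ cos (th w) = (p22 w - p11 w) / gS w,
  sin (th w) = 2 * p12 w / gS w, 0 < th w & th w <= pi / 2].
Proof.
have q0 : 0 < 2 * p12 w by have := p12_ge1 w; lra.
have [c s a b] := ang_cos_sin_up (p22 w - p11 w) q0.
have e : gS w = Num.sqrt ((p22 w - p11 w) ^+ 2 + (2 * p12 w) ^+ 2).
  by congr Num.sqrt; rewrite gT_p; have := p_det w; lra.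
rewrite e; split => //.
rewrite leNgt; apply/negP => h.
have : cos (th w) < 0.
  by rewrite -cos_pihalf ltr_cos ?in_itv //=; have := pi_gt0 R; rewrite -/(th w) in a b; lra.
rewrite c ltNge divr_ge0 ?sqrtr_ge0 // subr_ge0; exact: p11_le.
Qed.

Definition kap2 w w' := p12 w * (p22 w' - p11 w') - p12 w' * (p22 w - p11 w).

Lemma sin_th w w' : sin (th w - th w') = 2 * kap2 w w' / (gS w * gS w').
Proof.
have [c s _ _] := thP w; have [c' s' _ _] := thP w'.
rewrite sinB c s c' s' /kap2; field.
by rewrite !lt0r_neq0 // gS_gt0.
Qed.

Definition kap w m := n12 m * (g11 w - g22 w) - g12 w * (n11 m - n22 m).

(** In a hyperbolic triangle the product of the sine of an angle and the hyperbolic sines of the two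
    adjacent sides does not depend on the vertex. [kap2] is this quantity, up to a factor, at the
    vertex i of the triangle i, gamma i, gamma M i. Applying gamma^-1 moves the reading to the
    vertex i of gamma^-1 i, i, M i, where only gamma^T gamma and M M^T enter. *)
Lemma kap2_cat w m : kap2 w (w ++ m) = kap w m.
Proof.
rewrite /kap2 /kap /p11 /p12 /p22; have [-> -> -> ->] := r_cat w m.
rewrite -[RHS]mulr1 -(r_det w) /n11 /n12 /n22 /g11 /g12 /g22; ring.
Qed.

(** The counterpart of [psi] for M M^T. Below, [nS] is the gap between its eigenvalues and [Lam] the
    larger one. *)
Definition phi0 m := ang (n11 m - n22 m) (2 * n12 m) / 2.
Definition nS m := Num.sqrt (nT m ^+ 2 - 4).
Definition Lam m := (nT m + nS m) / 2.

Lemma n12_gt0 m : m != [::] -> 1 <= n12 m.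
Proof. by move=> m0; apply: le_trans (n12_ge m); rewrite ler1n lt0n size_eq0. Qed.

Lemma nT_sqr m : nT m ^+ 2 - 4 = (n11 m - n22 m) ^+ 2 + (2 * n12 m) ^+ 2.
Proof. by rewrite /nT; have := n_det m; lra. Qed.

Lemma nS_gt0 m : m != [::] -> 0 < nS m.
Proof.
move=> /n12_gt0 n0; rewrite sqrtr_gt0 nT_sqr; have := sqr_ge0 (n11 m - n22 m); nra.
Qed.

Lemma nS_sqr m : nS m ^+ 2 = nT m ^+ 2 - 4.
Proof. by rewrite sqr_sqrtr // nT_sqr addr_ge0 ?sqr_ge0. Qed.

Lemma phi0P m : m != [::] -> [/\ cos (2 * phi0 m) = (n11 m - n22 m) / nS m,
  sin (2 * phi0 m) = 2 * n12 m / nS m, 0 < phi0 m & phi0 m < pi / 2].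
Proof.
move=> m0; have q0 : 0 < 2 * n12 m by have := n12_gt0 m0; lra.
have [c s a b] := ang_cos_sin_up (n11 m - n22 m) q0.
have -> : 2 * phi0 m = ang (n11 m - n22 m) (2 * n12 m) by rewrite /phi0; lra.
rewrite /nS nT_sqr; split => //; rewrite /phi0; lra.
Qed.

(* The hyperbolic laws of sines and of cosines in the triangle with vertices
   [i], [gamma^-1 i] and [M i]. *)
Lemma kap_sin w m : m != [::] ->
  2 * kap w m = gS w * nS m * sin (2 * phi0 m - 2 * psi w).
Proof.
move=> m0; have [c s _ _] := phi0P m0; have [c' s' _ _] := psiP w.
rewrite sinB c s c' s' /kap; field.
by rewrite !lt0r_neq0 ?gS_gt0 ?nS_gt0.
Qed.

Lemma gT_cat_cos w m : m != [::] ->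
  2 * gT (w ++ m) = gT w * nT m + gS w * nS m * cos (2 * phi0 m - 2 * psi w).
Proof.
move=> m0; have [c s _ _] := phi0P m0; have [c' s' _ _] := psiP w.
rewrite cosB c s c' s' gT_cat /gT /nT; field.
by rewrite !lt0r_neq0 ?gS_gt0 ?nS_gt0.
Qed.

Lemma Lam_inv m : Lam m * (nT m - Lam m) = 1.
Proof. by rewrite /Lam; have := nS_sqr m; lra. Qed.

Lemma nT_ge3 m : m != [::] -> 3 <= nT m.
Proof.
move=> /n12_gt0; have a1 := ra_ge1 m; have d1 := rd_ge1 m.
rewrite /nT /n12 /n11 /n22.
have b2 : rb m = 0 \/ 1 <= rb m by rewrite /rb; case: (wB m); [left|right; rewrite ler1n].
have c2 : rc m = 0 \/ 1 <= rc m by rewrite /rc; case: (wC m); [left|right; rewrite ler1n].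
by case: b2 c2 => [->|b2] [->|c2]; nra.
Qed.

Lemma gS_le w : gS w <= gT w.
Proof.
have t := gT_ge3 w; rewrite -[leRHS]ger0_norm; last by lra.
by rewrite -sqrtr_sqr ler_wsqrtr //; lra.
Qed.


Lemma gT_cat_le w m : m != [::] -> gT (w ++ m) <= Lam m * gT w.
Proof.
move=> m0; have := gT_cat_cos w m0; have := cos_le1 (2 * phi0 m - 2 * psi w).
have s0 := nS_gt0 m0; have t0 := gS_gt0 w; have t1 := gS_le w; rewrite /Lam => c E.
have : gS w * nS m * cos (2 * phi0 m - 2 * psi w) <= gT w * nS m * 1.
  apply: le_trans (_ : gS w * nS m * 1 <= _).
    by rewrite ler_pM2l // mulr_gt0.
  by rewrite !mulr1 ler_pM2r.
lra.
Qed.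

Lemma sin_th_cat w m : m != [::] ->
  sin (th w - th (w ++ m)) = nS m * sin (2 * phi0 m - 2 * psi w) / gS (w ++ m).
Proof.
move=> m0; rewrite sin_th kap2_cat kap_sin //; field.
by rewrite !lt0r_neq0 // gS_gt0.
Qed.

Lemma gS_ge e w : 0 < e -> 4 / e <= gT w -> (1 - e) * gT w <= gS w.
Proof.
move=> e0; have t := gT_ge3 w; rewrite ler_pdivrMr // => h.
have [e1|e1] := leP 1 e; first by have := gS_gt0 w; nra.
apply: le_sqrt; first by rewrite mulr_ge0; lra.
by nra.
Qed.

Lemma norm_sin x : - pi <= x <= pi -> `|sin x| = sin `|x|.
Proof.
move=> x1; have [x0|x0] := leP 0 x.
  by rewrite (ger0_norm x0) ger0_norm //; apply: sin_ge0_pi; lra.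
have : 0 <= sin (- x) by apply: sin_ge0_pi; lra.
by rewrite (ltr0_norm x0) sinN => h; rewrite ler0_norm //; lra.
Qed.

Lemma norm_sin_le x : `|sin x| <= `|x|.
Proof.
have p2 := pi_ge2 R; have [h|h] := boolP (- pi <= x <= pi).
  by rewrite norm_sin // sin_le.
apply: le_trans (sin_max x) _; have [x0|x0] := leP 0 x.
  by rewrite ger0_norm //; lra.
by rewrite ltr0_norm //; lra.
Qed.

Lemma sqr_normr x : `|x| ^+ 2 = x ^+ 2.
Proof. by rewrite real_normK ?num_real. Qed.

Lemma cos_ge x : 1 - x ^+ 2 / 2 <= cos x.
Proof.
have -> : x = x / 2 *+ 2 by rewrite mulr2n; lra.
have -> : (x / 2 *+ 2) ^+ 2 = 4 * (x / 2) ^+ 2 by rewrite mulr2n; lra.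
rewrite cos_mulr2n; have := cos2Dsin2 (x / 2); set y := x / 2.
have : sin y ^+ 2 <= y ^+ 2 by rewrite -(sqr_normr (sin y)) -(sqr_normr y) ler_sqr ?nnegrE // norm_sin_le.
by rewrite -[_ *+ 2]mulr_natl; move: (cos y ^+ 2) (sin y ^+ 2) (y ^+ 2) => *; lra.
Qed.

Lemma norm_sin_ge e x : 0 < e < 1 -> `|x| <= e -> (1 - e) * `|x| <= `|sin x|.
Proof.
move=> /andP[e0 e1] xe; have p2 := pi_ge2 R.
have xx : -pi <= x <= pi by move: xe; rewrite ler_norml; lra.
rewrite norm_sin //; have := normr_ge0 x; move: (`|x| : R) xe => y xe y0.
have := @le_tan y; rewrite y0 /= => /(_ _).
have c := cos_ge y; have c0 : 0 < cos y by nra.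
rewrite /tan ler_pdivlMr // => /(_ _) h; apply: le_trans (h _); last by lra.
by rewrite mulrC ler_wpM2l //; nra.
Qed.

Lemma small_angle e s y : 0 < e < 1 -> `|y| <= pi / 2 -> `|sin y| <= s -> s ^+ 2 <= e ->
  (1 - e) * `|y| <= s.
Proof.
move=> /andP[e0 e1] yp sy se; have p2 := pi_ge2 R.
have yy : -pi <= y <= pi by move: yp; rewrite ler_norml; lra.
move: sy; rewrite norm_sin //; have := normr_ge0 y; move: (`|y| : R) yp => z yp z0 sz.
have s0 : 0 <= sin z by apply: sin_ge0_pi; lra.
have c0 : 0 <= cos z by apply: cos_ge0_pihalf; lra.
have c1 := cos_le1 z; have cs := cos2Dsin2 z.
have s2 : sin z ^+ 2 <= e by apply: le_trans se; rewrite ler_sqr ?nnegrE //; lra.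
have cz : 1 - e <= cos z by nra.
have zp : z < pi / 2.
  rewrite lt_neqAle yp andbT; apply/eqP => E; move: s2; rewrite E sin_pihalf expr1n; lra.
have := @le_tan z; rewrite z0 zp => /(_ isT); rewrite /tan ler_pdivlMr; last by lra.
by move=> h; apply: le_trans sz; apply: le_trans h; rewrite mulrC ler_wpM2l.
Qed.

Lemma local_gS m e : m != [::] -> 0 < e < 1 -> forall w, 16 / e <= gT w ->
  `|2 * phi0 m - 2 * psi w| <= e -> (1 - e) * (Lam m * gT w) <= gS (w ++ m).
Proof.
move=> m0 /andP[e0 e1] w wZ; set x := 2 * phi0 m - 2 * psi w => xe.
have E := gT_cat_cos w m0; rewrite -/x in E.
have t := gT_ge3 w; have n3 := nT_ge3 m0; have s0 := nS_gt0 m0; have sw := gS_gt0 w.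
have c : 1 - e / 2 <= cos x.
  apply: le_trans (cos_ge x); have : x ^+ 2 <= e ^+ 2.
    by rewrite -(sqr_normr x) ler_sqr ?nnegrE //; lra.
  nra.
have e4 : 0 < e / 4 by lra.
have wZ4 : 4 / (e / 4) <= gT w by apply: le_trans wZ; rewrite le_eqVlt; apply/orP; left; apply/eqP; field; lra.
have gSw := gS_ge e4 wZ4.
have h1 : (1 - e / 4) * gT w * (1 - e / 2) <= gS w * cos x.
  have tp : 0 <= gT w by rewrite (le_trans _ t).
  by apply: ler_pM => //; [rewrite mulr_ge0 //|]; clear -e0 e1; lra.
have h2 : (1 - 3 * e / 4) * gT w * nS m <= gS w * cos x * nS m.
  rewrite ler_pM2r //; apply: le_trans h1; nra.
have h3 : (1 - 3 * e / 4) * (Lam m * gT w) <= gT (w ++ m).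
  have : (1 - 3 * e / 4) * (gT w * nT m) <= gT w * nT m by rewrite ler_piMl ?mulr_ge0 ?(le_trans _ t) ?(le_trans _ n3) //; clear -e0 e1; lra.
  by rewrite /Lam; clear -E h2; lra.
have h4 : gT w <= gT (w ++ m).
  have : 0 <= gS w * cos x * nS m by rewrite !mulr_ge0 ?(ltW sw) ?(ltW s0) //; lra.
  nra.
have := gS_ge e4 (le_trans wZ4 h4).
have L0 : 0 <= Lam m by rewrite divr_ge0 // addr_ge0 ?(ltW s0) // (le_trans _ n3).
have h5 : 0 <= Lam m * gT w by rewrite mulr_ge0 // (le_trans _ t).
by clear -h3 h5 e0 e1; nra.
Qed.

(** On (a - pi, a) the sine is small near 0 and possibly near the two ends; the comparison with sin
    a keeps y away from the ends. It is applied with a = 2 phi0, since psi ranges over (0, pi/2). *)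
Lemma sin_away (a e y : R) : 0 < a < pi -> 0 < e < 1 -> a - pi < y < a ->
  `|sin y| < sin e -> `|sin y| < sin a -> `|y| <= e.
Proof.
move=> a0 e0 ya s1 s2; have p2 := pi_ge2 R.
have yp : - pi <= y <= pi by lra.
rewrite norm_sin // in s1 s2; rewrite leNgt; apply/negP => ey.
have mono (u v : R) : 0 <= u -> u < v -> v <= pi / 2 -> sin u < sin v :> R.
  by move=> *; rewrite ltr_sin // in_itv /=; lra.
have [h|h] := leP `|y| (pi / 2).
  by have := mono e `|y|; lra.
have F : sin (pi - `|y|) = sin `|y| by rewrite sinB sinpi cospi; lra.
have Fa : sin (pi - a) = sin a by rewrite sinB sinpi cospi; lra.
have [y0|y0] := leP 0 y.
  rewrite (ger0_norm y0) in F h s2 ey; have := mono (pi - a) (pi - y); lra.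
rewrite (ltr0_norm y0) in F h s2 ey; have := mono a (pi - - y); lra.
Qed.

Definition Nm m tau X := [set w | gT (w ++ m) <= X /\ `|th w - th (w ++ m)| <= tau / X].
(** For large gamma and psi near phi0, the angle difference is about nS (2 phi0 - 2 psi) / (Lam gT
    w). So [Nm] is nearly the triangle with h = 1 / Lam and omega = Lam tau / nS, and its density k0
    omega h^2 / 2 is [cm m] times tau. *)
Definition cm m := k0 / (2 * Lam m * nS m).

Lemma Nm_finite m tau X : finite_set (Nm m tau X).
Proof. by apply: sub_finite_set (ball_finite m X) => w []. Qed.

Lemma thB_le w w' : `|th w - th w'| <= pi / 2.
Proof.
have [_ _ a b] := thP w; have [_ _ a' b'] := thP w'.
by rewrite ler_norml; lra.
Qed.

Lemma Nm_outer m e tau X w : m != [::] -> 0 < e < 1 -> 0 < X ->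
  tau < nS m * sin e -> tau < nS m * sin (2 * phi0 m) -> 16 / e <= gT w ->
  Nm m tau X w ->
  triangle (phi0 m) ((1 - e) * Lam m)^-1 (Lam m * tau / ((1 - e) * nS m)) X w.
Proof.
move=> m0 ee X0 t1 t2 wZ [wX wth]; have s0 := nS_gt0 m0.
have E := sin_th_cat w m0; set x := 2 * phi0 m - 2 * psi w in E.
have sg := gS_gt0 (w ++ m); have gl := gS_le (w ++ m); have gc := gT_cat_le w m0.
have D : nS m * `|sin x| <= gS (w ++ m) * (tau / X).
  rewrite -ler_pdivrMl //; apply: le_trans wth; apply: le_trans (norm_sin_le _).
  by rewrite E !normrM normfV (gtr0_norm s0) (gtr0_norm sg) mulrC.
have t0 : 0 <= tau / X by apply: le_trans wth.
have sx : nS m * `|sin x| <= tau.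
  apply: le_trans D _; rewrite mulrA ler_pdivrMr // mulrC ler_wpM2l //; last by lra.
  by move: t0; rewrite pmulr_lge0 // invr_gt0.
have [_ _ f0 f1] := phi0P m0; have [_ _ q0 q1] := psiP w.
have xe : `|x| <= e.
  apply: (@sin_away (2 * phi0 m)) => //; rewrite ?/x; try by clear -f0 f1 q0 q1; lra.
    by rewrite -(ltr_pM2l s0); apply: le_lt_trans sx t1.
  by rewrite -(ltr_pM2l s0); apply: le_lt_trans sx t2.
have h := local_gS m0 ee wZ xe; case/andP: (ee) => e0 e1.
have L0 : 0 < Lam m by rewrite /Lam; have := nT_ge3 m0; lra.
have e1' : 0 < 1 - e by lra.
split.
  have eL : 0 < (1 - e) * Lam m by rewrite mulr_gt0.
  by rewrite ler_pdivlMr // [leLHS]mulrC -mulrA; lra.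
rewrite distrC -/x.
rewrite (_ : _ * gT w / X = (Lam m * gT w * (tau / X) / nS m) / (1 - e)); last first.
  by field; rewrite !lt0r_neq0.
rewrite ler_pdivlMr // [leLHS]mulrC; apply: le_trans (norm_sin_ge ee xe) _.
rewrite ler_pdivlMr // [leLHS]mulrC; apply: le_trans D _.
by apply: ler_wpM2r => //; lra.
Qed.

Lemma Nm_inner m e tau X w : m != [::] -> 0 < e < 1 -> 0 < X -> 0 < tau ->
  tau <= nS m * e -> (tau / X) ^+ 2 <= e -> 16 / e <= gT w ->
  triangle (phi0 m) (Lam m)^-1 ((1 - e) ^+ 2 * (Lam m * tau / nS m)) X w ->
  Nm m tau X w.
Proof.
move=> m0 ee X0 tau0 t1 tX wZ [wX]; have s0 := nS_gt0 m0; case/andP: (ee) => e0 e1.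
have L0 : 0 < Lam m by rewrite /Lam; have := nT_ge3 m0; lra.
have E := sin_th_cat w m0; rewrite distrC; set x := 2 * phi0 m - 2 * psi w in E *.
have sg := gS_gt0 (w ++ m); have gc := gT_cat_le w m0.
rewrite (_ : _ * gT w / X = (1 - e) ^+ 2 * (tau / nS m) * (Lam m * gT w / X)); last first.
  by field; rewrite !lt0r_neq0.
move=> xle; rewrite ler_pdivlMr // mulrC in wX.
have g3 := gT_ge3 w.
have r1 : 0 <= Lam m * gT w / X <= 1.
  have LG : 0 <= Lam m * gT w by apply: mulr_ge0; lra.
  by rewrite (divr_ge0 LG (ltW X0)) /= ler_pdivrMr // mul1r.
have te : tau / nS m <= e by rewrite ler_pdivrMr // mulrC.
have tn : 0 < tau / nS m by rewrite divr_gt0.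
have e2 : 0 <= (1 - e) ^+ 2 <= 1 by apply/andP; split; nra.
have xe : `|x| <= e.
  apply: le_trans xle _; apply: le_trans (_ : 1 * (tau / nS m) * 1 <= _); last by lra.
  case/andP: r1 => r10 r11; case/andP: e2 => e20 e21.
  apply: ler_pM => //; first by rewrite mulr_ge0 // ltW.
  by rewrite ler_pM2r.
have h := local_gS m0 ee wZ xe.
split; first by lra.
have ty : `|sin (th w - th (w ++ m))| <= (1 - e) * (tau / X).
  rewrite E !normrM normfV (gtr0_norm s0) (gtr0_norm sg) ler_pdivrMr //.
  apply: le_trans (_ : nS m * `|x| <= _); first by rewrite ler_pM2l // norm_sin_le.
  apply: le_trans (_ : nS m * ((1 - e) ^+ 2 * (tau / nS m) * (Lam m * gT w / X)) <= _).
    by rewrite ler_pM2l.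
  rewrite (_ : _ * (_ * _ * _) = (1 - e) * (tau / X) * ((1 - e) * (Lam m * gT w))); last first.
    by field; rewrite !lt0r_neq0.
  by apply: ler_wpM2l => //; rewrite mulr_ge0 ?divr_ge0 ?(ltW tau0) ?(ltW X0) //; lra.
have tX0 : 0 < tau / X by rewrite divr_gt0.
have sq : ((1 - e) * (tau / X)) ^+ 2 <= e.
  apply: le_trans tX; rewrite exprMn ler_piMl ?sqr_ge0 //; by case/andP: e2.
have := small_angle ee (thB_le w (w ++ m)) ty sq.
by rewrite ler_pM2l //; lra.
Qed.

(** * The contribution of a fixed matrix *)

Lemma Lam_gt1 m : m != [::] -> 1 < Lam m.
Proof. by move=> m0; rewrite /Lam; have := nT_ge3 m0; have := nS_gt0 m0; lra. Qed.

Lemma cm_gt0 m : m != [::] -> 0 < cm m.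
Proof.
move=> m0; rewrite divr_gt0 ?k0_gt0 // mulr_gt0 ?nS_gt0 // mulr_gt0 //.
by have := Lam_gt1 m0; lra.
Qed.

Lemma inv_cube_le (e : R) : 0 < e < 1 -> (1 - e / 16)^-1 ^+ 3 <= 1 + e / 2.
Proof.
move=> ee; have h : 0 < 1 - e / 16 by lra.
rewrite exprVn -[leLHS]mul1r ler_pdivrMr ?exprn_gt0 //.
have : 1 - 3 * e / 16 <= (1 - e / 16) ^+ 3.
  by rewrite exprSr expr2; nra.
by nra.
Qed.

Lemma sandwich_numeric (e k a b c d p q : R) :
  a <= b + d -> c <= a + d -> `|b - p| <= e / 4 * k -> `|c - q| <= e / 4 * k ->
  d <= e / 4 * k -> p <= (1 + e / 2) * k -> (1 - e / 2) * k <= q ->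
  (1 - e) * k <= a <= (1 + e) * k.
Proof. by rewrite !ler_norml => *; apply/andP; split; lra. Qed.

Lemma Nm_asymp m e : m != [::] -> 0 < e < 1 -> exists2 t, 0 < t &
  forall tau, 0 < tau <= t -> \forall X \near +oo,
  (1 - e) * (cm m * tau) * X <= (cnt (Nm m tau X))%:R <= (1 + e) * (cm m * tau) * X.
Proof.
move=> m0 ee; have s0 := nS_gt0 m0; have L1 := Lam_gt1 m0; have kp := k0_gt0.
have [_ _ f0 f1] := phi0P m0; have pp := pi_gt0 R; have p2 := pi_ge2 R.
pose e' := e / 16; have ee' : 0 < e' < 1 by rewrite /e'; lra.
case/andP: (ee') => e'0 e'1; have e'1' : 0 < 1 - e' by lra.
(* The first bound serves [Nm_inner], the next two, halved for strictness, serve [Nm_outer]; the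
   last two keep the triangles inside the range [0, pi/2] of psi. *)
pose t := Num.min (nS m * e') (Num.min (nS m * sin e' / 2) (Num.min (nS m * sin (2 * phi0 m) / 2)
  (Num.min ((1 - e') ^+ 2 * nS m * phi0 m) ((1 - e') ^+ 2 * nS m * (pi / 2 - phi0 m))))).
have se : 0 < sin e' by apply: sin_gt0_pi; lra.
have sp : 0 < sin (2 * phi0 m) by apply: sin_gt0_pi; lra.
exists t.
  have f2 : 0 < pi / 2 - phi0 m by lra.
  have e2 : 0 < (1 - e') ^+ 2 by rewrite exprn_gt0.
  rewrite /t !lt_min (mulr_gt0 s0 e'0) !(divr_gt0 (mulr_gt0 _ _)) //.
  by rewrite !(mulr_gt0 (mulr_gt0 e2 s0)).
move=> tau /andP[tau0]; rewrite /t !le_min => /andP[t1 /andP[t2 /andP[t3 /andP[t4 t5]]]].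
have c0 : 0 < cm m * tau by rewrite mulr_gt0 ?cm_gt0.
pose h1 := ((1 - e') * Lam m)^-1; pose o1 := Lam m * tau / ((1 - e') * nS m).
pose h2 := (Lam m)^-1; pose o2 := (1 - e') ^+ 2 * (Lam m * tau / nS m).
have L0 : 0 < Lam m by lra.
have h10 : 0 < h1 by rewrite invr_gt0 mulr_gt0.
have h20 : 0 < h2 by rewrite invr_gt0.
have o10 : 0 < o1 := divr_gt0 (mulr_gt0 L0 tau0) (mulr_gt0 e'1' s0).
have o20 : 0 < o2 := mulr_gt0 (exprn_gt0 2 e'1') (divr_gt0 (mulr_gt0 L0 tau0) s0).
have oh1 : o1 * h1 = tau / ((1 - e') ^+ 2 * nS m) by rewrite /o1 /h1; field; rewrite !lt0r_neq0.
have oh2 : o2 * h2 = (1 - e') ^+ 2 * (tau / nS m) by rewrite /o2 /h2; field; rewrite !lt0r_neq0.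
have q0 : 0 < (1 - e') ^+ 2 * nS m by rewrite mulr_gt0 ?exprn_gt0.
have b1 : o1 * h1 <= phi0 m by rewrite oh1 ler_pdivrMr // mulrC.
have b2 : o1 * h1 <= pi / 2 - phi0 m by rewrite oh1 ler_pdivrMr // mulrC.
have b3 : o2 * h2 <= o1 * h1.
  rewrite oh1 oh2 [leRHS](_ : _ = ((1 - e') ^+ 2)^-1 * (tau / nS m)); last first.
    by field; rewrite !lt0r_neq0.
  rewrite ler_pM2r ?divr_gt0 //.
  have le1 : (1 - e') ^+ 2 <= 1 by rewrite expr_le1 ?(ltW e'1') // gerBl ltW.
  apply: (le_trans le1); rewrite invf_ge1; [exact: le1 | exact: exprn_gt0].
have e0 : 0 < e by case/andP: ee.
have d : 0 < e / 4 * (cm m * tau) by exact: mulr_gt0 (divr_gt0 e0 (ltr0n R 4)) c0.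
have b1' : 0 <= phi0 m - o1 * h1 by rewrite subr_ge0.
have b2' : phi0 m + o1 * h1 <= pi / 2 by rewrite addrC -lerBrDr.
have D1 := @dens_triangle (phi0 m) h1 o1 h10 o10 b1' b2' _ d.
have b1'' : 0 <= phi0 m - o2 * h2 by rewrite subr_ge0 (le_trans b3).
have b2'' : phi0 m + o2 * h2 <= pi / 2 by rewrite addrC -lerBrDr (le_trans b3).
have D2 := @dens_triangle (phi0 m) h2 o2 h20 o20 b1'' b2'' _ d.
near=> X.
have X0 : 0 < X by near: X; exact: nbhs_pinfty_gt.
have T1 : `|(cnt (triangle (phi0 m) h1 o1 X))%:R - k0 * o1 * h1 ^+ 2 / 2 * X| <= e / 4 * (cm m * tau) * X.
  by near: X.
have T2 : `|(cnt (triangle (phi0 m) h2 o2 X))%:R - k0 * o2 * h2 ^+ 2 / 2 * X| <= e / 4 * (cm m * tau) * X.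
  by near: X.
(* The comparison with the triangles requires gT w >= 16 / e'; the finitely many other words cost a
   constant. *)
pose C := cnt (ball [::] (16 / e')).
have CX : C%:R <= e / 4 * (cm m * tau) * X by near: X; exact: near_cst.
have tX : (tau / X) ^+ 2 <= e'.
  have tX1 : tau / e' <= X by near: X; apply: nbhs_pinfty_ge; exact: num_real.
  have tX2 : tau <= X by near: X; apply: nbhs_pinfty_ge; exact: num_real.
  have i1 : tau / X <= 1 by rewrite ler_pdivrMr // mul1r.
  have i2 : tau / X <= e' by rewrite ler_pdivrMr // -ler_pdivrMl // mulrC.
  have i0 : 0 <= tau / X by rewrite divr_ge0 // ltW.
  by rewrite expr2; apply: le_trans i2; rewrite ler_piMl.
have tri_fin h o : finite_set (triangle (phi0 m) h o X) by exact: gT_ball_finite.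
have up : (cnt (Nm m tau X) <= cnt (triangle (phi0 m) h1 o1 X) + C)%N.
  apply: leq_trans (cntU_le (tri_fin _ _) (ball_finite _ _)).
  apply: cnt_le; first by rewrite finite_setU; split; [exact: tri_fin | exact: ball_finite].
  move=> w hw; have [wZ|wZ] := leP (16 / e') (gT w); last first.
    by right; rewrite /ball /= cats0 ltW.
  left; apply: Nm_outer => //.
    by apply: le_lt_trans t2 _; rewrite gtr_pMr ?mulr_gt0 // invf_lt1 ?ltr1n.
  by apply: le_lt_trans t3 _; rewrite gtr_pMr ?mulr_gt0 // invf_lt1 ?ltr1n.
have lo : (cnt (triangle (phi0 m) h2 o2 X) <= cnt (Nm m tau X) + C)%N.
  apply: leq_trans (cntU_le (Nm_finite _ _ _) (ball_finite _ _)).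
  apply: cnt_le; first by rewrite finite_setU; split; [exact: Nm_finite | exact: ball_finite].
  move=> w hw; have [wZ|wZ] := leP (16 / e') (gT w); last first.
    by right; rewrite /ball /= cats0 ltW.
  by left; apply: Nm_inner hw.
have e1 : k0 * o1 * h1 ^+ 2 / 2 = cm m * tau * (1 - e')^-1 ^+ 3.
  by rewrite /o1 /h1 /cm; field; rewrite !lt0r_neq0.
have e2 : k0 * o2 * h2 ^+ 2 / 2 = cm m * tau * (1 - e') ^+ 2.
  by rewrite /o2 /h2 /cm; field; rewrite !lt0r_neq0.
have f2 : 1 - e / 2 <= (1 - e') ^+ 2 by rewrite /e'; clear -ee; nra.
have cX : 0 < cm m * tau * X by rewrite mulr_gt0.
have g1 : cm m * tau * (1 - e')^-1 ^+ 3 * X <= (1 + e / 2) * (cm m * tau * X).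
  by rewrite mulrAC mulrC ler_pM2r // inv_cube_le.
have g2 : (1 - e / 2) * (cm m * tau * X) <= cm m * tau * (1 - e') ^+ 2 * X.
  by rewrite [leRHS]mulrAC [leRHS]mulrC ler_pM2r.
have mA (a b : R) : a * b * X = a * (b * X) by rewrite -mulrA.
move: up lo T1 T2 CX; rewrite -2!(ler_nat R) !natrD e1 e2 !(mA (e / 4)) !(mA (1 - e)) !(mA (1 + e)) => up lo T1 T2 CX.
exact: sandwich_numeric up lo T1 T2 CX g1 g2.
Unshelve. all: by end_near. Qed.

(** * Separation of the angles of words that are not nested *)

Lemma gT_le_row w : gT w <= 2 * (ra w + rc w + (rb w + rd w)) ^+ 2.
Proof.
have := ra_ge1 w; have := rb_ge0 w; have := rc_ge0 w; have := rd_ge1 w.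
by rewrite /gT /g11 /g22 => *; nra.
Qed.

(** [kap2] is bilinear in gamma gamma^T and gamma' gamma'^T, each of which is the sum of the c c^T
    over its columns c. A pair of columns contributes its determinant times its scalar product. *)
Lemma kap2_columns w w' : kap2 w w' =
  (ra w * (ra w' + rc w') - (ra w + rc w) * ra w') * (ra w * ra w' + (ra w + rc w) * (ra w' + rc w')) +
  (ra w * (rb w' + rd w') - (ra w + rc w) * rb w') * (ra w * rb w' + (ra w + rc w) * (rb w' + rd w')) +
  (rb w * (ra w' + rc w') - (rb w + rd w) * ra w') * (rb w * ra w' + (rb w + rd w) * (ra w' + rc w')) +
  (rb w * (rb w' + rd w') - (rb w + rd w) * rb w') * (rb w * rb w' + (rb w + rd w) * (rb w' + rd w')).
Proof. by rewrite /kap2 /p11 /p12 /p22; ring. Qed.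

Lemma dot_ge (k g x1 x2 y1 y2 : R) : 0 <= k -> g <= - k -> 0 <= x1 -> 0 <= x2 -> 0 <= y1 ->
  0 <= y2 -> k * (x2 * y2) <= - (g * (x1 * y1 + x2 * y2)).
Proof.
move=> k0 kg x10 x20 y10 y20; have xy1 := mulr_ge0 x10 y10; have xy2 := mulr_ge0 x20 y20.
by move: xy1 xy2; move: (x1 * y1) (x2 * y2) => *; nra.
Qed.

Lemma neg_sum_le (a a' p q : R) : 1 <= a -> 1 <= a' -> 0 <= p -> 0 <= q ->
  - (a * a' + p + q) <= - 1.
Proof. by move=> *; nra. Qed.

Lemma le_comb (a b c d : R) : 0 <= a -> 0 <= b -> 0 <= c -> 1 <= d ->
  b <= a * c + b * (c + d).
Proof. by move=> *; have : 0 <= a * c by [rewrite mulr_ge0]; nra. Qed.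

Lemma pos_or_zeros (a b c d : nat) : (0 < a)%N -> (0 < d)%N ->
  (0 < a * b + c * b + c * d)%N \/ (b = 0%N /\ c = 0%N).
Proof.
by move=> a0 d0; case: b => [|b]; case: c => [|c]; [right|left|left|left]; rewrite ?addn_gt0 ?muln_gt0 ?a0 ?d0 ?orbT.
Qed.

(** Once the words branch, the determinants of a column of gamma and a column of gamma' are integers
    of the same sign, and the scalar products are nonnegative, so nothing cancels in [kap2_columns].
    Three of the four determinants are at most -1; the remaining one may vanish. *)
Lemma kap2_branch u v v' w w' : w = u ++ false :: v -> w' = u ++ true :: v' ->
  gT w * gT w' <= 16 * kap2 w w' ^+ 2.
Proof.
move=> dw dw'.
have [ew1 ew2 ew3 ew4] : [/\ ra w = ra u * ra v + rb u * (ra v + rc v),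
  rb w = ra u * rb v + rb u * (rb v + rd v), rc w = rc u * ra v + rd u * (ra v + rc v)
  & rd w = rc u * rb v + rd u * (rb v + rd v)].
  rewrite dw; have [-> -> -> ->] := r_cat u (false :: v).
  by have [-> -> -> ->] := r_cons false v.
have [ew'1 ew'2 ew'3 ew'4] : [/\ ra w' = ra u * (ra v' + rc v') + rb u * rc v',
  rb w' = ra u * (rb v' + rd v') + rb u * rd v', rc w' = rc u * (ra v' + rc v') + rd u * rc v'
  & rd w' = rc u * (rb v' + rd v') + rd u * rd v'].
  rewrite dw'; have [-> -> -> ->] := r_cat u (true :: v').
  by have [-> -> -> ->] := r_cons true v'.
have du := r_det u; have dv := r_det v; have dv' := r_det v'.
have [Au Bu Cu Du] := And4 (ra_ge1 u) (rb_ge0 u) (rc_ge0 u) (rd_ge1 u).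
have [Av Bv Cv Dv] := And4 (ra_ge1 v) (rb_ge0 v) (rc_ge0 v) (rd_ge1 v).
have [Av' Bv' Cv' Dv'] := And4 (ra_ge1 v') (rb_ge0 v') (rc_ge0 v') (rd_ge1 v').
have [Aw Bw Cw Dw] := And4 (ra_ge1 w) (rb_ge0 w) (rc_ge0 w) (rd_ge1 w).
have [Aw' Bw' Cw' Dw'] := And4 (ra_ge1 w') (rb_ge0 w') (rc_ge0 w') (rd_ge1 w').
have wedge x z x' z' : (ra u * x + rb u * (x + z)) *
    ((ra u + rc u) * (x' + z') + (rb u + rd u) * z') -
    ((ra u + rc u) * x + (rb u + rd u) * (x + z)) * (ra u * (x' + z') + rb u * z') =
    - (x * x' + z * x' + z * z').
  transitivity (- (ra u * rd u - rb u * rc u) * (x * x' + z * x' + z * z')); first by ring.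
  by rewrite du mulN1r.
pose s2 := ra w + rc w; pose t2 := rb w + rd w; pose s2' := ra w' + rc w'; pose t2' := rb w' + rd w'.
have s20 : 0 <= s2 := addr_ge0 (le_trans ler01 Aw) Cw.
have t20 : 0 <= t2 := addr_ge0 Bw (le_trans ler01 Dw).
have s20' : 0 <= s2' := addr_ge0 (le_trans ler01 Aw') Cw'.
have t20' : 0 <= t2' := addr_ge0 Bw' (le_trans ler01 Dw').
pose W11 := ra w * s2' - s2 * ra w'; pose W12 := ra w * t2' - s2 * rb w'.
pose W21 := rb w * s2' - t2 * ra w'; pose W22 := rb w * t2' - t2 * rb w'.
have eW11 : W11 = - (ra v * ra v' + rc v * ra v' + rc v * rc v').
  by rewrite -wedge /W11 /s2 /s2' ew1 ew3 ew'1 ew'3; ring.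
have eW12 : W12 = - (ra v * rb v' + rc v * rb v' + rc v * rd v').
  by rewrite -wedge /W12 /s2 /t2' ew1 ew3 ew'2 ew'4; ring.
have eW21 : W21 = - (rb v * ra v' + rd v * ra v' + rd v * rc v').
  by rewrite -wedge /W21 /t2 /s2' ew2 ew4 ew'1 ew'3; ring.
have eW22 : W22 = - (rb v * rb v' + rd v * rb v' + rd v * rd v').
  by rewrite -wedge /W22 /t2 /t2' ew2 ew4 ew'2 ew'4; ring.
have h11 : W11 <= - 1.
  by rewrite eW11 neg_sum_le ?mulr_ge0 ?(le_trans ler01 Av').
have h21 : W21 <= - 1.
  by rewrite eW21 [rb v * _ + _]addrC neg_sum_le ?mulr_ge0 ?(le_trans ler01 Av') ?(le_trans ler01 Dv).
have h22 : W22 <= - 1.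
  by rewrite eW22 [_ + rd v * rd v']addrC addrA neg_sum_le ?mulr_ge0 ?(le_trans ler01 Dv).
have h12 : W12 <= 0.
  by rewrite eW12 oppr_le0 !addr_ge0 ?mulr_ge0 ?(le_trans ler01 Av) ?(le_trans ler01 Dv').
have key : (s2 + t2) * (s2' + t2') <= 2 * - kap2 w w'.
  have k11 := @dot_ge 1 W11 (ra w) s2 (ra w') s2' ler01 h11 (le_trans ler01 Aw) s20 (le_trans ler01 Aw') s20'.
  have k21 := @dot_ge 1 W21 (rb w) t2 (ra w') s2' ler01 h21 Bw t20 (le_trans ler01 Aw') s20'.
  have k22 := @dot_ge 1 W22 (rb w) t2 (rb w') t2' ler01 h22 Bw t20 Bw' t20'.
  have -> : - kap2 w w' = - (W11 * (ra w * ra w' + s2 * s2')) - (W12 * (ra w * rb w' + s2 * t2'))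
    - (W21 * (rb w * ra w' + t2 * s2')) - (W22 * (rb w * rb w' + t2 * t2')).
    by rewrite kap2_columns /W11 /W12 /W21 /W22 /s2 /t2 /s2' /t2'; ring.
  have p11 := mulr_ge0 s20 s20'; have p12 := mulr_ge0 s20 t20'; have p21 := mulr_ge0 t20 s20'.
  have p22 := mulr_ge0 t20 t20'.
  have [|W12_0] : W12 <= - 1 \/ (wB v' = 0%N /\ wC v = 0%N).
  - rewrite eW12 /ra /rb /rc /rd -!natrM -!natrD lerN2 ler1n.
    exact: pos_or_zeros (wA_gt0 v) (wD_gt0 v').
  - move=> h; have k12 := @dot_ge 1 W12 (ra w) s2 (rb w') t2' ler01 h (le_trans ler01 Aw) s20 Bw' t20'.
    by move: k11 k12 k21 k22; rewrite !mul1r; clear -p11 p12 p21 p22; lra.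
  have k12 := @dot_ge 0 W12 (ra w) s2 (rb w') t2' (lexx 0) (ltac:(by rewrite oppr0)) (le_trans ler01 Aw) s20 Bw' t20'.
  (* If [W12] vanishes, the missing term s2 t2' must be paid by s2 s2' and t2 t2', which the factor
     2 in [key] leaves available. Here [wB v'] and [wC v] are 0, so that t2' = s2 and the two terms
     are large enough. *)
  suff : s2 * t2' <= s2 * s2' + t2 * t2'.
    by move: k11 k12 k21 k22; rewrite !mul1r mul0r; clear -p11 p12 p21 p22; lra.
  have B0 : rb v' = 0 by rewrite /rb W12_0.1.
  have C0 : rc v = 0 by rewrite /rc W12_0.2.
  have A1 : ra v = 1.
    have : (wA v * wD v = 1)%N by rewrite w_det W12_0.2 muln0.
    by move/eqP; rewrite muln_eq1 => /andP[/eqP + _]; rewrite /ra => ->.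
  have D1 : rd v' = 1.
    have : (wA v' * wD v' = 1)%N by rewrite w_det W12_0.1 mul0n.
    by move/eqP; rewrite muln_eq1 => /andP[_ /eqP]; rewrite /rd => ->.
  have es2 : s2 = (ra u + rc u) + (rb u + rd u) by rewrite /s2 ew1 ew3 A1 C0; ring.
  have et2' : t2' = s2 by rewrite es2 /t2' ew'2 ew'4 B0 D1; ring.
  have et2 : rb u + rd u <= t2.
    have -> : t2 = (ra u + rc u) * rb v + (rb u + rd u) * (rb v + rd v) by rewrite /t2 ew2 ew4; ring.
    by apply: le_comb => //; rewrite addr_ge0 ?(le_trans ler01 Au) ?(le_trans ler01 Du).
  have es2' : ra u + rc u <= s2'.
    have -> : s2' = (ra u + rc u) * (ra v' + rc v') + (rb u + rd u) * rc v' by rewrite /s2' ew'1 ew'3; ring.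
    by rewrite [leRHS]addrC [ra v' + _]addrC; apply: le_comb => //; rewrite addr_ge0 ?(le_trans ler01 Au) ?(le_trans ler01 Du).
  rewrite et2' [t2 * s2]mulrC -mulrDr ler_wpM2l //.
  by rewrite {1}es2 lerD.
have T1 := gT_le_row w; have T2 := gT_le_row w'.
rewrite -/s2 -/t2 in T1; rewrite -/s2' -/t2' in T2.
have T0 : 0 <= gT w by rewrite /gT /g11 /g22 !addr_ge0 ?sqr_ge0.
have T0' : 0 <= gT w' by rewrite /gT /g11 /g22 !addr_ge0 ?sqr_ge0.
have TT := ler_pM T0 T0' T1 T2.
apply: le_trans TT _.
have q0 : 0 <= (s2 + t2) * (s2' + t2') by rewrite mulr_ge0 ?addr_ge0.
have qq : ((s2 + t2) * (s2' + t2')) ^+ 2 <= (2 * - kap2 w w') ^+ 2 by rewrite ler_sqr ?nnegrE ?(le_trans q0).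
rewrite [leLHS](_ : _ = 4 * ((s2 + t2) * (s2' + t2')) ^+ 2); last by ring.
rewrite [leRHS](_ : _ = 4 * (2 * - kap2 w w') ^+ 2); last by ring.
by rewrite ler_wpM2l.
Qed.

Lemma kap2C w w' : kap2 w' w = - kap2 w w'.
Proof. by rewrite /kap2; ring. Qed.

Lemma nested_or_branch w w' : [\/ exists m, w' = w ++ m, exists m, w = w' ++ m,
  exists u v v', w = u ++ false :: v /\ w' = u ++ true :: v' |
  exists u v v', w = u ++ true :: v /\ w' = u ++ false :: v'].
Proof.
elim: w w' => [|b w IH] w'; first by apply: Or41; exists w'.
case: w' => [|b' w']; first by apply: Or42; exists (b :: w).
have [<-|nb] := eqVneq b b'.
  case: (IH w') => [[m ->]|[m ->]|[u [v [v' [-> ->]]]]|[u [v [v' [-> ->]]]]].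
  - by apply: Or41; exists m.
  - by apply: Or42; exists m.
  - by apply: Or43; exists (b :: u), v, v'.
  - by apply: Or44; exists (b :: u), v, v'.
case: b b' nb => [] [] // _; first by apply: Or44; exists [::], w, w'.
by apply: Or43; exists [::], w, w'.
Qed.

Lemma gT_gt0 w : 0 < gT w.
Proof. by have := gT_ge3 w; lra. Qed.

Lemma separation X w w' : gT w <= X -> gT w' <= X -> (forall m, w' <> w ++ m) ->
  (forall m, w <> w' ++ m) -> (2 * X)^-1 <= `|th w - th w'|.
Proof.
move=> wX w'X n1 n2.
have K : gT w * gT w' <= 16 * kap2 w w' ^+ 2.
  case: (nested_or_branch w w') => [[m /n1 //]|[m /n2 //]|[u [v [v' [e1 e2]]]]|[u [v [v' [e1 e2]]]]].
    exact: kap2_branch e1 e2.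
  by rewrite kap2C sqrrN mulrC; exact: kap2_branch e2 e1.
apply: le_trans (norm_sin_le _).
rewrite sin_th.
have X0 : 0 < X := lt_le_trans (gT_gt0 w) wX.
have [S1 S2] := (gS_gt0 w, gS_gt0 w'); have [T1 T2] := (gT_gt0 w, gT_gt0 w').
have SS : gS w * gS w' <= gT w * gT w' by rewrite ler_pM ?gS_le ?(ltW S1) ?(ltW S2).
have TX : gT w * gT w' <= X ^+ 2 by rewrite expr2 ler_pM ?(ltW T1) ?(ltW T2).
rewrite -ler_sqr ?nnegrE ?normr_ge0 ?invr_ge0 ?mulr_ge0 ?(ltW X0) //.
rewrite sqr_normr expr_div_n exprVn ler_pdivlMr ?exprn_gt0 ?mulr_gt0 //.
rewrite ler_pdivrMl ?exprn_gt0 ?mulr_gt0 //.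
have SS2 : (gS w * gS w') ^+ 2 <= (gT w * gT w') ^+ 2.
  by rewrite ler_sqr ?nnegrE ?mulr_ge0 ?(ltW S1) ?(ltW S2) ?(ltW T1) ?(ltW T2).
apply: le_trans SS2 _; rewrite expr2.
have TT := mulr_gt0 T1 T2.
apply: le_trans (ler_pM (ltW TT) (ltW TT) TX K) _.
by rewrite le_eqVlt; apply/orP; left; apply/eqP; ring.
Qed.

(** * Uniform bound for large matrices *)

(** The slope of the eigenvector of M M^T for [Lam]; the second row ([u1], [u2]) of gamma will be
    close to a multiple of (1, [sg m]). The quantity [qq m], of the order of |M|^2, indexes M by a
    lattice point. *)
Definition sg m := (Lam m - n11 m) / n12 m.
Definition u1 w := (wA w + wC w)%N.
Definition u2 w := (wB w + wD w)%N.
Definition qq m := rx m ^+ 2 + ry m ^+ 2.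

Lemma Lam_bounds m : m != [::] -> n11 m < Lam m /\ n22 m < Lam m.
Proof.
move=> m0; have n0 := n12_gt0 m0; have s0 := nS_gt0 m0; have e := nS_sqr m.
rewrite nT_sqr in e; rewrite /Lam /nT; move: n0 s0 e; clear; nra.
Qed.

Lemma sg_gt0 m : m != [::] -> 0 < sg m.
Proof.
move=> m0; have [L1 _] := Lam_bounds m0; have n0 := n12_gt0 m0.
by apply: divr_gt0; lra.
Qed.

Lemma sg_inv m : m != [::] -> (sg m)^-1 = (Lam m - n22 m) / n12 m.
Proof.
move=> m0; have [L1 L2] := Lam_bounds m0; have n0 := n12_gt0 m0.
have e : (Lam m - n11 m) * (Lam m - n22 m) = n12 m ^+ 2.
  have d := n_det m; have l := Lam_inv m; rewrite /nT in l.
  suff -> : n12 m ^+ 2 = n11 m * n22 m - Lam m * (n11 m + n22 m - Lam m) by ring.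
  by rewrite l -d; ring.
have s0 : Lam m - n11 m != 0 by rewrite gt_eqF ?subr_gt0.
have nn : n12 m != 0 by rewrite gt_eqF //; lra.
by rewrite /sg invf_div; apply/eqP; rewrite eqr_div // -expr2 -e mulrC.
Qed.

Lemma nT_qq m : qq m <= 2 * nT m.
Proof.
rewrite /qq rxE ryE /nT /n11 /n22.
have := sqr_ge0 (ra m - rb m); have := sqr_ge0 (rc m - rd m); clear.
rewrite !expr2; nra.
Qed.

Lemma qq_ge2 m : 2 <= qq m.
Proof. by rewrite /qq; have := rx_ge1 m; have := ry_ge1 m; nra. Qed.

Lemma nS_nT m : m != [::] -> nT m <= 2 * nS m.
Proof.
move=> m0; have := nT_ge3 m0; have := nS_gt0 m0; have := nS_sqr m; clear; nra.
Qed.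

Lemma sg_n12 m : m != [::] -> sg m <= 1 ->
  qq m <= 4 * n11 m /\ sg m / n12 m <= 8 / qq m.
Proof.
move=> m0 s1; have [L1 L2] := Lam_bounds m0; have n0 := n12_gt0 m0.
have n1 : n22 m <= n11 m.
  have i1 : 1 <= (sg m)^-1 by rewrite invf_ge1 ?sg_gt0.
  have : sg m <= (sg m)^-1 by lra.
  by rewrite sg_inv // ler_pM2r ?invr_gt0; lra.
have h1 := nT_qq m; rewrite /nT in h1; split; first by lra.
rewrite -[sg m]invrK sg_inv // -invfM divfK; last by rewrite gt_eqF; lra.
rewrite -[_^-1]mul1r ler_pdivrMr; last by lra.
rewrite mulrAC ler_pdivlMr; last by have := qq_ge2 m; lra.
have h2 := nS_nT m0; rewrite /Lam /nT in h2 *; lra.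
Qed.

Lemma sg_n12' m : m != [::] -> 1 < sg m ->
  qq m <= 4 * n22 m /\ (sg m)^-1 / n12 m <= 8 / qq m.
Proof.
move=> m0 s1; have [L1 L2] := Lam_bounds m0; have n0 := n12_gt0 m0.
have n1 : n11 m <= n22 m.
  have i1 : (sg m)^-1 <= 1 by rewrite invf_le1 ?sg_gt0 ?ltW.
  have : (sg m)^-1 <= sg m by lra.
  by rewrite sg_inv // ler_pM2r ?invr_gt0; lra.
have h1 := nT_qq m; rewrite /nT in h1; split; first by lra.
rewrite /sg invf_div -mulrA -invfM; have L : 0 < Lam m - n11 m by lra.
rewrite invfM mulrCA divff ?mulr1; last by rewrite gt_eqF; lra.
rewrite -[_^-1]mul1r ler_pdivrMr // mulrAC ler_pdivlMr; last by have := qq_ge2 m; lra.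
have h2 := nS_nT m0; rewrite /Lam /nT in h2 *; lra.
Qed.

(** For fixed M, [kap] is a sum of values of a quadratic form at the two rows of gamma. Its
    isotropic lines are the eigenlines of M M^T, of slopes [sg m] and -1 / [sg m], whence the
    factorization. *)
Lemma kap_sg w m : m != [::] -> kap w m = - n12 m *
  ((rb w - sg m * ra w) * (rb w + ra w / sg m) +
   (rb w + rd w - sg m * (ra w + rc w)) * (rb w + rd w + (ra w + rc w) / sg m)).
Proof.
move=> m0; have s0 := sg_gt0 m0; have n0 := n12_gt0 m0.
have e : n11 m - n22 m = n12 m * ((sg m)^-1 - sg m).
  by rewrite sg_inv // /sg; field; rewrite gt_eqF; lra.
have es : sg m * (sg m)^-1 = 1 by rewrite divff ?gt_eqF.
rewrite /kap e /g11 /g12 /g22; move: es; move: (sg m) (_^-1) => s i es.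
rewrite -[ra w ^+ 2]mulr1 -[(ra w + rc w) ^+ 2]mulr1 -es; ring.
Qed.

(* [f] and [h] are the coordinates along the eigenvectors of [M M^T]; as
   [f(r) h(v) - f(v) h(r) = +- (s + 1/s)] for the rows [r], [v] of [gamma], a
   small value of [f h (r) + f h (v)] forces [f(v)] to be small. *)
Lemma slope_window (s n t x1 y1 x2 y2 : R) : 0 < s <= 1 -> 1 <= n -> 0 <= t <= 1 / 4 ->
  0 <= x1 <= x2 -> 0 <= y1 <= y2 -> 1 <= x2 -> `|x1 * y2 - y1 * x2| = 1 ->
  `|(y1 - s * x1) * (y1 + x1 / s) + (y2 - s * x2) * (y2 + x2 / s)| <=
    t * (x1 ^+ 2 + y1 ^+ 2 + x2 ^+ 2 + y2 ^+ 2) / (2 * n) ->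
  y2 ^+ 2 <= 3 * x2 ^+ 2 /\ `|y2 - s * x2| <= 4 * t * x2 * (s / n) + 2.
Proof.
move=> /andP[s0 s1] n1 /andP[t0 t1] /andP[x10 x12] /andP[y10 y12] x21 w1.
set S := _ + _ => hS.
have x11 : x1 ^+ 2 <= x2 ^+ 2 by rewrite ler_sqr ?nnegrE //; lra.
have y11 : y1 ^+ 2 <= y2 ^+ 2 by rewrite ler_sqr ?nnegrE //; lra.
pose i := s^-1; have si : s * i = 1 by rewrite divff ?gt_eqF.
have i1 : 1 <= i by rewrite invf_ge1.
have SE : S = (y1 ^+ 2 + x1 * y1 * (i - s) - x1 ^+ 2) + (y2 ^+ 2 + x2 * y2 * (i - s) - x2 ^+ 2).
  rewrite /S -/i -[x1 ^+ 2]mulr1 -[x2 ^+ 2]mulr1 -si; ring.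
have xy1 : 0 <= x1 * y1 * (i - s) by rewrite mulr_ge0 ?mulr_ge0 //; lra.
have xy2 : 0 <= x2 * y2 * (i - s) by rewrite mulr_ge0 ?mulr_ge0 //; lra.
have hS' : `|S| * n <= t * (x2 ^+ 2 + y2 ^+ 2).
  rewrite -ler_pdivlMr; last by lra.
  apply: le_trans hS _; rewrite invfM mulrA ler_pM2r ?invr_gt0; last by lra.
  by rewrite ler_pdivrMr // -mulrA ler_wpM2l //; lra.
have nS0 : 0 <= `|S| * (n - 1) by rewrite mulr_ge0 //; lra.
have S1 : `|S| <= t * (x2 ^+ 2 + y2 ^+ 2) by nra.
have yx : y2 ^+ 2 <= 3 * x2 ^+ 2.
  have q0 : 0 <= x2 ^+ 2 + y2 ^+ 2 by rewrite addr_ge0 ?sqr_ge0.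
  have S2 : `|S| <= 1 / 4 * (x2 ^+ 2 + y2 ^+ 2) by apply: le_trans S1 _; rewrite ler_wpM2r.
  have := ler_norm S; have := sqr_ge0 y1; lra.
split=> //; move: S1 => _.
have hSx : `|S| <= 4 * t * x2 ^+ 2 / n.
  rewrite ler_pdivlMr; last by lra.
  by apply: le_trans hS' _; rewrite [4 * t]mulrC -mulrA ler_wpM2l //; lra.
pose f := y2 - s * x2; pose h1 := y1 + i * x1; pose h2 := y2 + i * x2.
have i0 : 0 <= i := le_trans ler01 i1.
have h10 : 0 <= h1 := addr_ge0 y10 (mulr_ge0 i0 x10).
have h12 : h1 <= h2 := lerD y12 (ler_wpM2l i0 x12).
have h2x : i * x2 <= h2 by rewrite /h2; lra.
have ix : 1 <= i * x2 by nra.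
have id : f * (h2 ^+ 2 + h1 ^+ 2) = S * h2 + (s + i) * (x1 * y2 - y1 * x2) * h1.
  rewrite SE /f /h1 /h2.
  have -> : x1 ^+ 2 = s * i * x1 ^+ 2 by rewrite si mul1r.
  have -> : x2 ^+ 2 = s * i * x2 ^+ 2 by rewrite si mul1r.
  ring.
have id' : `|f| * h2 ^+ 2 <= (`|S| + (s + i)) * h2.
  apply: le_trans (_ : `|f * (h2 ^+ 2 + h1 ^+ 2)| <= _).
    by rewrite normrM ler_wpM2l // ger0_norm ?addr_ge0 ?sqr_ge0 // lerDl sqr_ge0.
  rewrite id; apply: le_trans (ler_normD _ _) _; rewrite !normrM w1 mulr1.
  rewrite (ger0_norm h10) (ger0_norm (le_trans h10 h12)) (@ger0_norm _ (s + i)); last by lra.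
  by rewrite [leRHS]mulrDl lerD2l ler_wpM2l //; lra.
have h20 : 0 < h2 by lra.
have id2 : `|f| * h2 <= `|S| + (s + i) by rewrite -(ler_pM2r h20) -mulrA -expr2.
have id3 : `|f| * (i * x2) <= 4 * t * x2 ^+ 2 / n + (s + i).
  apply: le_trans (_ : `|f| * h2 <= _); first by rewrite ler_wpM2l.
  by clear -id2 hSx; lra.
have id4 : `|f| * x2 <= 4 * t * x2 ^+ 2 * (s / n) + (s ^+ 2 + 1).
  have := ler_wpM2l (ltW s0) id3.
  rewrite [leLHS](_ : _ = (s * i) * (`|f| * x2)); last by ring.
  rewrite [leRHS](_ : _ = 4 * t * x2 ^+ 2 * (s / n) + (s ^+ 2 + s * i)); last by ring.
  by rewrite si mul1r.
have x20 : 0 < x2 := lt_le_trans ltr01 x21.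
rewrite -(ler_pM2r x20); apply: le_trans id4 _.
rewrite [leRHS](_ : _ = 4 * t * x2 ^+ 2 * (s / n) + 2 * x2); last by ring.
have : s ^+ 2 <= 1 by rewrite expr_le1 ?(ltW s0).
by move=> s2; rewrite lerD2l; clear -s2 x21; lra.
Qed.

Lemma close_kap w m t X : gT (w ++ m) <= X -> `|th w - th (w ++ m)| <= t / X ->
  `|kap w m| <= t * gT w / 2.
Proof.
move=> wX ht; have T0 := gT_gt0 (w ++ m); have X0 : 0 < X := lt_le_trans T0 wX.
have S1 := gS_gt0 w; have S2 := gS_gt0 (w ++ m).
have := le_trans (norm_sin_le _) ht; rewrite sin_th kap2_cat normrM normfV normrM.
rewrite (@ger0_norm _ 2) // (gtr0_norm (mulr_gt0 S1 S2)) ler_pdivrMr ?mulr_gt0 // => h.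
have t0 : 0 <= t.
  by have := le_trans (normr_ge0 _) ht; rewrite pmulr_lge0 ?invr_gt0.
have h2 : t / X * (gS w * gS (w ++ m)) <= t * gT w.
  rewrite -[t / X * _]mulrA ler_wpM2l //.
  rewrite ler_pdivrMl // mulrC ler_pM ?(ltW S1) ?(ltW S2) ?gS_le //.
  by apply: le_trans wX; exact: gS_le.
by lra.
Qed.

Lemma ler_sqr_of (x y : R) : 0 <= x <= y -> x ^+ 2 <= y ^+ 2.
Proof. by move=> /andP[x0 xy]; rewrite ler_sqr ?nnegrE // (le_trans x0). Qed.

Lemma u1E w : (u1 w)%:R = ra w + rc w :> R. Proof. by rewrite natrD. Qed.
Lemma u2E w : (u2 w)%:R = rb w + rd w :> R. Proof. by rewrite natrD. Qed.

Lemma cross_rows w : ra w * (rb w + rd w) - rb w * (ra w + rc w) = 1.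
Proof. by rewrite -(r_det w); ring. Qed.

Lemma rows_S w m t X : m != [::] -> gT (w ++ m) <= X -> `|th w - th (w ++ m)| <= t / X ->
  `|(rb w - sg m * ra w) * (rb w + ra w / sg m) +
   (rb w + rd w - sg m * (ra w + rc w)) * (rb w + rd w + (ra w + rc w) / sg m)| <=
  t * (ra w ^+ 2 + rb w ^+ 2 + (ra w + rc w) ^+ 2 + (rb w + rd w) ^+ 2) / (2 * n12 m).
Proof.
have -> : ra w ^+ 2 + rb w ^+ 2 + (ra w + rc w) ^+ 2 + (rb w + rd w) ^+ 2 = gT w.
  by rewrite /gT /g11 /g22; ring.
move=> m0 wX ht; have := close_kap wX ht; rewrite kap_sg // normrM normrN.
have n0 := n12_gt0 m0; rewrite (@ger0_norm _ (n12 m)); last by lra.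
rewrite -ler_pdivlMl; last by lra.
by move=> h; apply: le_trans h _; rewrite [leLHS]mulrC invfM -[leLHS]mulrA.
Qed.

(** The larger coordinate of the eigenvector is taken as the parameter, [u1] here and [u2] in
    [window2], so that the slope in [slope_window] is at most 1. *)
Lemma window1 w m t X : m != [::] -> 0 <= t <= 1 / 4 -> sg m <= 1 ->
  gT (w ++ m) <= X -> `|th w - th (w ++ m)| <= t / X ->
  [/\ (u1 w)%:R ^+ 2 * qq m <= 4 * X, gT w <= 8 * (u1 w)%:R ^+ 2 &
      `|(u2 w)%:R - sg m * (u1 w)%:R| <= 32 * t * (u1 w)%:R / qq m + 2].
Proof.
move=> m0 t0 s1 wX ht; rewrite u1E u2E.
have [q1 q2] := sg_n12 m0 s1.
have [A B C D] := And4 (ra_ge1 w) (rb_ge0 w) (rc_ge0 w) (rd_ge1 w).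
have c1 : 1 <= ra w + rc w by lra.
have sb : 0 < sg m <= 1 by rewrite sg_gt0.
have ab : 0 <= ra w <= ra w + rc w by apply/andP; split; lra.
have cd : 0 <= rb w <= rb w + rd w by apply/andP; split; lra.
case: (slope_window sb (n12_gt0 m0) t0 ab cd c1 _ (rows_S m0 wX ht)).
  by rewrite cross_rows normr1.
move=> y3 win; split.
- have := gT_ge w m; have := n22_ge1 m.
  have r1 : 0 <= (ra w + rc w) ^+ 2 by exact: sqr_ge0.
  have r2 : 0 <= (rb w + rd w) ^+ 2 by exact: sqr_ge0.
  move=> n1 g.
  have g2 : 0 <= (rb w + rd w) ^+ 2 * n22 m by rewrite mulr_ge0 // (le_trans ler01 n1).
  apply: le_trans (ler_wpM2l r1 q1) _.
  by rewrite mulrCA ler_wpM2l //; clear -g g2 wX; lra.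
- have a2 := ler_sqr_of ab.
  have b2 := ler_sqr_of cd.
  by rewrite /gT /g11 /g22; clear -a2 b2 y3; lra.
apply: le_trans win _; rewrite lerD2r.
have ct : 0 <= 4 * t * (ra w + rc w).
  by case/andP: t0 => t0 _; rewrite !mulr_ge0 // (le_trans ler01 c1).
apply: le_trans (ler_wpM2l ct q2) _.
by rewrite le_eqVlt; apply/orP; left; apply/eqP; ring.
Qed.

Lemma window2 w m t X : m != [::] -> 0 <= t <= 1 / 4 -> 1 < sg m ->
  gT (w ++ m) <= X -> `|th w - th (w ++ m)| <= t / X ->
  [/\ (u2 w)%:R ^+ 2 * qq m <= 4 * X, gT w <= 8 * (u2 w)%:R ^+ 2 &
      `|(u1 w)%:R - (sg m)^-1 * (u2 w)%:R| <= 32 * t * (u2 w)%:R / qq m + 2].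
Proof.
move=> m0 t0 s1 wX ht; rewrite u1E u2E.
have [q1 q2] := sg_n12' m0 s1.
have [A B C D] := And4 (ra_ge1 w) (rb_ge0 w) (rc_ge0 w) (rd_ge1 w).
have c1 : 1 <= rb w + rd w by lra.
have sb : 0 < (sg m)^-1 <= 1 by rewrite invr_gt0 sg_gt0 //= invf_le1 ?sg_gt0 // ltW.
have ab : 0 <= ra w <= ra w + rc w by apply/andP; split; lra.
have cd : 0 <= rb w <= rb w + rd w by apply/andP; split; lra.
have h : `|(ra w - (sg m)^-1 * rb w) * (ra w + rb w / (sg m)^-1) +
   (ra w + rc w - (sg m)^-1 * (rb w + rd w)) * (ra w + rc w + (rb w + rd w) / (sg m)^-1)| <=
  t * (rb w ^+ 2 + ra w ^+ 2 + (rb w + rd w) ^+ 2 + (ra w + rc w) ^+ 2) / (2 * n12 m).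
  have := rows_S m0 wX ht; rewrite invrK -normrN.
  set x := `|_|; set y := `|_|; have -> : x = y.
    rewrite /x /y; congr (`|_|); have : sg m * (sg m)^-1 = 1 by rewrite divff ?gt_eqF ?sg_gt0.
    move: (sg m) (_^-1) => s i e; ring: e.
  by rewrite [ra w ^+ 2 + _]addrC -[leRHS]/(_ * _ / _) -!addrA [(ra w + rc w) ^+ 2 + _]addrC.
case: (slope_window sb (n12_gt0 m0) t0 cd ab c1 _ h).
  by rewrite distrC cross_rows normr1.
move=> y3 win; split.
- have := gT_ge w m; have := n11_ge1 m.
  have r1 : 0 <= (ra w + rc w) ^+ 2 by exact: sqr_ge0.
  have r2 : 0 <= (rb w + rd w) ^+ 2 by exact: sqr_ge0.
  move=> n1 g.
  have g2 : 0 <= (ra w + rc w) ^+ 2 * n11 m by rewrite mulr_ge0 // (le_trans ler01 n1).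
  apply: le_trans (ler_wpM2l r2 q1) _.
  by rewrite mulrCA ler_wpM2l //; clear -g g2 wX; lra.
- have a2 := ler_sqr_of ab.
  have b2 := ler_sqr_of cd.
  by rewrite /gT /g11 /g22; clear -a2 b2 y3; lra.
apply: le_trans win _; rewrite lerD2r.
have ct : 0 <= 4 * t * (rb w + rd w).
  by case/andP: t0 => t0 _; rewrite !mulr_ge0 // (le_trans ler01 c1).
apply: le_trans (ler_wpM2l ct q2) _.
by rewrite le_eqVlt; apply/orP; left; apply/eqP; ring.
Qed.

Lemma sum_inv_sqr_tail (Y n : nat) : (0 < Y)%N ->
  \sum_(1 <= p < n.+1 | (Y < p)%N) (p%:R ^+ 2)^-1 <= Y%:R^-1 :> R.
Proof.
move=> Y0; apply: le_trans (_ : _ <= Y%:R^-1 - (maxn Y n)%:R^-1) _; last first.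
  by rewrite lerBlDr lerDl invr_ge0.
elim: n => [|n IH]; first by rewrite big_nil maxn0 subrr.
rewrite big_mkcond big_nat_recr //= -big_mkcond /=.
have [nY|] := boolP (Y < n.+1)%N; last first.
  by rewrite -leqNgt => nY; rewrite (maxn_idPl nY) addr0; rewrite (maxn_idPl (ltnW nY)) in IH.
rewrite (maxn_idPr (ltnW nY)); rewrite ltnS in nY; rewrite (maxn_idPr nY) in IH.
have N0 : 0 < n%:R :> R by rewrite ltr0n (leq_trans Y0).
have : (n.+1%:R ^+ 2)^-1 <= n%:R^-1 - n.+1%:R^-1 :> R.
  rewrite -natr1; move: (n%:R : R) N0 => x x0.
  have -> : x^-1 - (x + 1)^-1 = (x * (x + 1))^-1 by field; rewrite !gt_eqF //; lra.
  by rewrite lef_pV2 ?posrE ?exprn_gt0 ?mulr_gt0 //; nra.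
by move: IH; move: (\sum_(_ <= _ < _ | _) _) (Y%:R^-1 : R) (n%:R^-1 : R) (n.+1%:R^-1 : R) (_ ^- 2) => *; lra.
Qed.

Lemma sum_inv_sqr (n : nat) : \sum_(1 <= p < n.+1) (p%:R ^+ 2)^-1 <= 2 :> R.
Proof.
case: n => [|n]; first by rewrite big_nil.
rewrite big_ltn // expr1n invr1.
have -> : \sum_(2 <= p < n.+2) (p%:R ^+ 2)^-1 = \sum_(1 <= p < n.+2 | (1 < p)%N) (p%:R ^+ 2)^-1 :> R.
  rewrite [RHS]big_ltn_cond //= big_nat_cond [RHS]big_nat_cond; apply: eq_bigl => p.
  by rewrite andbT; case: (ltnP 1 p); rewrite ?andbF ?andbT.
have := @sum_inv_sqr_tail 1 n.+1 isT; rewrite invr1; lra.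
Qed.

Lemma sum_nat_le (K : R) (n : nat) : 0 <= K ->
  \sum_(1 <= c < n.+1 | c%:R ^+ 2 <= K) c%:R <= K.
Proof.
move=> K0; suff [] : \sum_(1 <= c < n.+1 | c%:R ^+ 2 <= K) c%:R <= K /\
  \sum_(1 <= c < n.+1 | c%:R ^+ 2 <= K) c%:R <= (n%:R : R) ^+ 2 by [].
elim: n => [|n [IH1 IH2]]; first by rewrite !big_nil.
rewrite big_mkcond big_nat_recr //= -big_mkcond /=; case: ifP => h; last first.
  rewrite addr0; split=> //; apply: le_trans IH2 _.
  by rewrite ler_sqr ?nnegrE // ler_nat.
rewrite -natr1 in h *; have n0 : 0 <= n%:R :> R by [].
move: (n%:R : R) n0 (\sum_(_ <= _ < _ | _) _) IH1 IH2 h => x x0 S *; split; nra.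
Qed.

Lemma count_sqr_le (K : R) (n : nat) : 0 <= K -> (\sum_(1 <= c < n.+1 | c%:R ^+ 2 <= K) 1 : R) ^+ 2 <= K.
Proof.
move=> K0; suff [_ []] : 0 <= (\sum_(1 <= c < n.+1 | c%:R ^+ 2 <= K) 1 : R) /\
  (\sum_(1 <= c < n.+1 | c%:R ^+ 2 <= K) 1 : R) ^+ 2 <= K /\
  (\sum_(1 <= c < n.+1 | c%:R ^+ 2 <= K) 1 : R) <= n%:R by [].
elim: n => [|n [IH0 [IH1 IH2]]]; first by rewrite !big_nil expr0n.
rewrite big_mkcond big_nat_recr //= -big_mkcond /=; case: ifP => h; last first.
  by rewrite addr0; split=> //; split=> //; apply: le_trans IH2 _; rewrite ler_nat.
rewrite -natr1 in h *; have n0 : 0 <= n%:R :> R by [].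
move: (n%:R : R) n0 (\sum_(_ <= _ < _ | _) _) IH0 IH1 IH2 h => x x0 S *; do !split; nra.
Qed.

Lemma count_disk_le (K : R) (n : nat) : 0 <= K ->
  \sum_(1 <= p < n.+1) \sum_(1 <= q < n.+1) (if p%:R ^+ 2 + q%:R ^+ 2 <= K then 1 else 0 : R) <= K.
Proof.
move=> K0; set S := \sum_(1 <= c < n.+1 | c%:R ^+ 2 <= K) 1 : R.
apply: le_trans (count_sqr_le n K0); rewrite expr2 -/S {1}/S big_distrl /=.
rewrite [leRHS]big_mkcond /= ler_sum // => p _.
case: ifP => [_|/negbT]; last first.
  rewrite -ltNge => h; rewrite big1 // => q _; rewrite leNgt.
  by rewrite (lt_le_trans h) // lerDl sqr_ge0.
rewrite mul1r /S [leRHS]big_mkcond /= ler_sum // => q _.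
case: ifP => [h|_]; last by case: ifP.
by rewrite ifT //; apply: le_trans h; rewrite lerDr sqr_ge0.
Qed.

Definition far (Y p q : nat) := (Y < p)%N || (Y < q)%N.

(** As (p^2 + q^2)^2 >= 4 p^2 q^2, the double sum is dominated by a product of two sums of inverse
    squares, one of which runs over a tail beyond Y. *)
Lemma sum_far (Y n : nat) : (0 < Y)%N ->
  \sum_(1 <= p < n.+1) \sum_(1 <= q < n.+1)
    (if far Y p q then ((p%:R ^+ 2 + q%:R ^+ 2) ^+ 2)^-1 else 0 : R) <= Y%:R^-1.
Proof.
move=> Y0; set s := index_iota 1 n.+1.
pose f (p : nat) : R := (p%:R ^+ 2)^-1; pose g (p : nat) : R := if (Y < p)%N then f p else 0.
have f0 p : 0 <= f p by rewrite invr_ge0 sqr_ge0.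
have g0 p : 0 <= g p by rewrite /g; case: ifP.
have F : \sum_(p <- s) f p <= 2 by exact: sum_inv_sqr.
have G : \sum_(p <- s) g p <= Y%:R^-1 by rewrite /g -big_mkcond; exact: sum_inv_sqr_tail.
have F0 : 0 <= \sum_(p <- s) f p by rewrite sumr_ge0.
have G0 : 0 <= \sum_(p <- s) g p by rewrite sumr_ge0.
apply: le_trans (_ : \sum_(p <- s) \sum_(q <- s) ((g p * f q + f p * g q) / 4) <= _).
  rewrite big_seq [leRHS]big_seq ler_sum // => p; rewrite mem_index_iota => /andP[p0 _].
  rewrite big_seq [leRHS]big_seq ler_sum // => q; rewrite mem_index_iota => /andP[q0 _].
  rewrite /far; case: ifP => h; last by rewrite divr_ge0 // addr_ge0 // mulr_ge0.
  apply: le_trans (_ : f p * f q / 4 <= _).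
    rewrite /f -!invfM lef_pV2 ?posrE ?exprn_gt0 ?mulr_gt0 ?addr_gt0 ?exprn_gt0 ?ltr0n //.
    by have := sqr_ge0 ((p%:R : R) ^+ 2 - q%:R ^+ 2); nra.
  rewrite ler_pM2r ?invr_gt0 //; case/orP: h => h.
    have -> : g p = f p by rewrite /g h.
    by rewrite lerDl mulr_ge0.
  have -> : g q = f q by rewrite /g h.
  by rewrite lerDr mulr_ge0.
have -> : \sum_(p <- s) \sum_(q <- s) ((g p * f q + f p * g q) / 4) =
  ((\sum_(p <- s) g p) * \sum_(q <- s) f q) / 2.
  transitivity (\sum_(p <- s) ((g p * \sum_(q <- s) f q + f p * \sum_(q <- s) g q) / 4)).
    apply: eq_bigr => p _; rewrite -mulr_suml; congr (_ / _).
    by rewrite big_split /= !mulr_sumr.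
  rewrite -mulr_suml big_split /= -!mulr_suml.
  by rewrite [X in _ + X]mulrC; lra.
rewrite ler_pdivrMr //; apply: le_trans (_ : Y%:R^-1 * 2 <= _) => //.
by rewrite ler_pM.
Qed.

Lemma XY_inj v w : wX v = wX w -> wY v = wY w -> v = w.
Proof.
by move=> e1 e2; have [] := @Calkin_Wilf_inj 1 1 v w isT isT; rewrite ?e1 ?e2.
Qed.

(** The pairs are sorted by the label (p, q) of M and by c = x(gamma). With Q = p^2 + q^2 a fibre
    has at most 64 t c / Q + 5 elements. The first part, summed over c^2 <= 4X/Q and then over the
    far (p, q), gives 256 t X / Y. The constant 5, summed over the (p, q) with Q <= 4X/c^2 and then
    over c > Z, gives 20 X / Z. *)
Lemma window_count (A : set (seq bool * seq bool)) (x y : seq bool -> nat)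
    (s : seq bool -> R) (Y Z : nat) (t : R) X :
  finite_set A -> (0 < Y)%N -> (0 < Z)%N -> 0 <= t -> 0 <= X ->
  (forall v w, x v = x w -> y v = y w -> v = w) ->
  (forall a, A a -> [/\ (x a.1)%:R ^+ 2 * qq a.2 <= 4 * X,
     `|(y a.1)%:R - s a.2 * (x a.1)%:R| <= 32 * t * (x a.1)%:R / qq a.2 + 2,
     (Z < x a.1)%N & far Y (wX a.2) (wY a.2)]) ->
  (cnt A)%:R <= 256 * t * X / Y%:R + 20 * X / Z%:R.
Proof.
move=> finA Y0 Z0 t0 X0 inj hA.
have X40 : 0 <= 4 * X by rewrite mulr_ge0.
pose n := Num.bound (4 * X); have nX : 4 * X < n%:R by exact: archi_boundP.
pose r := index_iota 1 n.+1.
have memr k : (0 < k)%N -> (k%:R : R) ^+ 2 <= 4 * X -> k \in r.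
  move=> k0 kX; rewrite mem_index_iota k0 ltnS -(ler_nat R); apply: le_trans (ltW nX).
  by apply: le_trans kX; rewrite -natrX ler_nat -{1}[k]expn1 leq_pexp2l.
pose f (a : seq bool * seq bool) := ((wX a.2, wY a.2), x a.1).
pose S := [seq (pq, c) | pq <- [seq (p, q) | p <- r, q <- r], c <- r].
have uS : uniq S.
  by rewrite !allpairs_uniq ?iota_uniq // => -[? ?] [? ?] _ _ [-> ->].
have fS a : A a -> f a \in S.
  move=> /hA[h1 _ h3 _]; have x0 : (0 < x a.1)%N by apply: leq_trans h3.
  have x1 : 1 <= (x a.1)%:R ^+ 2 :> R by rewrite -natrX ler1n expn_gt0 x0.
  have q2 := qq_ge2 a.2.
  have Q4 : qq a.2 <= 4 * X by apply: le_trans h1; rewrite ler_peMl //; lra.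
  have sx := sqr_ge0 (rx a.2); have sy := sqr_ge0 (ry a.2).
  apply: allpairs_f; first apply: allpairs_f.
  - by apply: memr; rewrite ?wX_gt0 // -/(rx a.2); apply: le_trans Q4; rewrite /qq; lra.
  - by apply: memr; rewrite ?wY_gt0 // -/(ry a.2); apply: le_trans Q4; rewrite /qq; lra.
  - by apply: memr => //; apply: le_trans h1; rewrite ler_peMr ?sqr_ge0 //; lra.
rewrite (cnt_fibers finA uS fS) natr_sum big_allpairs big_allpairs.
pose Q (p q : nat) : R := p%:R ^+ 2 + q%:R ^+ 2.
pose G1 p q (c : nat) : R := if far Y p q then (if c%:R ^+ 2 <= 4 * X / Q p q then c%:R else 0) * (64 * t / Q p q) else 0.
pose G2 p q (c : nat) : R := if (Z < c)%N then (if Q p q <= 4 * X / c%:R ^+ 2 then 1 else 0) * 5 else 0.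
have Q0 p q : p \in r -> 0 < Q p q.
  by rewrite mem_index_iota => /andP[p0 _]; rewrite /Q ltr_wpDr ?sqr_ge0 // exprn_gt0 ?ltr0n.
have fiber p q c : p \in r -> c \in r -> (cnt (A `&` f @^-1` [set (p, q, c)]))%:R <= G1 p q c + G2 p q c.
  move=> pr cr; have Qpq := Q0 _ q pr; set A' := _ `&` _.
  have G10 : 0 <= G1 p q c.
    by rewrite /G1; case: ifP => // _; rewrite mulr_ge0 ?divr_ge0 ?mulr_ge0 ?(ltW Qpq) //; case: ifP.
  have G20 : 0 <= G2 p q c by rewrite /G2; case: ifP => // _; case: ifP.
  have [->|/set0P[a0 [Aa0 fa0]]] := eqVneq A' set0; first by rewrite cnt0 addr_ge0.
  move: fa0; rewrite /preimage /f /= => -[eX eY ex].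
  have [h1 h2 h3 h4] := hA _ Aa0.
  have eQ : qq a0.2 = Q p q by rewrite /qq /rx /ry eX eY.
  rewrite ex eX eY eQ in h1 h2 h3 h4.
  have c0 : 0 < (c%:R : R) by rewrite ltr0n; apply: leq_trans h3.
  have -> : G1 p q c = c%:R * (64 * t / Q p q).
    by rewrite /G1 h4 ifT // ler_pdivlMr.
  have -> : G2 p q c = 5.
    by rewrite /G2 h3 ifT ?mul1r // ler_pdivlMr ?exprn_gt0 // mulrC.
  have finA' : finite_set A' by apply: sub_finite_set finA => a [].
  have same a : A' a -> a.2 = a0.2.
    by move=> [_ [e1 e2 _]]; apply: XY_inj; rewrite ?e1 ?e2 ?eX ?eY.
  rewrite -(@cnt_image _ _ A' (fun a => y a.1)) //; last first.
    move=> a b; rewrite !inE => Aa Ab /= e.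
    have e2 : a.2 = b.2 by rewrite !same.
    have : a.1 = b.1 by apply: inj e; case: Aa => _ [_ _ ->]; case: Ab => _ [_ _ ->].
    by case: a b e2 {Aa Ab e} => [? ?] [? ?] /= -> ->.
  have b0 : 0 <= 32 * t * c%:R / Q p q + 2 by rewrite addr_ge0 // divr_ge0 ?(ltW Qpq) // !mulr_ge0.
  have [] := @cnt_nat_near R ((fun a => y a.1) @` A') (s a0.2 * c%:R) _ b0.
    move=> k [a Aa <-]; have [Aa1 [e1 e2 e3]] := Aa.
    by have [_ + _ _] := hA _ Aa1; rewrite e3 (same _ Aa) eQ.
  move=> h _; apply: le_trans h _; rewrite le_eqVlt; apply/orP; left; apply/eqP.
  by field; rewrite gt_eqF.
apply: le_trans (_ : \sum_(p <- r) \sum_(q <- r) \sum_(c <- r) (G1 p q c + G2 p q c) <= _).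
  rewrite big_seq [leRHS]big_seq ler_sum // => p pr.
  rewrite ler_sum // => q _; rewrite big_seq [leRHS]big_seq ler_sum // => c cr.
  exact: fiber.
under eq_bigr do under eq_bigr do rewrite big_split.
under eq_bigr do rewrite big_split.
rewrite big_split /=; apply: lerD.
  apply: le_trans (_ : \sum_(p <- r) \sum_(q <- r) (if far Y p q then (Q p q ^+ 2)^-1 else 0) * (256 * t * X) <= _).
    rewrite big_seq [leRHS]big_seq ler_sum // => p pr.
    rewrite ler_sum // => q _; rewrite /G1; case: ifP => _; last by rewrite big1_eq mul0r.
    have Qp := Q0 _ q pr; rewrite -mulr_suml -big_mkcond.
    have K0 : 0 <= 4 * X / Q p q by rewrite divr_ge0 // ltW.
    apply: le_trans (_ : (4 * X / Q p q) * (64 * t / Q p q) <= _).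
      by rewrite ler_wpM2r ?divr_ge0 ?mulr_ge0 ?(ltW Qp) // sum_nat_le.
    by rewrite le_eqVlt; apply/orP; left; apply/eqP; field; rewrite gt_eqF.
  under eq_bigr do rewrite -mulr_suml; rewrite -mulr_suml mulrC; apply: ler_wpM2l; last exact: sum_far.
  exact: (mulr_ge0 (mulr_ge0 (ler0n R 256) t0) X0).
apply: le_trans (_ : \sum_(c <- r) (if (Z < c)%N then (c%:R ^+ 2)^-1 else 0) * (20 * X) <= _); last first.
  rewrite -mulr_suml -big_mkcond mulrC ler_wpM2l ?mulr_ge0 //; exact: sum_inv_sqr_tail.
under eq_bigr do rewrite exchange_big /=; rewrite exchange_big /=.
rewrite ler_sum // => c _; rewrite /G2; case: ifP => Zc; last first.
  by under eq_bigr do rewrite big1_eq; rewrite big1_eq mul0r.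
under eq_bigr do rewrite -mulr_suml; rewrite -mulr_suml.
have K0 : 0 <= 4 * X / c%:R ^+ 2 by rewrite divr_ge0 ?sqr_ge0.
rewrite [leRHS](_ : _ = 4 * X / c%:R ^+ 2 * 5); last by ring.
by rewrite ler_wpM2r // count_disk_le.
Qed.

(** * Bounded gamma and large M *)

(** The slope of the long axis of gamma^T gamma. The roles are now exchanged: for a fixed gamma, a
    bound on [kap] confines ([wX m], [wY m]) to a strip of bounded width around this slope, which
    leaves O(sqrt X) matrices M. *)
Definition rho w := (gS w - (g11 w - g22 w)) / (2 * g12 w).

Lemma gS_sqr w : gS w ^+ 2 = (g11 w - g22 w) ^+ 2 + 4 * g12 w ^+ 2.
Proof.
rewrite /gS sqr_sqrtr; last by have := gT_ge3 w; rewrite expr2; nra.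
by rewrite -(mulr1 4) -{1}(g_det w) /gT; ring.
Qed.

Lemma rhoP w : 0 < rho w /\ (rho w)^-1 - rho w = (g11 w - g22 w) / g12 w.
Proof.
have b1 := g12_ge1 w; have S0 := gS_gt0 w; have e := gS_sqr w.
have d0 : 0 < gS w - (g11 w - g22 w) by move: b1 S0 e; clear; nra.
have r0 : 0 < rho w by rewrite divr_gt0 //; lra.
split=> //; apply: (mulfI (lt0r_neq0 r0)); rewrite mulrBr divff ?gt_eqF //.
have g0 : g12 w != 0 by rewrite gt_eqF; lra.
apply: (mulfI (expf_neq0 2 g0)); by rewrite /rho; field: e.
Qed.

Definition col_cst (K : R) w := (K + (rho w + (rho w)^-1)) * (rho w + 1).

(** In the eigencoordinates f, h of gamma^T gamma, the two columns of M satisfy |f1 h1 + f2 h2| <= K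
    and f2 h1 - f1 h2 = rho + 1/rho. Solving for f1 + f2, the coordinate of the sum of the columns,
    bounds it uniformly in M. *)
Lemma column_window (K : R) w m : 0 <= K -> `|kap w m| <= K ->
  `|(wY m)%:R - rho w * (wX m)%:R| <= col_cst K w.
Proof.
move=> K0 hk; have b1 := g12_ge1 w; have [r0 er] := rhoP w.
pose i := (rho w)^-1; have ri : rho w * i = 1 by rewrite divff ?gt_eqF.
have i0 : 0 < i by rewrite invr_gt0.
have [A B C D] := And4 (ra_ge1 m) (rb_ge0 m) (rc_ge0 m) (rd_ge1 m).
pose h1 := rc m + i * ra m; pose h2 := rd m + i * rb m.
pose f1 := rc m - rho w * ra m; pose f2 := rd m - rho w * rb m.
have ek : kap w m = g12 w * (f1 * h1 + f2 * h2).
  have -> : kap w m = g12 w * ((i - rho w) * n12 m + n22 m - (rho w * i) * n11 m).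
    by rewrite er ri /kap; field; rewrite gt_eqF //; lra.
  by rewrite /n12 /n11 /n22 /f1 /f2 /h1 /h2; ring.
have S1 : `|f1 * h1 + f2 * h2| <= K.
  apply: le_trans hk; rewrite ek normrM ler_peMl // ger0_norm; lra.
have x1 : f2 * h1 - f1 * h2 = rho w + i.
  transitivity ((rho w + i) * (ra m * rd m - rb m * rc m)); last by rewrite r_det mulr1.
  by rewrite /f1 /f2 /h1 /h2; ring.
have h10 : i <= h1 by rewrite /h1; nra.
have h20 : 1 <= h2 by rewrite /h2; have := mulr_ge0 (ltW i0) B; lra.
have H0 : 0 < h1 ^+ 2 + h2 ^+ 2 by rewrite ltr_wpDr ?sqr_ge0 // exprn_gt0 // (lt_le_trans i0).
have id : (f1 + f2) * (h1 ^+ 2 + h2 ^+ 2) = (f1 * h1 + f2 * h2) * (h1 + h2) + (rho w + i) * (h1 - h2).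
  by rewrite -x1; ring.
have fE : (wY m)%:R - rho w * (wX m)%:R = f1 + f2.
  by rewrite -/(ry m) -/(rx m) rxE ryE /f1 /f2; ring.
rewrite fE -(ler_pM2r H0) -{1}(gtr0_norm H0) -normrM id.
apply: le_trans (ler_normD _ _) _; rewrite !normrM.
have p1 : 0 < h1 := lt_le_trans i0 h10.
have p2 : 0 < h2 := lt_le_trans ltr01 h20.
have d1 : `|h1 + h2| = h1 + h2 by rewrite (gtr0_norm (addr_gt0 p1 p2)).
have d2 : `|h1 - h2| <= h1 + h2 by rewrite ler_norml; clear -p1 p2; apply/andP; split; lra.
have d3 : `|rho w + i| = rho w + i by rewrite (gtr0_norm (addr_gt0 r0 i0)).
rewrite d1 d3; apply: le_trans (_ : (K + (rho w + i)) * (h1 + h2) <= _).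
  rewrite [leRHS]mulrDl; apply: lerD; first by rewrite (ler_wpM2r (ltW (addr_gt0 p1 p2))).
  by rewrite (ler_wpM2l (ltW (addr_gt0 r0 i0))).
rewrite /col_cst -/i -mulrA ler_wpM2l //; first exact: addr_ge0 K0 (ltW (addr_gt0 r0 i0)).
have k1 : h1 <= rho w * h1 ^+ 2.
  have := ler_wpM2l (ltW r0) h10; rewrite ri => k1.
  by rewrite expr2 mulrA ler_peMl // ltW.
have k2 : h2 <= h2 ^+ 2 by rewrite expr2 ler_peMl // ltW.
have k3 := sqr_ge0 h1; have k4 := mulr_ge0 (ltW r0) (sqr_ge0 h2).
by rewrite mulrDl mul1r mulrDr; clear -k1 k2 k3 k4; lra.
Qed.

Lemma u12_ge1 w : 1 <= ra w + rc w /\ 1 <= rb w + rd w.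
Proof.
by have := ra_ge1 w; have := rb_ge0 w; have := rc_ge0 w; have := rd_ge1 w; split; lra.
Qed.

Lemma nT_le_cat w m : nT m <= gT (w ++ m).
Proof.
have [a b] := u12_ge1 w; have n1 := n11_ge1 m; have n2 := n22_ge1 m.
apply: le_trans (gT_ge w m); rewrite /nT lerD //.
  by rewrite ler_peMl //; [lra | rewrite expr_ge1 //; lra].
by rewrite ler_peMl //; [lra | rewrite expr_ge1 //; lra].
Qed.

Lemma gT_le_cat w m : gT w <= 2 * gT (w ++ m).
Proof.
have [a b] := u12_ge1 w; have n1 := n11_ge1 m; have n2 := n22_ge1 m.
have h := gT_ge w m.
have h1 : (ra w + rc w) ^+ 2 <= (ra w + rc w) ^+ 2 * n11 m by rewrite ler_peMr ?sqr_ge0.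
have h2 : (rb w + rd w) ^+ 2 <= (rb w + rd w) ^+ 2 * n22 m by rewrite ler_peMr ?sqr_ge0.
have a2 : ra w ^+ 2 <= (ra w + rc w) ^+ 2.
  by apply: ler_sqr_of; rewrite lerDl rc_ge0 andbT (le_trans ler01 (ra_ge1 w)).
have b2 : rb w ^+ 2 <= (rb w + rd w) ^+ 2.
  by apply: ler_sqr_of; rewrite lerDl rb_ge0 (le_trans ler01 (rd_ge1 w)).
by rewrite {1}/gT /g11 /g22; lra.
Qed.

Lemma gT_le_nT m : gT m <= 3 * nT m.
Proof.
rewrite /gT /g11 /g22 /nT /n11 /n22.
have := sqr_ge0 (ra m - rc m); have := sqr_ge0 (rb m - rd m).
have := sqr_ge0 (rc m); have := sqr_ge0 (rd m); rewrite !expr2; clear; nra.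
Qed.

Lemma small_count (K : R) w X (S : set (seq bool)) : 0 <= K -> 0 <= X ->
  (forall m, S m -> gT (w ++ m) <= X /\ `|kap w m| <= K) ->
  (cnt S)%:R <= Num.sqrt (2 * X) * (2 * col_cst K w + 1).
Proof.
move=> K0 X0 hS.
have c0 : 0 <= col_cst K w.
  by have [r0 _] := rhoP w; rewrite mulr_ge0 ?addr_ge0 ?invr_ge0 ?(ltW r0).
have c20 : 0 <= 2 * col_cst K w + 1 by lra.
have fibr n : forall k, [set wY m | m in S `&` [set m | wX m = n]] k ->
    `|k%:R - rho w * n%:R| <= col_cst K w.
  by move=> k [m [Sm <-] <-]; apply: column_window => //; have [] := hS _ Sm.
have [] := @cnt_dep R _ S wX wY (Num.sqrt (2 * X)) _ (sqrtr_ge0 _) c20 _ _ _ => //.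
- move=> m /hS[h _]; split; first exact: wX_gt0.
  apply: le_sqrt => //; rewrite -/(rx m) rxE; have := nT_le_cat w m.
  rewrite /nT /n11 /n22; have := sqr_ge0 (ra m - rb m); have := sqr_ge0 (rc m).
  by have := sqr_ge0 (rd m); move: h; clear; rewrite !expr2; nra.
- by move=> v m _ _; exact: XY_inj.
- by move=> n; have [h1 h2] := @cnt_nat_near R _ _ _ c0 (fibr n).
Qed.

(** * Close pairs and nested pairs *)

Definition Ep t X := [set a : seq bool * seq bool | [/\ a.2 != [::], gT (a.1 ++ a.2) <= X &
  `|th a.1 - th (a.1 ++ a.2)| <= t / X]].
Definition Tl Y t X := Ep t X `&` [set a | far Y (wX a.2) (wY a.2)].

Lemma Ep_finite t X : finite_set (Ep t X).
Proof.
apply: sub_finite_set (finite_setX (ball_finite [::] (2 * X)) (ball_finite [::] (3 * X))).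
move=> [w m] [/= m0 wX _]; rewrite /ball /setX /= !cats0; split.
  by have := gT_le_cat w m; lra.
by have := gT_le_nT m; have := nT_le_cat w m; lra.
Qed.

Lemma tail_count (Y : nat) (t e : R) : (0 < Y)%N -> 0 <= t <= 1 / 4 -> 0 < e ->
  \forall X \near +oo, (cnt (Tl Y t X))%:R <= 512 * t * X / Y%:R + e * X.
Proof.
move=> Y0 t01 e0; have /andP[t0 t1] := t01.
(* The ranges sg <= 1 and sg > 1 each lose 20 X / Z, together at most e X / 2. The other half of e X
   absorbs the finitely many gamma with gT <= 8 Z^2, each of which contributes O(sqrt X). *)
pose Z := (Num.bound (80 / e)).+1.
have Ze : 40 / Z%:R <= e / 2.
  rewrite ler_pdivrMr ?ltr0n // -ler_pdivrMl; last by lra.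
  have h : 80 / e < (Num.bound (80 / e))%:R by apply: archi_boundP; rewrite divr_ge0 // ltW.
  apply: le_trans (_ : 80 / e <= _); first by rewrite le_eqVlt; apply/orP; left; apply/eqP; field; rewrite gt_eqF.
  by apply: le_trans (ltW h) _; rewrite ler_nat.
pose K := t * (8 * Z%:R ^+ 2) / 2.
have K0 : 0 <= K by rewrite divr_ge0 // mulr_ge0 // mulr_ge0 // sqr_ge0.
pose s : seq (seq bool) := fset_set (ball [::] (8 * Z%:R ^+ 2)).
pose C := \sum_(w <- s) (2 * col_cst K w + 1).
have e20 : 0 < e / 2 by lra.
near=> X.
have X0 : 0 < X by near: X; exact: nbhs_pinfty_gt.
have CX : Num.sqrt (2 * X) * C <= e / 2 * X.
  rewrite sqrtrM // mulrAC [leLHS]mulrC [leLHS]mulrC; near: X; exact: near_sqrt.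
have finT : finite_set (Tl Y t X) by apply: sub_finite_set (Ep_finite t X) => ? [].
pose big1 := Tl Y t X `&` [set a | sg a.2 <= 1 /\ 8 * Z%:R ^+ 2 < gT a.1].
pose big2 := Tl Y t X `&` [set a | 1 < sg a.2 /\ 8 * Z%:R ^+ 2 < gT a.1].
pose sml := Tl Y t X `&` [set a | gT a.1 <= 8 * Z%:R ^+ 2].
have fin1 : finite_set big1 by apply: sub_finite_set finT => ? [].
have fin2 : finite_set big2 by apply: sub_finite_set finT => ? [].
have fin3 : finite_set sml by apply: sub_finite_set finT => ? [].
have Zlt (k : nat) : 8 * Z%:R ^+ 2 < 8 * (k%:R : R) ^+ 2 -> (Z < k)%N.
  by rewrite ltr_pM2l // ltr_sqr ?nnegrE // ltr_nat.
have c1 : (cnt big1)%:R <= 256 * t * X / Y%:R + 20 * X / Z%:R.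
  apply: (@window_count _ u1 u2 sg) ; rewrite ?(ltW X0) //.
    by move=> v w; exact: row_inj.
  move=> [w m] /= [[[/= m0 wX ht] hf] [/= s1 bg]].
  have [h1 h2 h3] := window1 m0 t01 s1 wX ht; split=> //.
  by apply: Zlt; exact: lt_le_trans h2.
have c2 : (cnt big2)%:R <= 256 * t * X / Y%:R + 20 * X / Z%:R.
  apply: (@window_count _ u2 u1 (fun m => (sg m)^-1)) ; rewrite ?(ltW X0) //.
    by move=> v w e2 e1; exact: row_inj.
  move=> [w m] /= [[[/= m0 wX ht] hf] [/= s1 bg]].
  have [h1 h2 h3] := window2 m0 t01 s1 wX ht; split=> //.
  by apply: Zlt; exact: lt_le_trans h2.
have c3 : (cnt sml)%:R <= e / 2 * X.
  apply: le_trans CX; rewrite (@cnt_fibers _ _ sml fst s) //; first last.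
  - move=> [w m] [_ /= h]; rewrite /s in_fset_set; last exact: ball_finite.
    by rewrite inE /ball /= cats0.
  - exact: fset_uniq.
  rewrite natr_sum /C mulr_sumr ler_sum // => w _.
  set S := _ `&` _; have fS : finite_set S by apply: sub_finite_set fin3 => ? [].
  rewrite -(@cnt_image _ _ S snd) //; last first.
    by move=> [? ?] [? ?]; rewrite !inE => -[_ /= ->] [_ /= ->] /= ->.
  apply: small_count; rewrite ?(ltW X0) //.
  move=> m [[w' m'] [[[[/= m0 wX ht] _] /= sm] /= ew] /= em]; subst w' m'; split=> //.
  apply: le_trans (close_kap wX ht) _; rewrite /K ler_pM2r ?invr_gt0 //.
  by rewrite ler_wpM2l.
have cov : Tl Y t X `<=` big1 `|` (big2 `|` sml).
  move=> a Ta; have [h|h] := leP (gT a.1) (8 * Z%:R ^+ 2); first by right; right.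
  by have [s1|s1] := leP (sg a.2) 1; [left | right; left].
have fin23 : finite_set (big2 `|` sml) by rewrite finite_setU.
have := cnt_le _ cov; rewrite finite_setU => /(_ (conj fin1 fin23)).
move=> /leq_trans => /(_ _ (cntU_le fin1 fin23)).
have l23 := cntU_le fin2 fin3.
move=> h; have {h l23} : (cnt (Tl Y t X) <= cnt big1 + (cnt big2 + cnt sml))%N.
  by apply: leq_trans h _; rewrite leq_add2l.
rewrite -(ler_nat R) !natrD => h; apply: le_trans h _.
have ZX : 40 / Z%:R * X <= e / 2 * X by rewrite ler_wpM2r // ltW.
have -> : 512 * t * X / Y%:R = 256 * t * X / Y%:R + 256 * t * X / Y%:R by rewrite -mulrDl; congr (_ / _); ring.
have e2 : 40 / Z%:R * X = 20 * X / Z%:R + 20 * X / Z%:R by ring.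
by move: c1 c2 c3 ZX; rewrite e2; move: (_ / Y%:R) (_ / Z%:R) ((cnt _)%:R) ((cnt _)%:R) ((cnt _)%:R) => *; lra.
Unshelve. all: by end_near. Qed.

Definition CP (d : R) X := [set p : seq bool * seq bool | [/\ gT p.1 <= X, gT p.2 <= X,
  p.2 != p.1 & 0 <= th p.2 - th p.1 <= d]].

Lemma CP_finite d X : finite_set (CP d X).
Proof.
apply: sub_finite_set (finite_setX (ball_finite [::] X) (ball_finite [::] X)).
by move=> [w w'] [/= h1 h2 _ _]; split; rewrite /ball /= cats0.
Qed.

Lemma gT_mono w m : gT w <= gT (w ++ m).
Proof.
rewrite gT_cat /gT; have n1 := n11_ge1 m; have n2 := n22_ge1 m; have n3 := n12_ge0 m.
have g3 := g12_ge1 w.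
have h1 : g11 w <= g11 w * n11 m by rewrite ler_peMr // /g11 addr_ge0 ?sqr_ge0.
have h2 : g22 w <= g22 w * n22 m by rewrite ler_peMr // /g22 addr_ge0 ?sqr_ge0.
have h3 : 0 <= 2 * g12 w * n12 m by rewrite !mulr_ge0 //; lra.
lra.
Qed.

Lemma close_nested (t : R) X w w' : t < 1 / 2 -> gT w <= X -> gT w' <= X ->
  `|th w - th w'| <= t / X -> (exists m, w' = w ++ m) \/ (exists m, w = w' ++ m).
Proof.
move=> t2 wX w'X h; have X0 : 0 < X := lt_le_trans (gT_gt0 w) wX.
case: (pselect (exists m, w' = w ++ m)) => [|n1]; first by left.
case: (pselect (exists m, w = w' ++ m)) => [|n2]; first by right.
have sep := @separation X w w' wX w'X (fun m q => n1 (ex_intro _ m q)) (fun m q => n2 (ex_intro _ m q)).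
have := le_trans sep h; rewrite invfM ler_pM2r ?invr_gt0 //; lra.
Qed.

Lemma cat_neq w m : m != [::] -> w ++ m != w.
Proof. by move=> m0; rewrite -{2}[w]cats0 eqseq_cat // eqxx. Qed.

Lemma size_lt_cat w m : m != [::] -> (size w < size (w ++ m))%N.
Proof. by move=> m0; rewrite size_cat -[ltnLHS]addn0 ltn_add2l; case: m m0. Qed.

Definition rising := [set a : seq bool * seq bool | th a.1 <= th (a.1 ++ a.2)].
Definition falling := [set a : seq bool * seq bool | th (a.1 ++ a.2) <= th a.1].

Lemma CP_up (t : R) X : t < 1 / 2 ->
  cnt (CP (t / X) X `&` [set p | (size p.1 < size p.2)%N]) =
  cnt (Ep t X `&` rising).
Proof.
move=> t2; set E := Ep t X `&` _.
have finE : finite_set E by apply: sub_finite_set (Ep_finite t X) => ? [].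
rewrite -(@cnt_image _ _ E (fun a => (a.1, a.1 ++ a.2))) //; last first.
  move=> [w m] [v k] _ _ /= [-> /eqP]; rewrite eqseq_cat // eqxx => /eqP -> //.
congr cnt; apply/seteqP; split=> [[w w'] [[/= wX w'X ne dd] sz]|_ [[w m] [[/= m0 wX hd] le] <-]].
  have d' : `|th w - th w'| <= t / X by rewrite distrC ger0_norm; case/andP: dd.
  case: (close_nested t2 wX w'X d') => [[m em]|[m em]]; last first.
    by move: sz; rewrite em size_cat ltnNge leq_addr.
  have m0 : m != [::] by apply: contra ne => /eqP m0; rewrite em m0 cats0.
  subst w'; exists (w, m) => //; split; last by rewrite /rising /falling /= -subr_ge0; case/andP: dd.
  by split.
split; last by rewrite /= size_lt_cat.
split=> //=; [exact: le_trans (gT_mono w m) wX | exact: cat_neq |].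
by rewrite subr_ge0 le /=; apply: le_trans hd; rewrite distrC ler_norm.
Qed.

Lemma CP_down (t : R) X : t < 1 / 2 ->
  cnt (CP (t / X) X `&` [set p | (size p.2 < size p.1)%N]) =
  cnt (Ep t X `&` falling).
Proof.
move=> t2; set E := Ep t X `&` _.
have finE : finite_set E by apply: sub_finite_set (Ep_finite t X) => ? [].
rewrite -(@cnt_image _ _ E (fun a => (a.1 ++ a.2, a.1))) //; last first.
  move=> [w m] [v k] _ _ /= [h wv]; subst v; move/eqP: h; rewrite eqseq_cat // eqxx => /eqP -> //.
congr cnt; apply/seteqP; split=> [[w' w] [[/= w'X wX ne dd] sz]|_ [[w m] [[/= m0 wX hd] le] <-]].
  have d' : `|th w - th w'| <= t / X by rewrite ger0_norm; case/andP: dd.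
  case: (close_nested t2 wX w'X d') => [[m em]|[m em]]; last first.
    by move: sz; rewrite em size_cat ltnNge leq_addr.
  have m0 : m != [::] by apply: contra ne => /eqP m0; rewrite em m0 cats0.
  subst w'; exists (w, m) => //; split; last by rewrite /rising /falling /= -subr_ge0; case/andP: dd.
  by split.
split; last by rewrite /= size_lt_cat.
split=> //=; [exact: le_trans (gT_mono w m) wX | by rewrite eq_sym; exact: cat_neq |].
by rewrite subr_ge0 le /=; apply: le_trans hd; rewrite ler_norm.
Qed.

Lemma CP_split (t : R) X : t < 1 / 2 -> cnt (CP (t / X) X) =
  (cnt (Ep t X `&` rising) +
   cnt (Ep t X `&` falling))%N.
Proof.
move=> t2; rewrite -CP_up // -CP_down // -cntU.
- congr cnt; apply/seteqP; split=> [[w w'] h|? [[]|[]] //].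
  have [/= wX w'X ne dd] := h.
  have d' : `|th w - th w'| <= t / X by rewrite distrC ger0_norm; case/andP: dd.
  case: (close_nested t2 wX w'X d') => [[m em]|[m em]].
    left; split=> //=; rewrite em size_lt_cat //.
    by apply: contra ne => /eqP m0; rewrite /= em m0 cats0.
  right; split=> //=; rewrite em size_lt_cat //.
  by apply: contra ne => /eqP m0; rewrite /= em m0 cats0.
- by apply: sub_finite_set (CP_finite (t / X) X) => ? [].
- by apply: sub_finite_set (CP_finite (t / X) X) => ? [].
- apply/seteqP; split=> // p [[_ h1] [_ h2]].
  by move: (ltn_trans h1 h2); rewrite ltnn.
Qed.

(** A nested pair with distinct angles is a close pair in exactly one order, a nested pair with
    equal angles in both. The excess over [Ep] therefore consists of coincidences, bounded by
    [CP 0 X]. *)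
Lemma CP_Ep (t : R) X : 0 <= t < 1 / 2 -> 0 < X ->
  [/\ (cnt (Ep t X) <= cnt (CP (t / X) X))%N,
      (cnt (CP (t / X) X) <= cnt (Ep t X) + cnt (CP 0 X))%N &
      (cnt (CP 0 X) <= 2 * cnt (Ep t X))%N].
Proof.
move=> /andP[t0 t2] X0.
have CP0 := @CP_split 0 X (ltac:(lra)); rewrite mul0r in CP0.
have finS (A B : set (seq bool * seq bool)) : A `<=` Ep t X -> finite_set A.
  by move=> h; apply: sub_finite_set (Ep_finite t X).
have E0 : Ep 0 X `<=` Ep t X.
  move=> a [h1 h2 h3]; split=> //; apply: le_trans h3 _.
  by rewrite mul0r divr_ge0 // ltW.
have fin0 := Ep_finite t X.
have e1 : cnt (Ep t X) = (cnt (Ep t X `&` rising) + cnt (Ep t X `\` (Ep t X `&` rising)))%N.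
  by apply: cntD => // ? [].
have finu : finite_set (Ep t X `&` rising) by apply: sub_finite_set fin0 => ? [].
have find : finite_set (Ep t X `&` falling) by apply: sub_finite_set fin0 => ? [].
have sub1 : Ep t X `\` (Ep t X `&` rising) `<=` Ep t X `&` falling.
  move=> a [Ea na]; split=> //; rewrite /falling /= leNgt; apply/negP => h.
  by apply: na; split=> //; exact: ltW.
have sub2 : Ep t X `&` falling `<=` (Ep t X `\` (Ep t X `&` rising)) `|` (Ep 0 X `&` rising).
  move=> a [Ea da]; have [h|h] := leP (th a.1) (th (a.1 ++ a.2)); last first.
    by left; split=> // -[_]; rewrite /rising /= leNgt h.
  right; split=> //; have [h1 h2 h3] := Ea; split=> //.
  have -> : th a.1 = th (a.1 ++ a.2) by apply/eqP; rewrite eq_le h da.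
  by rewrite subrr normr0 mul0r.
rewrite CP_split //; split.
- by rewrite e1 leq_add2l; apply: cnt_le.
- rewrite e1 CP0 -addnA leq_add2l; apply: leq_trans (cnt_le _ sub2) _.
    by rewrite finite_setU; split; [apply: sub_finite_set fin0 => ? [] |
      apply: sub_finite_set fin0 => ? [/E0]].
  apply: leq_trans (cntU_le _ _) _.
  + by apply: sub_finite_set fin0 => ? [].
  + by apply: sub_finite_set fin0 => ? [/E0].
  by rewrite leq_add2l leq_addr.
- rewrite CP0 mul2n -addnn leq_add // cnt_le // => a [/E0 //].
Qed.

(** * The slope of the limit correlation at 0 *)

Lemma k0_38 : pi / 2 * k0 = 3 / 8 :> R.
Proof. by rewrite /k0; have := pi_gt0 R; move: (pi : R) => p p0; field; rewrite gt_eqF. Qed.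

Lemma N_asymp e : 0 < e -> \forall X \near +oo,
  (1 - e) * (3 / 8 * X) <= N [::] X <= (1 + e) * (3 / 8 * X).
Proof.
move=> e0; have := equidistribution_cell [::] (_ : 0 < e / 4).
rewrite /dev al_nil => /(_ (ltac:(lra))) h; near=> X.
have X0 : 0 < X by near: X; exact: nbhs_pinfty_gt.
have : `|N [::] X - k0 * (pi / 2) * X| <= (0 + e / 4) * X by near: X.
rewrite [k0 * _]mulrC k0_38.
rewrite ler_norml; have := mulr_gt0 e0 X0; move=> *; apply/andP; split; lra.
Unshelve. all: by end_near. Qed.

Lemma Ep_cells (F : seq (seq bool)) (t : R) X : uniq F -> [::] \notin F ->
  cnt (Ep t X `&` [set a | a.2 \in F]) = (\sum_(m <- F) cnt (Nm m t X))%N.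
Proof.
move=> uF nF; set E := _ `&` _.
have finE : finite_set E by apply: sub_finite_set (Ep_finite t X) => ? [].
rewrite (@cnt_fibers _ _ E snd F finE uF) //; last by move=> ? [].
rewrite big_seq [RHS]big_seq; apply: eq_bigr => m mF.
rewrite -(@cnt_image _ _ _ (fun a : seq bool * seq bool => a.1)); first last.
- by move=> [w m1] [v m2]; rewrite !inE => -[_ /= ->] [_ /= ->] /= ->.
- by apply: sub_finite_set finE => ? [].
congr cnt; apply/seteqP; split=> [_ [[w m'] [[[/= m0 wX h] _] /= e] <-]|w [/= wX h]].
  by subst m'.
exists (w, m) => //; split=> //; split=> //; split=> //=.
by apply: contraNneq nF => <-.
Qed.

Lemma cells_asymp (F : seq (seq bool)) e : [::] \notin F -> 0 < e < 1 -> exists2 t, 0 < t &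
  forall tau, 0 < tau <= t -> \forall X \near +oo,
  (1 - e) * (\sum_(m <- F) cm m * tau) * X <= \sum_(m <- F) (cnt (Nm m tau X))%:R <=
  (1 + e) * (\sum_(m <- F) cm m * tau) * X.
Proof.
move=> + ee; elim: F => [_|m F IH].
  by exists 1 => // tau _; near=> X; rewrite !big_nil !mulr0 !mul0r lexx.
rewrite inE negb_or eq_sym => /andP[m0 /IH[t t0 ht]].
have [s s0 hs] := Nm_asymp m0 ee.
exists (Num.min s t); first by rewrite lt_min s0 t0.
move=> tau /andP[tau0]; rewrite le_min => /andP[ts tt]; near=> X.
have h1 : (1 - e) * (cm m * tau) * X <= (cnt (Nm m tau X))%:R <= (1 + e) * (cm m * tau) * X.
  by near: X; apply: hs; rewrite tau0.
have h2 : (1 - e) * (\sum_(m <- F) cm m * tau) * X <= \sum_(m <- F) (cnt (Nm m tau X))%:R <=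
  (1 + e) * (\sum_(m <- F) cm m * tau) * X by near: X; apply: ht; rewrite tau0.
rewrite !big_cons ![_ * (cm m * tau + _)]mulrDr ![(_ * (cm m * tau) + _) * X]mulrDl; case/andP: h1 => *; case/andP: h2 => *.
by apply/andP; split; apply: lerD.
Unshelve. all: by end_near. Qed.

Definition wt m := nT m / nS m - 1.
Definition Gsum (F : seq (seq bool)) : R := 2 / 3 * \sum_(m <- F) wt m.

(** Rests on Lam (nT - nS) = 2. Dividing by k0 and 3/8 turns a count per tau X into a correlation
    per xi, because the number of elements is about 3X/8 and tau is about xi / k0. *)
Lemma wt_cm m : m != [::] -> 2 / 3 * wt m = cm m / k0 / (3 / 8).
Proof.
move=> m0; have s0 := nS_gt0 m0; have L1 := Lam_gt1 m0; have k := k0_gt0.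
have L : Lam m * (nT m - nS m) = 2.
  have -> : nT m - nS m = 2 * (nT m - Lam m) by rewrite /Lam; field.
  by rewrite mulrCA Lam_inv mulr1.
have -> : wt m = Lam m * (nT m - nS m) / (Lam m * nS m).
  by rewrite /wt; field; rewrite !gt_eqF //; lra.
by rewrite L /cm; field; rewrite !gt_eqF //; lra.
Qed.

Lemma Gsum_cm F (tau : R) : [::] \notin F -> \sum_(m <- F) cm m * tau = 3 / 8 * Gsum F * (k0 * tau).
Proof.
move=> nF; rewrite /Gsum mulr_sumr mulr_sumr mulr_suml big_seq [RHS]big_seq.
apply: eq_bigr => m mF; rewrite wt_cm; last by apply: contraNneq nF => <-.
by field; rewrite gt_eqF ?k0_gt0.
Qed.

(** The correlation [RA_ q xi] in the variable X = q^2, by [RA_words]. *)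
Definition rr (xi X : R) : R := (cnt (CP (pi / 2 * xi / N [::] X) X))%:R / N [::] X.

Lemma CP_mono d d' X : d <= d' -> (cnt (CP d X) <= cnt (CP d' X))%N.
Proof.
move=> dd; apply: cnt_le; first exact: CP_finite.
by move=> p [h1 h2 h3 /andP[h4 h5]]; split=> //; rewrite h4 (le_trans h5).
Qed.

Lemma Gsum_ge0 F : [::] \notin F -> 0 <= Gsum F.
Proof.
move=> nF; rewrite /Gsum mulr_sumr big_seq sumr_ge0 // => m mF.
have m0 : m != [::] by apply: contraNneq nF => <-.
have c0 := cm_gt0 m0; rewrite wt_cm // divr_ge0 //; apply: (divr_ge0 (ltW c0) (ltW k0_gt0)).
Qed.

Lemma rr_lower F e : uniq F -> [::] \notin F -> 0 < e < 1 -> exists2 x0, 0 < x0 &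
  forall xi, 0 < xi <= x0 -> \forall X \near +oo, (1 - e) * Gsum F * xi <= rr xi X.
Proof.
move=> uF nF ee; pose e' := e / 4; have ee' : 0 < e' < 1 by rewrite /e'; lra.
have q1 : (1 - e) * (1 + e') <= (1 - e') * (1 - e') by rewrite /e'; nra.
have e1' : 0 < 1 - e' by lra.
have ee1 : 0 <= 1 - e by lra.
have c38 : 0 < (3 / 8 : R) by lra.
have [t t0 ht] := cells_asymp nF ee'; have k := k0_gt0; have pp := pi_gt0 R.
pose x0 := Num.min (k0 * t) (k0 / 4).
exists x0; first by rewrite lt_min mulr_gt0 // divr_gt0.
move=> xi /andP[xi0]; rewrite le_min => /andP[xt x4].
(* Since N is about (pi/2) k0 X, the window (pi/2) xi / N is about xi / (k0 X); the factor 1 - e'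
   absorbs the error in N. *)
pose tau := (1 - e') * xi / k0.
have tau0 : 0 < tau by rewrite divr_gt0 // mulr_gt0 //; lra.
have txi : tau <= xi / k0 by rewrite /tau ler_pM2r ?invr_gt0 // ler_piMl //; [exact: ltW | lra].
have taut : tau <= t by apply: le_trans txi _; rewrite ler_pdivrMr // mulrC.
have tau2 : 0 <= tau < 1 / 2.
  by rewrite (ltW tau0) /=; apply: le_lt_trans txi _; rewrite ltr_pdivrMr //; lra.
near=> X.
have X0 : 0 < X by near: X; exact: nbhs_pinfty_gt.
have /andP[N1 N2] : (1 - e') * (3 / 8 * X) <= N [::] X <= (1 + e') * (3 / 8 * X).
  by near: X; apply: N_asymp; lra.
have /andP[c1 _] : (1 - e') * (\sum_(m <- F) cm m * tau) * X <= \sum_(m <- F) (cnt (Nm m tau X))%:R <=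
  (1 + e') * (\sum_(m <- F) cm m * tau) * X by near: X; apply: ht; rewrite tau0.
have Npos : 0 < N [::] X := lt_le_trans (mulr_gt0 e1' (mulr_gt0 c38 X0)) N1.
rewrite /rr ler_pdivlMr //.
have tX : tau / X <= pi / 2 * xi / N [::] X.
  rewrite ler_pdivlMr // mulrAC ler_pdivrMr //.
  apply: le_trans (ler_wpM2l (ltW tau0) N2) _.
  rewrite /tau [leLHS](_ : _ = (1 - e' ^+ 2) * (pi / 2 * xi * X)); last first.
    by rewrite -k0_38; field; rewrite gt_eqF.
  rewrite ler_piMl //; last by rewrite lerBlDr lerDl sqr_ge0.
  by rewrite !mulr_ge0 ?(ltW pp) ?(ltW xi0) ?(ltW X0).
have h : (\sum_(m <- F) cnt (Nm m tau X) <= cnt (CP (pi / 2 * xi / N [::] X) X))%N.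
  rewrite -Ep_cells //; apply: leq_trans (CP_mono X tX).
  have [le1 _ _] := CP_Ep tau2 X0; apply: leq_trans le1.
  by apply: cnt_le; [exact: Ep_finite | move=> ? []].
rewrite -(ler_nat R) natr_sum in h; apply: le_trans h; apply: le_trans c1.
have G0 := Gsum_ge0 nF; rewrite Gsum_cm //; move: (Gsum F) G0 => G G0.
have -> : k0 * tau = (1 - e') * xi by rewrite /tau; field; rewrite gt_eqF.
have g0 : 0 <= (1 - e) * G * xi by exact: mulr_ge0 (mulr_ge0 ee1 G0) (ltW xi0).
apply: le_trans (ler_wpM2l g0 N2) _.
rewrite [leLHS](_ : _ = (1 - e) * (1 + e') * (3 / 8 * G * xi * X)); last by ring.
rewrite [leRHS](_ : _ = (1 - e') * (1 - e') * (3 / 8 * G * xi * X)); last by ring.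
rewrite ler_wpM2r ?mulr_ge0 ?(ltW xi0) ?(ltW X0) //.
Unshelve. all: by end_near. Qed.

(** Conversion factor: a count c tau X contributes about c K0 xi to the correlation, again by N ~
    3X/8 and tau ~ xi / k0. *)
Definition K0 : R := 8 / (3 * k0).
Lemma K0_ge0 : 0 <= K0.
Proof. by rewrite divr_ge0 // mulr_ge0 // ltW ?k0_gt0. Qed.

Lemma mul_div_rot (a b c d : R) : a * b * c / d = a / d * b * c.
Proof. by ring. Qed.

Lemma upper_numeric (e G y xi X k : R) : 0 < e < 1 -> 0 <= G -> 0 <= y -> 0 < xi -> 0 < X -> 0 < k ->
  (1 + e / 8) * (3 / 8 * G * (k * ((1 + e / 8) * xi / k))) * X +
   (y * ((1 + e / 8) * xi / k) * X + e / 8 * ((1 + e / 8) * xi / k) * X) <=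
  (1 + e) * (G + 8 / (3 * k) * (y + e)) * xi * ((1 - e / 8 / 2) * (3 / 8 * X)).
Proof.
move=> ee G0 y0 x0 X0 k1.
have q2 : (1 + e / 8) * (1 + e / 8) <= (1 + e) * (1 - e / 8 / 2) by nra.
have V0 : 0 <= G + 8 / (3 * k) * (y + e).
  by rewrite addr_ge0 // mulr_ge0 ?divr_ge0 ?mulr_ge0 ?addr_ge0 ?(ltW k1) //; lra.
apply: le_trans (_ : (1 + e / 8) * (1 + e / 8) * (3 / 8 * (G + 8 / (3 * k) * (y + e)) * xi * X) <= _); last first.
  rewrite [leRHS](_ : _ = (1 + e) * (1 - e / 8 / 2) * (3 / 8 * (G + 8 / (3 * k) * (y + e)) * xi * X)); last by ring.
  by rewrite ler_wpM2r // !mulr_ge0 ?(ltW x0) ?(ltW X0).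
rewrite -subr_ge0 [X in 0 <= X](_ : _ = (1 + e / 8) * (e / 8 * y + ((1 + e / 8) * e - e / 8)) * (xi / k * X)); last first.
  by field; rewrite gt_eqF.
have p : 0 <= e / 8 * y by rewrite mulr_ge0 //; lra.
rewrite !mulr_ge0 ?invr_ge0 ?(ltW x0) ?(ltW X0) ?(ltW k1) //; first by lra.
by rewrite addr_ge0 //; nra.
Qed.

(** The second bound concerns the coincidences of angles: its left side does not depend on xi, so
    letting xi tend to 0 shows in [lim_at0] that the limit correlation vanishes at 0. This removes
    the extra term of the first bound. *)
Lemma rr_upper F e (Y : nat) : uniq F -> [::] \notin F -> (0 < Y)%N ->
  (forall m, m != [::] -> m \notin F -> far Y (wX m) (wY m)) ->
  0 < e < 1 -> exists2 x0, 0 < x0 &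
  forall xi, 0 < xi <= x0 -> \forall X \near +oo,
    rr xi X <= (1 + e) * (Gsum F + K0 * (512 / Y%:R + e)) * xi + rr 0 X /\
    rr 0 X <= 2 * ((1 + e) * (Gsum F + K0 * (512 / Y%:R + e)) * xi).
Proof.
move=> uF nF Y0 cF ee; pose e' := e / 8; have ee' : 0 < e' < 1 by rewrite /e'; lra.
have q3 : 1 <= (1 + e') * (1 - e' / 2) by rewrite /e'; nra.
have e1' : 0 < 1 - e' / 2 by lra.
have c38 : 0 < (3 / 8 : R) by lra.
have tl : forall tau, 0 <= tau <= 1 / 4 -> 0 < e' * tau -> \forall X \near +oo,
    (cnt (Tl Y tau X))%:R <= 512 / Y%:R * tau * X + e' * tau * X.
  move=> tau t4 et; near=> X; rewrite -mul_div_rot; near: X; exact: tail_count.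
have e1 : 0 <= 1 + e by lra.
move: (512 / Y%:R : R) (divr_ge0 (ler0n _ 512) (ler0n _ Y) : 0 <= 512 / Y%:R :> R) tl => y y0 tl.
have ye : 0 <= y + e by lra.
have [t t0 ht] := cells_asymp nF ee'; have k := k0_gt0; have pp := pi_gt0 R.
pose x0 := Num.min (k0 * t / 2) (k0 / 8).
exists x0; first by rewrite lt_min !divr_gt0 // mulr_gt0.
move=> xi /andP[xi0]; rewrite le_min => /andP[xt x4].
pose tau := (1 + e') * xi / k0.
have tau0 : 0 < tau by rewrite divr_gt0 // mulr_gt0 //; lra.
have txi : tau <= 2 * xi / k0 by rewrite /tau ler_pM2r ?invr_gt0 // ler_wpM2r ?(ltW xi0) //; lra.
have taut : tau <= t by apply: le_trans txi _; rewrite ler_pdivrMr // mulrC; lra.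
have tau4 : 0 <= tau <= 1 / 4.
  by rewrite (ltW tau0) /=; apply: le_trans txi _; rewrite ler_pdivrMr //; lra.
have tau2 : 0 <= tau < 1 / 2 by case/andP: tau4 => -> t4; clear -t4; lra.
have et : 0 < e' * tau by rewrite mulr_gt0 //; lra.
near=> X.
have X0 : 0 < X by near: X; exact: nbhs_pinfty_gt.
have /andP[N1 _] : (1 - e' / 2) * (3 / 8 * X) <= N [::] X <= (1 + e' / 2) * (3 / 8 * X).
  by near: X; apply: N_asymp; lra.
have /andP[_ c1] : (1 - e') * (\sum_(m <- F) cm m * tau) * X <= \sum_(m <- F) (cnt (Nm m tau X))%:R <=
  (1 + e') * (\sum_(m <- F) cm m * tau) * X by near: X; apply: ht; rewrite tau0.
have c2 : (cnt (Tl Y tau X))%:R <= y * tau * X + e' * tau * X.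
  by near: X; apply: tl.
have Npos : 0 < N [::] X := lt_le_trans (mulr_gt0 e1' (mulr_gt0 c38 X0)) N1.
have tX : pi / 2 * xi / N [::] X <= tau / X.
  rewrite ler_pdivrMr // [leRHS]mulrAC ler_pdivlMr //.
  apply: le_trans (ler_wpM2l (ltW tau0) N1).
  rewrite /tau [leRHS](_ : _ = (1 + e') * (1 - e' / 2) * (pi / 2 * xi * X)); last first.
    by rewrite -k0_38; field; rewrite gt_eqF.
  rewrite ler_peMl //; first by rewrite !mulr_ge0 ?(ltW pp) ?(ltW xi0) ?(ltW X0).
have hE : (cnt (Ep tau X) <= \sum_(m <- F) cnt (Nm m tau X) + cnt (Tl Y tau X))%N.
  rewrite -Ep_cells //; apply: leq_trans (cntU_le _ _).
  - apply: cnt_le; first by rewrite finite_setU; split; apply: sub_finite_set (Ep_finite tau X) => ? [].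
    move=> a Ea; have [h|h] := boolP (a.2 \in F); first by left.
    by right; split=> //; apply: cF => //; case: Ea.
  - by apply: sub_finite_set (Ep_finite tau X) => ? [].
  - by apply: sub_finite_set (Ep_finite tau X) => ? [].
have [_ up1 up2] := CP_Ep tau2 X0.
move: (Gsum F) (Gsum_ge0 nF) (Gsum_cm tau nF) => G G0 eG; rewrite eG in c1.
have hEN : (cnt (Ep tau X))%:R / N [::] X <= (1 + e) * (G + K0 * (y + e)) * xi.
  rewrite ler_pdivrMr //; rewrite -(ler_nat R) natrD natr_sum in hE; apply: le_trans hE _.
  apply: le_trans (lerD c1 c2) _; apply: le_trans (upper_numeric ee G0 y0 xi0 X0 k) _.
  rewrite -/K0 -/e'; apply: ler_wpM2l; last exact: N1.
  apply: mulr_ge0; last exact: ltW xi0.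
  by apply: mulr_ge0 => //; apply: addr_ge0 => //; apply: mulr_ge0 => //; exact: K0_ge0.
have z : pi / 2 * 0 / N [::] X = 0 by rewrite mulr0 mul0r.
split.
  rewrite /rr z; apply: le_trans (lerD hEN (lexx _)); rewrite -mulrDl ler_pM2r ?invr_gt0 // -natrD ler_nat.
  by apply: leq_trans (CP_mono X tX) up1.
rewrite /rr z; apply: le_trans (ler_wpM2l _ hEN); last by [].
rewrite mulrA ler_pM2r ?invr_gt0 // -natrM ler_nat; exact: up2.
Unshelve. all: by end_near. Qed.

Lemma near_sqr (Q : R -> Prop) : (\forall X \near +oo, Q X) -> \forall q \near +oo, Q (q ^+ 2).
Proof.
move=> [M [_ hM]]; near=> q.
have q1 : 1 < q by near: q; apply: nbhs_pinfty_gt; exact: num_real.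
have qM : M < q by near: q; apply: nbhs_pinfty_gt; exact: num_real.
by apply: hM; apply: lt_le_trans qM _; rewrite expr2 ler_peMl //; lra.
Unshelve. all: by end_near. Qed.

Definition near_words (Y : nat) : seq (seq bool) :=
  [seq m <- fset_set [set m | (wX m <= Y)%N /\ (wY m <= Y)%N] | m != [::]].

Lemma near_wordsP Y : [/\ uniq (near_words Y), [::] \notin near_words Y &
  forall m, m != [::] -> m \notin near_words Y -> far Y (wX m) (wY m)].
Proof.
have fin : finite_set [set m | (wX m <= Y)%N /\ (wY m <= Y)%N].
  have [] // := @cnt_box R _ [set m | (wX m <= Y)%N /\ (wY m <= Y)%N] wX wY Y%:R Y%:R (ler0n _ _) (ler0n _ _).
    by move=> m [h1 h2]; rewrite wX_gt0 wY_gt0 !ler_nat.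
  by move=> v w _ _; exact: XY_inj.
split; first by rewrite filter_uniq ?fset_uniq.
  by rewrite mem_filter.
move=> m m0; rewrite mem_filter m0 /= in_fset_set // => h.
rewrite /far !ltnNge -negb_and; apply: contra h => /andP[h1 h2]; rewrite inE /=; by split.
Qed.

Lemma slope_numeric (G k y d e : R) : 0 <= k -> 0 < d -> d <= 1 / 2 ->
  d * (G + k * y + 2 * k + 1) <= e -> (1 + d) * (G + k * (y + d)) <= e + (G + k * y).
Proof.
move=> k1 d0 d1 h; have kd : 0 <= k * d * (1 - d) by rewrite !mulr_ge0 ?(ltW d0) //; lra.
nra.
Qed.

Section LimitCorrelation.
Variable f : R -> R.
Hypothesis rr_cvg : forall xi, 0 <= xi -> rr xi (q ^+ 2) @[q --> +oo] --> f xi.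

Lemma lim_lower xi a : 0 <= xi -> (\forall X \near +oo, a <= rr xi X) -> a <= f xi.
Proof.
by move=> xi0 /near_sqr h; apply: (cvgr_to_ge (rr_cvg xi0)).
Qed.

Lemma lim_upper xi a : 0 <= xi -> (\forall X \near +oo, rr xi X <= a) -> f xi <= a.
Proof.
by move=> xi0 /near_sqr h; apply: (cvgr_to_le (rr_cvg xi0)).
Qed.

Lemma lim_at0 : f 0 = 0.
Proof.
apply/eqP; rewrite eq_le; apply/andP; split; last first.
  apply: lim_lower => //; near=> X; rewrite /rr divr_ge0 ?ler0n //; exact: N_ge0.
have [uF nF cF] := near_wordsP 1.
have h : 0 < (1 / 2 : R) < 1 by lra.
have [x0 x00 hx] := rr_upper uF nF (ltn0Sn 0) cF h.
set V := (1 + 1 / 2) * _ in hx.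
apply/ler_addgt0Pl => e e0; rewrite addr0.
have V0 : 0 < 2 * (`|V| + 1) by rewrite mulr_gt0 // ltr_wpDl.
pose xi := Num.min x0 (e / (2 * (`|V| + 1))).
have xi0 : 0 < xi by rewrite lt_min x00 divr_gt0.
have hh : 0 < xi <= x0 by rewrite xi0 ge_min lexx.
apply: le_trans (_ : 2 * (V * xi) <= e).
  by apply: lim_upper => //; near=> X; have [|_] := near (hx xi hh) X.
have xe : xi * (2 * (`|V| + 1)) <= e by rewrite -ler_pdivlMr // ge_min lexx orbT.
have Vx : V * xi <= `|V| * xi by rewrite ler_wpM2r ?(ltW xi0) ?ler_norm.
by lra.
Unshelve. all: by end_near. Qed.

Variable g : R.
Hypothesis f_slope : f xi / xi @[xi --> 0^'+] --> g.

Lemma Gsum_le_slope F : uniq F -> [::] \notin F -> Gsum F <= g.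
Proof.
move=> uF nF; have G0 := Gsum_ge0 nF.
suff h e : 0 < e < 1 -> (1 - e) * Gsum F <= g.
  apply/ler_addgt0Pl => e e0.
  pose d := Num.min (1 / 2) (e / (Gsum F + 1)).
  have d0 : 0 < d by rewrite lt_min !divr_gt0 //; lra.
  have d1 : d <= 1 / 2 by rewrite ge_min lexx.
  have dG : d * (Gsum F + 1) <= e by rewrite -ler_pdivlMr ?ge_min ?lexx ?orbT //; lra.
  have := h d (ltac:(lra)); lra.
move=> ee; have [x0 x00 hx] := rr_lower uF nF ee.
apply: (cvgr_to_ge f_slope); near=> xi.
have xi0 : 0 < xi by near: xi; exact: nbhs_right_gt.
have hh : 0 < xi <= x0 by rewrite xi0 /=; near: xi; exact: nbhs_right_le.
rewrite ler_pdivlMr //; apply: lim_lower; first exact: ltW.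
exact: hx.
Unshelve. all: by end_near. Qed.

Lemma slope_le_Gsum F (Y : nat) : uniq F -> [::] \notin F -> (0 < Y)%N ->
  (forall m, m != [::] -> m \notin F -> far Y (wX m) (wY m)) ->
  g <= Gsum F + K0 * (512 / Y%:R).
Proof.
move=> uF nF Y0 cF; have G0 := Gsum_ge0 nF; have K00 := K0_ge0.
have [y y0 ye] : exists2 y : R, 0 <= y & 512 / Y%:R = y.
  by exists (512 / Y%:R); [exact: divr_ge0 (ler0n _ 512) (ler0n _ Y) | reflexivity].
have Ky := mulr_ge0 K00 y0.
rewrite ye; suff h e : 0 < e < 1 -> g <= (1 + e) * (Gsum F + K0 * (y + e)).
  apply/ler_addgt0Pl => e e0.
  pose W := Gsum F + K0 * y + 2 * K0 + 1; have W0 : 0 < W by rewrite /W; lra.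
  pose d := Num.min (1 / 2) (e / W).
  have d0 : 0 < d by rewrite lt_min !divr_gt0 //; lra.
  have d1 : d <= 1 / 2 by rewrite ge_min lexx.
  have dG : d * W <= e by rewrite -ler_pdivlMr // ge_min lexx orbT.
  apply: le_trans (h d (ltac:(lra))) _.
  exact: slope_numeric K00 d0 d1 dG.
move=> ee; have [x0 x00 hx] := rr_upper uF nF Y0 cF ee; rewrite ye in hx.
apply: (cvgr_to_le f_slope); near=> xi.
have xi0 : 0 < xi by near: xi; exact: nbhs_right_gt.
have hh : 0 < xi <= x0 by rewrite xi0 /=; near: xi; exact: nbhs_right_le.
rewrite ler_pdivrMr //.
set V := _ * _.
have rr0 : \forall X \near +oo, rr xi X - rr 0 X <= V.
  by apply: filterS (hx xi hh) => X [h _]; rewrite lerBlDr.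
have hc : rr xi (q ^+ 2) - rr 0 (q ^+ 2) @[q --> +oo] --> f xi.
  by have := cvgB (rr_cvg (ltW xi0)) (rr_cvg (lexx 0)); rewrite lim_at0 subr0; exact.
apply: (cvgr_to_le hc).
exact: (@near_sqr (fun X => rr xi X - rr 0 X <= V) rr0).
Unshelve. all: by end_near. Qed.

(** Every finite family of words bounds the slope from below, and the words with label in a box of
    size Y bound it from above up to K0 * 512 / Y. Summability is thus a consequence. *)
Lemma slope_esum : (\esum_(m in [set m | m != [::]]) (wt m)%:E)%E = (3 / 2 * g)%:E.
Proof.
have wt0 m : m != [::] -> 0 <= wt m.
  move=> m0; have := Gsum_ge0 (F := [:: m]); rewrite /Gsum big_seq1 inE eq_sym m0 => /(_ isT); lra.
have sumE (F : seq (seq bool)) : (\sum_(m <- F) (wt m)%:E = (3 / 2 * Gsum F)%:E)%E.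
  by rewrite sumEFin; congr EFin; rewrite /Gsum; lra.
apply/eqP; rewrite eq_le; apply/andP; split.
  apply: ge_ereal_sup => _ [A [finA sA] <-].
  rewrite fsbig_finite // sumE lee_fin ler_pM2l; last by lra.
  apply: Gsum_le_slope; first exact: fset_uniq.
  by apply/negP; rewrite in_fset_set // inE => /sA /=.
apply/lee_addgt0Pr => e e0.
pose Y := (Num.bound (3 / 2 * (K0 * 512) / e)).+1.
have [uF nF cF] := near_wordsP Y.
have gl := slope_le_Gsum uF nF (ltn0Sn _) cF.
have Ye : 3 / 2 * (K0 * (512 / Y%:R)) <= e.
  have K512 : 0 <= 3 / 2 * (K0 * 512) / e.
    apply: divr_ge0; last exact: ltW.
    by apply: mulr_ge0; [rewrite divr_ge0 | exact: (mulr_ge0 K0_ge0 (ler0n R 512))].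
  have h := archi_boundP K512.
  have Yp : 0 < Y%:R :> R by rewrite ltr0n.
  have -> : 3 / 2 * (K0 * (512 / Y%:R)) = 3 / 2 * (K0 * 512) / Y%:R.
    by move: K0 (Y%:R : R) (512 : R) => *; ring.
  rewrite ltr_pdivrMr // in h; rewrite ler_pdivrMr //.
  apply: le_trans (ltW h) _.
  by rewrite mulrC ler_wpM2l ?(ltW e0) // ler_nat.
apply: le_trans (_ : ((3 / 2 * Gsum (near_words Y))%:E + e%:E <= _)%E).
  rewrite -EFinD lee_fin; move: gl Ye; rewrite -/Y; move: (Gsum _) (K0 * _) => a b *; lra.
rewrite leeD2r // -sumE; apply: esum_ge.
exists [set m | m \in near_words Y].
  by split; [exact: finite_seq | move=> m /= h; apply: contraNneq nF => <-].
by rewrite -fsbig_seq.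
Qed.
End LimitCorrelation.

(** * Words as integer matrices *)

Definition mat2 (a b c d : int) : 'M[int]_2 :=
  \matrix_(i, j) (if i == 0 then (if j == 0 then a else b) else (if j == 0 then c else d)).

Lemma mat2E a b c d : (mat2 a b c d 0 0 = a) * (mat2 a b c d 0 1 = b) *
  (mat2 a b c d 1 0 = c) * (mat2 a b c d 1 1 = d).
Proof. by rewrite !mxE. Qed.

Lemma ord2P (Q : 'I_2 -> Prop) : Q 0 -> Q 1 -> forall i, Q i.
Proof.
move=> Q0 Q1 i; have [->|] := eqVneq i 0; first by [].
by case: i => -[|[|//]] lt /=; rewrite ?eqxx // => _; congr Q : Q1; exact: val_inj.
Qed.

Lemma mx2P (M K : 'M[int]_2) : M 0 0 = K 0 0 -> M 0 1 = K 0 1 -> M 1 0 = K 1 0 ->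
  M 1 1 = K 1 1 -> M = K.
Proof. by move=> *; apply/matrixP; apply: ord2P; apply: ord2P. Qed.

Lemma mat2_eta (M : 'M[int]_2) : M = mat2 (M 0 0) (M 0 1) (M 1 0) (M 1 1).
Proof. by apply: mx2P; rewrite mat2E. Qed.

Lemma det2 (M : 'M[int]_2) : \det M = M 0 0 * M 1 1 - M 0 1 * M 1 0.
Proof.
rewrite (expand_det_row _ 0) !big_ord_recl big_ord0 addr0 /cofactor !det_mx11 !mxE /= expr0 expr1 mul1r.
rewrite mulN1r mulrN; congr (_ * M _ _ - M _ _ * M _ _); exact: val_inj.
Qed.

Lemma sum_ord2 (V : nmodType) (F : 'I_2 -> V) : \sum_i F i = F 0 + F 1.
Proof. by rewrite !big_ord_recl big_ord0 addr0; congr (_ + F _); exact: val_inj. Qed.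

Lemma mat2M a b c d a' b' c' d' : mat2 a b c d * mat2 a' b' c' d' =
  mat2 (a * a' + b * c') (a * b' + b * d') (c * a' + d * c') (c * b' + d * d').
Proof. by apply: mx2P; rewrite !mat2E /GRing.mul /= !mxE sum_ord2 !mat2E. Qed.

Definition wmat w := mat2 (wA w) (wB w) (wC w) (wD w).
Definition gam w := mat2 (wA w) (wB w) (wA w + wC w)%N (wB w + wD w)%N.

Lemma wmat_inj : injective wmat.
Proof.
move=> v w e; have e0 := congr1 (fun M : 'M[int]_2 => M 0 0) e.
have e1 := congr1 (fun M : 'M[int]_2 => M 0 1) e.
have e2 := congr1 (fun M : 'M[int]_2 => M 1 0) e.
have e3 := congr1 (fun M : 'M[int]_2 => M 1 1) e.
move: e0 e1 e2 e3; rewrite /= !mat2E => -[e0] [e1] [e2] [e3].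
by apply: row_inj; rewrite ?e0 ?e1 ?e2 ?e3.
Qed.

Lemma gam_inj : injective gam.
Proof.
move=> v w e.
have e2 := congr1 (fun M : 'M[int]_2 => M 1 0) e.
have e3 := congr1 (fun M : 'M[int]_2 => M 1 1) e.
by move: e2 e3; rewrite /= !mat2E => -[e2] [e3]; apply: row_inj.
Qed.

(** Determinant 1 forces one row to dominate the other entrywise unless the matrix is the identity;
    subtracting the smaller row removes the first letter. *)
Lemma words_surj (a b c d : nat) : (a * d = b * c + 1)%N ->
  exists w, [/\ wA w = a, wB w = b, wC w = c & wD w = d].
Proof.
have [n] := ubnP (a + b + c + d)%N; elim: n a b c d => // n IH a b c d; rewrite ltnS => sz det.
have a0 : (0 < a)%N by case: a det {sz} => //; rewrite mul0n addn1.
have d0 : (0 < d)%N by case: d det {sz} => //; rewrite muln0 addn1.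
have [/andP[ca db]|h1] := boolP ((c <= a) && (d <= b))%N.
  have [] := IH (a - c)%N (b - d)%N c d; [lia| |].
    rewrite !mulnBl det [(d * c)%N]mulnC; have : (c * d <= b * c)%N by rewrite mulnC leq_mul2r db orbT.
    by lia.
  move=> w [e1 e2 e3 e4]; exists (true :: w); rewrite !w_cons /= e1 e2 e3 e4; split; lia.
have [/andP[ac bd]|h2] := boolP ((a <= c) && (b <= d))%N.
  have [] := IH a b (c - a)%N (d - b)%N; [lia| |].
    rewrite !mulnBr det [(a * b)%N]mulnC; have : (b * a <= b * c)%N by rewrite leq_mul2l ac orbT.
    by lia.
  move=> w [e1 e2 e3 e4]; exists (false :: w); rewrite !w_cons /= e1 e2 e3 e4; split; lia.
exists [::]; rewrite !w_nil; have [ca|ac] := leqP c a.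
  have bd : (b < d)%N by move: h1; rewrite ca /= -ltnNge.
  have ca' : (c < a)%N by rewrite ltn_neqAle ca andbT; apply: contra h2 => /eqP ->; rewrite leqnn ltnW.
  by have := leq_mul ca' bd; rewrite det mulSn mulnS => h; split; nia.
have db : (d < b)%N by move: h2; rewrite (ltnW ac) /= -ltnNge.
by exfalso; have := leq_mul ac db; rewrite mulSn mulnS det [(c * b)%N]mulnC; lia.
Qed.

Lemma wmat_det w : \det (wmat w) = 1.
Proof.
rewrite det2 !mat2E -!PoszM (w_det w) PoszD; by rewrite [_ + 1]addrC addrK.
Qed.

Lemma wmat_nil : wmat [::] = 1.
Proof. by apply: mx2P; rewrite mat2E w_nil ?mxE. Qed.

Lemma nonneg_nat (z : int) : 0 <= z -> exists a : nat, z = a.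
Proof. by move=> /gez0_abs e; exists `|z|%N. Qed.

Lemma frakS_words : frakS = [set wmat m | m in [set m | m != [::]]].
Proof.
apply/seteqP; split=> [M [dM pM M1]|_ [m m0 <-]].
  have [a ea] := nonneg_nat (pM _ _ : 0 <= M 0 0).
  have [b eb] := nonneg_nat (pM _ _ : 0 <= M 0 1).
  have [c ec] := nonneg_nat (pM _ _ : 0 <= M 1 0).
  have [d ed] := nonneg_nat (pM _ _ : 0 <= M 1 1).
  move: dM; rewrite /SL2Z /= det2 ea eb ec ed => dM.
  have [|w [e1 e2 e3 e4]] := @words_surj a b c d; first by lia.
  have eM : wmat w = M by apply: mx2P; rewrite mat2E ?ea ?eb ?ec ?ed ?e1 ?e2 ?e3 ?e4.
  exists w => //=; apply: contraNneq M1 => w0; by rewrite -eM w0 wmat_nil.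
split; first exact: wmat_det.
  by apply: ord2P; apply: ord2P; rewrite mat2E.
by apply: contra m0 => /eqP; rewrite -wmat_nil => /wmat_inj ->.
Qed.

Lemma GammaI_words : GammaI = range gam.
Proof.
apply/seteqP; split=> [M [dM pM /and3P[h1 h2 h3]]|_ [w _ <-]].
  have [a ea] := nonneg_nat (pM _ _ : 0 <= M 0 0).
  have [b eb] := nonneg_nat (pM _ _ : 0 <= M 0 1).
  have [c ec] := nonneg_nat (pM _ _ : 0 <= M 1 0).
  have [d ed] := nonneg_nat (pM _ _ : 0 <= M 1 1).
  move: dM; rewrite /SL2Z /= det2 ea eb ec ed => dM.
  rewrite ea eb ec ed in h1 h2 h3.
  have c0 : (0 < c)%N.
    rewrite lt0n; apply/eqP => c0; move: (le_lt_trans h1 h2); rewrite c0 invr0 mulr0 ltxx //.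
  have ac : (a <= c)%N by move: h3; rewrite ler_pdivrMr ?ltr0z ?ltz_nat // mul1r ler_int lez_nat.
  have bd : (b <= d)%N by nia.
  have [|w [e1 e2 e3 e4]] := @words_surj a b (c - a)%N (d - b)%N.
    by nia.
  exists w => //; apply: mx2P; rewrite mat2E ?ea ?eb ?ec ?ed ?e1 ?e2 ?e3 ?e4 ?subnKC //.
have A0 := wA_gt0 w; have D0 := wD_gt0 w; have dt := w_det w.
split; first by rewrite /SL2Z /= det2 !mat2E; nia.
  by apply: ord2P; apply: ord2P; rewrite mat2E.
have p1 : 0 < ((wA w + wC w)%N : int)%:~R :> rat by rewrite ltr0z ltz_nat addn_gt0 A0.
have p2 : 0 < ((wB w + wD w)%N : int)%:~R :> rat by rewrite ltr0z ltz_nat addn_gt0 D0 orbT.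
rewrite !mat2E; apply/and3P; split.
- by rewrite divr_ge0 // ler0z.
- rewrite ltr_pdivrMr // mulrAC ltr_pdivlMr // -!intrM ltr_int -!PoszM ltz_nat; nia.
- by rewrite ler_pdivrMr // mul1r ler_int lez_nat leq_addr.
Qed.

(** * The pair correlation in terms of words *)

Lemma CintE (z : int) : z%:~R = Complex (z%:~R : R) 0.
Proof. by rewrite -[RHS]/((z%:~R : R)%:C)%C rmorph_int. Qed.

Lemma CmulE (x y x' y' : R) : Complex x y * Complex x' y' = Complex (x * x' - y * y') (x * y' + y * x').
Proof. by []. Qed.

Lemma CaddE (x y x' y' : R) : Complex x y + Complex x' y' = Complex (x + x') (y + y').
Proof. by []. Qed.

Lemma mobius_i (g : 'M[int]_2) (a b c d : R) : SL2Z g ->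
  a = (g 0 0)%:~R -> b = (g 0 1)%:~R -> c = (g 1 0)%:~R -> d = (g 1 1)%:~R ->
  0 < c ^+ 2 + d ^+ 2 /\
  mobius g (Complex 0 1) = Complex ((a * c + b * d) / (c ^+ 2 + d ^+ 2)) (c ^+ 2 + d ^+ 2)^-1.
Proof.
rewrite /SL2Z /= det2 => dg ea eb ec ed.
have dR : a * d - b * c = 1 by rewrite ea eb ec ed -!intrM -intrB dg.
have p0 : 0 < c ^+ 2 + d ^+ 2.
  rewrite lt_neqAle eq_sym addr_ge0 ?sqr_ge0 // andbT; apply/eqP => e.
  have c0 : c ^+ 2 = 0 by have := sqr_ge0 c; have := sqr_ge0 d; lra.
  have d0 : d ^+ 2 = 0 by have := sqr_ge0 c; have := sqr_ge0 d; lra.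
  move/eqP: c0; rewrite sqrf_eq0 => /eqP c0; move/eqP: d0; rewrite sqrf_eq0 => /eqP d0.
  by move: dR; rewrite c0 d0; lra.
split=> //; rewrite /mobius !CintE -ea -eb -ec -ed.
have ax (x y : R) : Complex x 0 * Complex 0 1 + Complex y 0 = Complex y x.
  by rewrite CmulE CaddE; congr Complex; ring.
rewrite !ax.
have D0 : Complex d c != 0.
  apply/eqP => -[d0 c0]; move: p0; rewrite d0 c0 expr0n addr0 ltxx //.
apply: (canLR (mulfK D0)); rewrite CmulE.
have pn : c ^+ 2 + d ^+ 2 != 0 by rewrite gt_eqF.
have -> : (a * c + b * d) / (c ^+ 2 + d ^+ 2) * d - (c ^+ 2 + d ^+ 2)^-1 * c =
  ((a * c + b * d) * d - (a * d - b * c) * c) / (c ^+ 2 + d ^+ 2) by rewrite dR; field.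
have -> : (a * c + b * d) / (c ^+ 2 + d ^+ 2) * c + (c ^+ 2 + d ^+ 2)^-1 * d =
  ((a * c + b * d) * c + (a * d - b * c) * d) / (c ^+ 2 + d ^+ 2) by rewrite dR; field.
by congr Complex; field.
Qed.

Lemma gam_SL2Z w : SL2Z (gam w).
Proof.
have : GammaI (gam w) by rewrite GammaI_words; exists w.
by case.
Qed.

(** Here gamma i = (p12 + i) / p22, and p12^2 + 1 = p11 p22, so the tangent vector at i is
    proportional to (2 p12, p11 - p22). Its real part is nonnegative, which selects the first branch
    of [angle_from_down]. *)
Lemma theta_gam w : theta R (gam w) = th w.
Proof.
have [] := @mobius_i (gam w) (ra w) (rb w) (ra w + rc w) (rb w + rd w) (gam_SL2Z w).
- by rewrite mat2E.
- by rewrite mat2E.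
- by rewrite mat2E /ra /rc -natrD.
- by rewrite mat2E /rb /rd -natrD.
rewrite -/(p22 w) -/(p12 w) => p0 mob.
have dt := p_det w; have p12_0 := p12_ge1 w; have le := p11_le w.
rewrite /theta mob /tangent_at_i /angle_from_down /=.
have r0 : 0 <= 2 * (p12 w / p22 w) by rewrite mulr_ge0 // divr_ge0 ?(ltW p0) //; lra.
rewrite r0 /th /ang; congr acos.
have pn : p22 w != 0 by rewrite gt_eqF.
have -> : (p12 w / p22 w) ^+ 2 + (p22 w)^-1 ^+ 2 - 1 = - (p22 w - p11 w) / p22 w.
  transitivity ((p12 w ^+ 2 + (p11 w * p22 w - p12 w ^+ 2)) / p22 w ^+ 2 - 1); first by rewrite dt; field.
  by field.
have -> : (2 * (p12 w / p22 w)) ^+ 2 + (- (p22 w - p11 w) / p22 w) ^+ 2 =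
   ((p22 w - p11 w) ^+ 2 + (2 * p12 w) ^+ 2) / p22 w ^+ 2 by field.
have q0 : 0 < (p22 w - p11 w) ^+ 2 + (2 * p12 w) ^+ 2.
  by rewrite ltr_wpDl ?sqr_ge0 // exprn_gt0 //; lra.
rewrite sqrtrM ?(ltW q0) // sqrtrV ?sqr_ge0 // sqrtr_sqr gtr0_norm //.
move: q0; rewrite -sqrtr_gt0; move: (Num.sqrt _) => S S0.
by field; rewrite pn gt_eqF.
Qed.

Lemma norm_gam w : (norm_sq (gam w))%:~R = gT w :> R.
Proof.
rewrite /norm_sq !mat2E !rmorphD !rmorphXn /= /gT /g11 /g22 -/(ra w) -/(rb w).
have -> : ((wA w + wC w)%N : int)%:~R = ra w + rc w :> R by rewrite /ra /rc -natrD.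
have -> : ((wB w + wD w)%N : int)%:~R = rb w + rd w :> R by rewrite /rb /rd -natrD.
by ring.
Qed.

Lemma norm_wmat w : (norm_sq (wmat w))%:~R = nT w :> R.
Proof.
rewrite /norm_sq !mat2E !rmorphD !rmorphXn /= /nT /n11 /n22 -/(ra w) -/(rb w) -/(rc w) -/(rd w).
by ring.
Qed.

Lemma ballI_words (q : R) : 0 < q -> ballI q = [set gam w | w in ball [::] (q ^+ 2)].
Proof.
move=> q0; rewrite /ballI GammaI_words.
have le w : (mxnorm R (gam w) <= q) = (gT w <= q ^+ 2).
  rewrite /mxnorm norm_gam -[in LHS](@ger0_norm _ q) ?(ltW q0) // -sqrtr_sqr ler_sqrt //.
  by rewrite sqr_ge0.
apply/seteqP; split=> [_ [[w _ <-]]|_ [w bw <-]].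
  by rewrite le => h; exists w; rewrite // /ball /= cats0.
by split; [exists w | rewrite le; move: bw; rewrite /ball /= cats0].
Qed.

Lemma B_words (q : R) : 0 < q -> B_ q = N [::] (q ^+ 2).
Proof.
move=> q0; rewrite /B_ ballI_words // /N -/(cnt _) cnt_image //; first exact: ball_finite.
by move=> v w _ _; exact: gam_inj.
Qed.

Lemma RA_words (q xi : R) : 0 < q -> RA_ q xi = rr xi (q ^+ 2).
Proof.
move=> q0; rewrite /RA_ /rr B_words //; congr (_%:R / _).
rewrite -/(cnt _) -[RHS](@cnt_image _ _ _ (fun p => (gam p.1, gam p.2))); first last.
- by move=> [? ?] [? ?] _ _ [/gam_inj -> /gam_inj ->].
- exact: CP_finite.
have pp := pi_gt0 R.
have ang v w : (0 <= 2 / pi * (theta R (gam w) - theta R (gam v)) <= xi / B_ q) =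
    (0 <= th w - th v <= pi / 2 * xi / N [::] (q ^+ 2)).
  rewrite !theta_gam B_words // pmulr_rge0 ?divr_gt0 //; congr (_ && _).
  by rewrite -ler_pdivlMl ?divr_gt0 // invf_div !mulrA.
congr cnt; apply/seteqP; split=> [[g1 g2] [/= b1 b2 ne h]|_ [[v w] [/= hv hw ne h] <-]].
  rewrite ballI_words // in b1 b2; case: b1 => v bv ev; case: b2 => w bw ew; subst g1 g2.
  rewrite ang in h; rewrite (inj_eq gam_inj) in ne.
  by exists (v, w) => //; split=> //; [move: bv | move: bw]; rewrite /ball /= cats0.
split; rewrite /= ?ballI_words // ?ang ?(inj_eq gam_inj) //.
  by exists v; rewrite // /ball /= cats0.
by exists w; rewrite // /ball /= cats0.
Qed.

Lemma esum_frakS_wt : (\esum_(M in frakS)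
    ((norm_sq M)%:~R / Num.sqrt ((norm_sq M)%:~R ^+ 2 - 4) - 1 : R)%:E =
  \esum_(m in [set m | m != [::]]) (wt m)%:E)%E.
Proof.
have bij : set_bij [set m | m != [::]] frakS wmat.
  rewrite frakS_words; split.
  - by move=> m m0; exists m.
  - by move=> v w _ _; exact: wmat_inj.
  - by [].
rewrite (@reindex_esum _ _ _ _ _ _ _ bij).
by apply: eq_esum => m _; rewrite norm_wmat -/(nS _) -/(wt _).
Qed.

Section Derivative.
Hypothesis RA_exists : forall xi : R, 0 <= xi -> cvg (RA_ q xi @[q --> +oo]).
Lemma rr_cvg_RA xi : 0 <= xi -> rr xi (q ^+ 2) @[q --> +oo] --> RA xi.
Proof.
move=> xi0; apply: cvg_trans (RA_exists xi0); apply: near_eq_cvg.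
near=> q; apply: RA_words; near: q; exact: nbhs_pinfty_gt.
Unshelve. all: by end_near. Qed.

Hypothesis RA_C1 : C1_0y (@RA R).

(** As [RA] vanishes at 0, the mean value theorem turns the quotient into a value of the derivative
    at a point between 0 and xi. *)
Lemma slope_RA : RA xi / xi @[xi --> 0^'+] --> gA_at0 R.
Proof.
case: RA_C1 => dcRA _ cvd; have R0 := lim_at0 rr_cvg_RA; have [dRA cRA] := dcRA.
have wc := derivable_oy_Rcontinuous_within_itvcy dcRA.
apply/cvgrPdist_le => e e0.
have /cvgrPdist_le/(_ e e0) : derive1 (@RA R) xi @[xi --> 0^'+] --> gA_at0 R by exact: cvd.
case=> d /= d0 hd; near=> xi.
have xi0 : 0 < xi by near: xi; exact: nbhs_right_gt.
have xd : xi < d by near: xi; exact: nbhs_right_lt.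
have [||c] := @MVT R (@RA R) (derive1 (@RA R)) 0 xi xi0.
- move=> x; rewrite in_itv /= => /andP[x0 _].
  by apply: DeriveDef; [apply: dRA; rewrite in_itv /= x0 | rewrite derive1E].
- apply: continuous_subspaceW wc => x /=; rewrite !in_itv /= andbT => /andP[] //.
rewrite in_itv /= => /andP[c0 cx]; rewrite R0 !subr0 => ->.
rewrite mulfK ?gt_eqF //; apply: hd => //=.
by rewrite sub0r normrN gtr0_norm //; exact: lt_trans xd.
Unshelve. all: by end_near. Qed.

Lemma first_equality : ((gA_at0 R)%:E = (2 / 3)%:E *
  \esum_(M in frakS) ((norm_sq M)%:~R / Num.sqrt ((norm_sq M)%:~R ^+ 2 - 4) - 1)%:E)%E.
Proof.
rewrite esum_frakS_wt (slope_esum rr_cvg_RA slope_RA) -EFinM; congr EFin; lra.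
Qed.
End Derivative.

(** * Symmetric words and closed geodesics *)

Definition wpow (t : seq bool) n := iter n (cat t) [::].

Lemma wpowS t n : wpow t n.+1 = t ++ wpow t n. Proof. by []. Qed.

Lemma wpowD t (i j : nat) : wpow t (i + j) = wpow t i ++ wpow t j.
Proof. by elim: i => [|i IH] //; rewrite addSn !wpowS IH catA. Qed.

Lemma wpow1 t : wpow t 1 = t. Proof. exact: cats0. Qed.

Lemma wpowSr t n : wpow t n.+1 = wpow t n ++ t.
Proof. by rewrite -addn1 wpowD wpow1. Qed.

Lemma wpowM t (i j : nat) : wpow (wpow t i) j = wpow t (j * i).
Proof. by elim: j => // j IH; rewrite mulSn wpowD -IH. Qed.

Lemma size_wpow t n : size (wpow t n) = (n * size t)%N.
Proof. by elim: n => // n IH; rewrite wpowS size_cat IH mulSn. Qed.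

Lemma wtr_cat u v : wtr (u ++ v) = wtr v ++ wtr u.
Proof. by rewrite /wtr map_cat rev_cat. Qed.

Lemma size_wtr u : size (wtr u) = size u.
Proof. by rewrite /wtr size_rev size_map. Qed.

Lemma wtr_wpow t n : wtr (wpow t n) = wpow (wtr t) n.
Proof. by elim: n => // n IH; rewrite wpowS wtr_cat IH -wpowSr. Qed.

(** Euclid's algorithm on the lengths: the shorter word is a prefix of the longer one, and the
    remainder still commutes with it. *)
Lemma words_commute u v : u ++ v = v ++ u -> exists t i j, u = wpow t i /\ v = wpow t j.
Proof.
have [n] := ubnP (size u + size v)%N; elim: n u v => // n IH u v; rewrite ltnS.
wlog le : u v / (size u <= size v)%N.
  move=> h sz e; case/orP: (leq_total (size u) (size v)) => le; first exact: h.
  have [|t [i [j [-> ->]]]] := h v u le _ (esym e); first by rewrite addnC.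
  by exists t, j, i.
move=> sz e; case: u le sz e => [|b u] le sz e; first by exists v, 0%N, 1%N; rewrite wpow1.
have ev : v = (b :: u) ++ drop (size (b :: u)) v.
  rewrite -{1}(cat_take_drop (size (b :: u)) v); congr (_ ++ _).
  by have := congr1 (take (size (b :: u))) e; rewrite take_size_cat // takel_cat.
move: ev; set x := drop _ _ => ev; rewrite ev in e sz.
have ex : (b :: u) ++ x = x ++ (b :: u).
  by move/eqP: e; rewrite -!catA eqseq_cat // eqxx => /eqP.
have [|t [i [j [e1 e2]]]] := IH (b :: u) x _ ex.
  by apply: leq_trans sz; rewrite !size_cat /=; lia.
by exists t, i, (i + j)%N; rewrite wpowD -e1 -e2.
Qed.

(** Let [u] be the shorter word and v = ux. Cancelling a leading u in u^i = (ux)^j and then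
    appending u on the right gives (ux)^j = (xu)^j, hence ux = xu. *)
Lemma wpow_eq_commute u v (i j : nat) : (0 < i)%N -> (0 < j)%N -> wpow u i = wpow v j ->
  u ++ v = v ++ u.
Proof.
wlog le : u v i j / (size u <= size v)%N.
  move=> h i0 j0 e; case/orP: (leq_total (size u) (size v)) => le; first exact: (h _ _ i j).
  by apply/esym; apply: (h v u j i).
case: i => // i _; case: j => // j _ e.
have ev : v = u ++ drop (size u) v.
  rewrite -{1}(cat_take_drop (size u) v); congr (_ ++ _).
  have := congr1 (take (size u)) e; rewrite !wpowS take_size_cat // => eu.
  by rewrite [RHS]eu takel_cat.
move: ev; set x := drop _ _ => ev.
have shift k : wpow (u ++ x) k.+1 = u ++ wpow (x ++ u) k ++ x.
  by elim: k => [|k IH]; [rewrite wpow1 | rewrite wpowSr IH wpowSr -!catA].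
have e1 : wpow u i = wpow (x ++ u) j ++ x.
  by move: e; rewrite ev shift wpowS => /eqP; rewrite eqseq_cat // eqxx => /eqP.
have e2 : wpow (u ++ x) j.+1 = wpow (x ++ u) j.+1.
  by rewrite -ev -e wpowSr e1 -catA wpowSr catA -catA.
have xu : u ++ x = x ++ u.
  by move/eqP: e2; rewrite !wpowS eqseq_cat ?size_cat 1?addnC // => /andP[/eqP].
by rewrite ev -catA xu.
Qed.

Definition wprim (r : seq bool) := r != [::] /\ forall t n, r = wpow t n -> n = 1%N.

Lemma wprim_root s : s != [::] -> exists r n, [/\ wprim r, (0 < n)%N & s = wpow r n].
Proof.
have [k] := ubnP (size s); elim: k s => // k IH s; rewrite ltnS => sz s0.
case: (pselect (wprim s)) => [p|np]; first by exists s, 1%N; rewrite wpow1.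
have [t [n [e n1]]] : exists t n, s = wpow t n /\ n <> 1%N.
  apply: contrapT => h; apply: np; split=> // t n e; apply: contrapT => n1.
  by apply: h; exists t, n.
have n0 : (1 < n)%N by case: n e n1 => [e|[|n]] //; move: s0; rewrite e.
have t0 : t != [::].
  by apply: contraNneq s0 => t0; rewrite e t0 -size_eq0 size_wpow muln0.
have st : (size t < k)%N.
  apply: leq_trans sz; rewrite e size_wpow ltn_Pmull //.
  by rewrite lt0n size_eq0.
have [r [j [p j0 et]]] := IH t st t0.
by exists r, (n * j)%N; rewrite muln_gt0 j0 (ltnW n0) e et wpowM.
Qed.

Lemma wprim_pow_inj r r' (n k : nat) : wprim r -> wprim r' -> (0 < n)%N -> (0 < k)%N ->
  wpow r n = wpow r' k -> r = r' /\ n = k.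
Proof.
move=> [r0 p] [r0' p'] n0 k0 e.
have [t [i [j [e1 e2]]]] := words_commute (wpow_eq_commute n0 k0 e).
have i1 := p _ _ e1; have j1 := p' _ _ e2.
have err : r = r' by rewrite e1 e2 i1 j1.
split=> //; move: e; rewrite -err => /(congr1 size); rewrite !size_wpow => /eqP.
by rewrite eqn_pmul2r ?lt0n ?size_eq0 // => /eqP.
Qed.

Definition wsym (s : seq bool) := wtr s = s.

Lemma wsym_wpow r n : (0 < n)%N -> wsym (wpow r n) -> wsym r.
Proof.
case: n => // n _; rewrite /wsym wtr_wpow !wpowS => /eqP.
by rewrite eqseq_cat ?size_wtr // => /andP[/eqP].
Qed.

Definition half_word (s : seq bool) := take (size s)./2 s.

Lemma half_wordK m : half_word (m ++ wtr m) = m.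
Proof. by rewrite /half_word size_cat size_wtr addnn doubleK take_size_cat. Qed.

Lemma wsym_cat m : wsym (m ++ wtr m).
Proof. by rewrite /wsym wtr_cat wtrK. Qed.

(** Since [wtr] exchanges the letters, a symmetric word contains both equally often. Its length is
    even, and there is no middle letter. *)
Lemma wsym_half s : wsym s -> s = half_word s ++ wtr (half_word s).
Proof.
move=> ss; have ev : ~~ odd (size s).
  have c : count id s = count negb s.
    have e := congr1 (count id) ss; rewrite /wtr count_rev count_map in e.
    by rewrite -e; apply: eq_count.
  by rewrite -(count_predC id s) -[count (predC id) s]c addnn odd_double.
rewrite /half_word; set u := take _ _; pose v := drop (size s)./2 s.
have e2 : s = u ++ v by rewrite cat_take_drop.
have hs : ((size s)./2 + (size s)./2 = size s)%N.
  by rewrite addnn -[RHS]odd_double_half (negbTE ev).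
have su : size u = (size s)./2 by rewrite size_takel // -[leqRHS]hs leq_addr.
have sv : size v = (size s)./2 by rewrite size_drop -{1}hs addnK.
have : wtr v ++ wtr u == u ++ v by rewrite -wtr_cat -e2 ss.
by rewrite eqseq_cat ?size_wtr ?su ?sv // => /andP[_ /eqP ->].
Qed.

(** * Symmetric matrices, primitivity and conjugacy classes *)

Lemma wmatM u v : wmat (u ++ v) = wmat u * wmat v.
Proof.
by have [e1 e2 e3 e4] := w_cat u v; rewrite /wmat mat2M e1 e2 e3 e4 !PoszD !PoszM.
Qed.

Lemma wmat_pow t n : wmat (wpow t n) = wmat t ^+ n.
Proof. by elim: n => [|n IH]; [exact: wmat_nil | rewrite wpowS wmatM IH -exprS]. Qed.

Lemma tr2 a b c d : (mat2 a b c d)^T = mat2 a c b d.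
Proof. by apply: mx2P; rewrite mxE !mat2E. Qed.

Lemma wmat_tr w : (wmat w)^T = wmat (wtr w).
Proof. by have [e1 e2 e3 e4] := w_tr w; rewrite /wmat tr2 e1 e2 e3 e4. Qed.

Lemma trM (A B : 'M[int]_2) : (A * B)^T = B^T * A^T.
Proof. exact: trmx_mul. Qed.

Lemma SL2Z_M (A B : 'M[int]_2) : SL2Z A -> SL2Z B -> SL2Z (A * B).
Proof. by rewrite /SL2Z /= => a b; rewrite det_mulmx a b mulr1. Qed.

Lemma SL2Z_tr (A : 'M[int]_2) : SL2Z A -> SL2Z A^T.
Proof. by rewrite /SL2Z /= det_tr. Qed.

Lemma SL2Z_unit (A : 'M[int]_2) : SL2Z A -> A \is a GRing.unit.
Proof. by rewrite /SL2Z /= => a; rewrite -[_ \is a _]/(A \in unitmx) unitmxE a. Qed.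

Lemma SL2Z_V (A : 'M[int]_2) : SL2Z A -> SL2Z A^-1.
Proof. by rewrite /SL2Z /= => a; rewrite detV a invr1. Qed.

Lemma SL2Z_1 : SL2Z 1. Proof. exact: det1. Qed.

Lemma SL2Z_pow (A : 'M[int]_2) n : SL2Z A -> SL2Z (A ^+ n).
Proof. by move=> a; elim: n => [|n IH]; [exact: SL2Z_1 | rewrite exprS; exact: SL2Z_M]. Qed.

Lemma SL2Z_wmat w : SL2Z (wmat w). Proof. exact: wmat_det. Qed.

Lemma inv2 (g : 'M[int]_2) : SL2Z g -> g^-1 = mat2 (g 1 1) (- g 0 1) (- g 1 0) (g 0 0).
Proof.
move=> sg; have ug := SL2Z_unit sg; apply: (mulrI ug); rewrite divrr //.
move: sg; rewrite /SL2Z /= det2 => dg; rewrite [X in X * _]mat2_eta mat2M.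
by apply: mx2P; rewrite !mat2E ?mxE /=; move: dg; move: (g 0 0) (g 0 1) (g 1 0) (g 1 1) => a b c d dg; lia.
Qed.

Lemma trV (A : 'M[int]_2) : SL2Z A -> (A^-1)^T = (A^T)^-1.
Proof.
move=> a; apply: (mulrI (SL2Z_unit (SL2Z_tr a))); rewrite divrr ?SL2Z_unit //; last exact: SL2Z_tr.
by rewrite -trM mulVr ?SL2Z_unit // trmx1.
Qed.

Lemma trace2 (A : 'M[int]_2) : \tr A = A 0 0 + A 1 1.
Proof. by rewrite /mxtrace sum_ord2. Qed.

Lemma trace_conj (g A : 'M[int]_2) : SL2Z g -> \tr (g * A / g) = \tr A.
Proof.
move=> sg; rewrite -[_ * _ / _]/((g * A) *m g^-1) mxtrace_mulC -[g^-1 *m _]/(g^-1 * (g * A)).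
by rewrite mulKr // SL2Z_unit.
Qed.

Lemma wsym_entries s : wsym s -> s != [::] -> [/\ wB s = wC s, (0 < wB s)%N & (2 < wA s + wD s)%N].
Proof.
move=> ss s0; have [_ e _ _] := w_tr s; rewrite ss in e.
have dt := w_det s; have A0 := wA_gt0 s; have D0 := wD_gt0 s.
have B0 : (0 < wB s)%N.
  rewrite lt0n; apply: contra_neq s0 => B0; apply: wmat_inj; rewrite wmat_nil.
  have : (wA s * wD s = 1)%N by rewrite dt B0.
  move/eqP; rewrite muln_eq1 => /andP[/eqP a /eqP d].
  by apply: mx2P; rewrite mat2E ?a ?d -?e ?B0 mxE.
by split=> //; rewrite -e in dt; nia.
Qed.

Lemma hyperbolic_wsym s : wsym s -> s != [::] -> hyperbolic (wmat s).
Proof.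
move=> ss s0; have [_ _ t] := wsym_entries ss s0; split; first exact: SL2Z_wmat.
by rewrite trace2 !mat2E -PoszD ger0_norm // ltz_nat.
Qed.

Lemma wsym_mat s : wsym s <-> (wmat s)^T = wmat s.
Proof. by rewrite wmat_tr; split=> [->//|/wmat_inj]. Qed.

Lemma sym_word (P : 'M[int]_2) : SL2Z P -> P^T = P -> 0 < P 0 0 -> 0 < P 0 1 ->
  exists s, [/\ wsym s, s != [::] & P = wmat s].
Proof.
move=> sP tP p0 q0; have e : P 1 0 = P 0 1 by rewrite -{2}tP mxE.
move: (sP); rewrite /SL2Z /= det2 e => dP.
have s0 : 0 <= P 1 1 by move: p0 q0 dP; move: (P 0 0) (P 0 1) (P 1 1) => a b d *; nia.
have [a ea] := nonneg_nat (ltW p0); have [b eb] := nonneg_nat (ltW q0); have [d ed] := nonneg_nat s0.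
have [|w [e1 e2 e3 e4]] := @words_surj a b b d.
  by move: dP; rewrite ea eb ed => dP; lia.
have eP : P = wmat w by apply: mx2P; rewrite mat2E ?e ?ea ?eb ?ed ?e1 ?e2 ?e3 ?e4.
exists w; split=> //; first by apply/wsym_mat; rewrite -eP.
by apply/eqP => w0; move: q0; rewrite eP w0 wmat_nil mxE.
Qed.

(** The sign of the off-diagonal entry decides, and inversion changes this sign while keeping the
    matrix symmetric. *)
Lemma sym_trichotomy (P : 'M[int]_2) : SL2Z P -> P^T = P -> 0 < P 0 0 ->
  P = 1 \/ exists s, [/\ wsym s, s != [::] & P = wmat s \/ P^-1 = wmat s].
Proof.
move=> sP tP p0; have e : P 1 0 = P 0 1 by rewrite -{2}tP mxE.
move: (sP); rewrite /SL2Z /= det2 e => dP.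
have [q0|q0|q0] := ltgtP (P 0 1) 0.
- right; have s0 : 0 < P 1 1 by move: p0 q0 dP; move: (P 0 0) (P 0 1) (P 1 1) => a b d *; nia.
  have [||||s [h1 h2 h3]] := @sym_word P^-1; first exact: SL2Z_V.
  + by rewrite trV // tP.
  + by rewrite inv2 // mat2E.
  + by rewrite inv2 // mat2E oppr_gt0.
  by exists s; split=> //; right.
- by right; have [s [h1 h2 h3]] := sym_word sP tP p0 q0; exists s; split=> //; left.
rewrite q0 mulr0 subr0 in dP.
have [a1 d1] : P 0 0 = 1 /\ P 1 1 = 1.
  have d0 : 0 < P 1 1 by rewrite -(pmulr_rgt0 _ p0) dP.
  have [a ea] := nonneg_nat (ltW p0); have [d ed] := nonneg_nat (ltW d0).
  move: dP; rewrite ea ed -PoszM => -[] /eqP; rewrite muln_eq1 => /andP[/eqP -> /eqP ->] //.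
by left; apply: mx2P; rewrite ?e ?q0 ?a1 ?d1 mxE.
Qed.

Lemma commute_sym (B : 'M[int]_2) r : wsym r -> r != [::] -> B * wmat r = wmat r * B -> B^T = B.
Proof.
move=> sr r0 e; have [bc b0 _] := wsym_entries sr r0.
have := congr1 (fun M : 'M[int]_2 => M 0 0) e.
rewrite (mat2_eta B) /wmat !mat2M !mat2E tr2 -bc => h.
have : (wB r : int) * (B 0 1 - B 1 0) = 0 by rewrite mulrBr; lia.
move/eqP; rewrite mulf_eq0 subr_eq0 => /orP[/eqP [] b1|/eqP -> //].
by rewrite b1 in b0.
Qed.

Lemma eqPSL_pow (B : 'M[int]_2) n : eqPSL ((- B) ^+ n) (B ^+ n).
Proof.
by rewrite exprNn -signr_odd; case: (odd n); [right; rewrite expr1 mulN1r | left; rewrite expr0 mul1r].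
Qed.

Lemma wmat_neqN v w : wmat v <> - wmat w.
Proof.
move/(congr1 (fun M : 'M[int]_2 => M 0 0)); rewrite !mxE /= => e.
by have := wA_gt0 v; have := wA_gt0 w; lia.
Qed.

Lemma eqPSL_N (A B : 'M[int]_2) : eqPSL A B -> eqPSL A (- B).
Proof. by case=> ->; [right; rewrite opprK | left]. Qed.

(** A root B of the matrix of [r], up to sign, commutes with it and is therefore symmetric; after a
    change of sign [sym_trichotomy] applies. If B is the matrix of a word, that word is a root of
    [r]; if B^-1 is, then [r] followed by a word would have matrix 1 or -1. *)
Lemma prim_mat r : wsym r -> wprim r -> primitive (wmat r).
Proof.
move=> sr [r0 pr] B n [sB hB] n2 eB.
have cB : B * wmat r = wmat r * B.
  case: eB => ->; first by rewrite -exprS -exprSr.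
  by rewrite mulNr mulrN -exprS -exprSr.
have tB := commute_sym sr r0 cB.
have e10 : B 1 0 = B 0 1 by rewrite -{2}tB mxE.
wlog B0 : B sB hB eB cB tB e10 / 0 < B 0 0.
  move=> h; have [|lt0|e0] := ltgtP (B 0 0) 0; last first.
  - by move: sB; rewrite /SL2Z /= det2 e10 e0; move: (B 0 1) (B 1 1) => b d; nia.
  - exact: (h B).
  move=> lt0; apply: (h (- B)).
  - by rewrite /SL2Z /= det2 !mxE mulrNN mulrNN -det2.
  - by rewrite raddfN normrN.
  - case: (eqPSL_pow B n) => ->; [exact: eB | exact: eqPSL_N].
  - by rewrite mulNr mulrN cB.
  - by rewrite linearN /= tB.
  - by rewrite !mxE e10.
  - by rewrite mxE oppr_gt0.
have [br b0 _] := wsym_entries sr r0.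
have nscal (s : seq bool) : wmat (r ++ s) <> 1 /\ wmat (r ++ s) <> - 1.
  have [_ e _ _] := w_cat r s; have p : (0 < wB (r ++ s))%N.
    by rewrite e addn_gt0 orbC muln_gt0 b0 wD_gt0.
  split=> /(congr1 (fun M : 'M[int]_2 => M 0 1)); rewrite !mxE /= ?oppr0 => -[h];
    by rewrite h in p.
case: (sym_trichotomy sB tB B0) => [B1|[t [st t0 [Bt|Bt]]]].
- by move: eB; rewrite B1 expr1n -(cats0 r); case; have [] := nscal [::].
- move: eB; rewrite Bt -wmat_pow => -[/wmat_inj/pr n1|/wmat_neqN //].
  by rewrite n1 in n2.
have uB : B \is a GRing.unit by exact: SL2Z_unit.
have : eqPSL (wmat (r ++ wpow t n)) 1.
  rewrite wmatM wmat_pow -Bt exprVn.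
  by case: eB => ->; [left | right]; rewrite ?mulNr mulrV ?unitrX.
by case; have [] := nscal (wpow t n).
Qed.

Lemma conj_class_self (A : 'M[int]_2) : conj_class A A.
Proof. by exists 1; [exact: SL2Z_1 | left; rewrite mul1r divr1]. Qed.

Lemma conj_class_sub (A B : 'M[int]_2) : conj_class A B -> conj_class B `<=` conj_class A.
Proof.
move=> [g sg eB] C [h sh eC]; exists (h * g); first exact: SL2Z_M.
have ug := SL2Z_unit sg; have uh := SL2Z_unit sh.
rewrite invrM // -!mulrA [_ * (A * _)]mulrA; case: eC => ->; case: eB => ->; rewrite ?mulrN ?mulNr ?opprK -?mulrA; by [left|right].
Qed.

Lemma conj_class_sym (A B : 'M[int]_2) : conj_class A B -> conj_class B A.
Proof.
move=> [g sg eB]; exists g^-1; first exact: SL2Z_V.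
have ug := SL2Z_unit sg; rewrite invrK.
by case: eB => ->; [left | right]; rewrite ?mulrN ?mulNr ?opprK -!mulrA mulVr // mulr1 mulKr.
Qed.

Lemma conj_class_eq (A B : 'M[int]_2) : conj_class A B -> conj_class B = conj_class A.
Proof.
by move=> h; apply/seteqP; split; apply: conj_class_sub => //; exact: conj_class_sym.
Qed.

(** An orthogonal matrix in SL2(Z) is 1 or a quarter turn, up to sign. A quarter turn changes the
    sign of the off-diagonal entry of a symmetric matrix, which is positive for both words. *)
Lemma orthogonal_conj (u : 'M[int]_2) r r' : SL2Z u -> u^T * u = 1 -> wsym r -> r != [::] ->
  wsym r' -> r' != [::] -> wmat r' * u = u * wmat r -> r' = r.
Proof.
move=> su uu sr r0 sr' r0' e.
have uV : u^T = u^-1 by apply: (mulIr (SL2Z_unit su)); rewrite uu mulVr // SL2Z_unit.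
have e10 : u 1 0 = - u 0 1 by have := congr1 (fun M : 'M[int]_2 => M 0 1) uV; rewrite inv2 // mat2E mxE.
have e11 : u 1 1 = u 0 0.
  by have := congr1 (fun M : 'M[int]_2 => M 0 0) uV; rewrite inv2 // mat2E mxE.
have d : u 0 0 * u 0 0 + u 0 1 * u 0 1 = 1.
  by move: su; rewrite /SL2Z /= det2 e10 e11 mulrN opprK.
have [_ b0 _] := wsym_entries sr r0; have [_ b0' _] := wsym_entries sr' r0'.
have [a0|a0] := eqVneq (u 0 0) 0.
  have b1 : u 0 1 != 0 by apply/eqP => b1; rewrite a0 b1 in d.
  have := congr1 (fun M : 'M[int]_2 => M 0 0) e.
  rewrite (mat2_eta u) /wmat !mat2M !mat2E e10 a0 !mulr0 !mul0r add0r mulrN mulrC => h.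
  have : u 0 1 * ((wB r' : int) + (wC r : int)) = 0 by rewrite mulrDr; lia.
  move/eqP; rewrite mulf_eq0 (negbTE b1) /= -PoszD => /eqP [] /eqP; rewrite addn_eq0 => /andP[/eqP b _].
  by rewrite b in b0'.
have b1 : u 0 1 = 0 by move: d a0; move: (u 0 0) (u 0 1) => a b d /eqP a0; nia.
have uE : u = (u 0 0)%:M.
  by apply: mx2P; rewrite ?e10 ?e11 ?b1 !mxE /= ?oppr0.
apply: wmat_inj.
have c : u * wmat r = wmat r * u by rewrite uE; apply/esym; exact: scalar_mxC.
by move: e; rewrite c => /(mulIr (SL2Z_unit su)).
Qed.

Definition swap_word r := wtr (half_word r) ++ half_word r.

Lemma half_neq0 r : wsym r -> r != [::] -> half_word r != [::].
Proof. by move=> sr r0; apply: contra_neq r0 => h; rewrite (wsym_half sr) h. Qed.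

Lemma swap_sym r : wsym (swap_word r).
Proof. by rewrite /swap_word -{2}(wtrK (half_word r)); exact: wsym_cat. Qed.

Lemma swap_neq0 r : wsym r -> r != [::] -> swap_word r != [::].
Proof.
move=> sr r0; apply: contra_neq (half_neq0 sr r0) => h.
by apply/eqP; rewrite -size_eq0; move/(congr1 size)/eqP: h; rewrite size_cat addn_eq0 => /andP[_].
Qed.

Lemma swap_conj r : wsym r ->
  wmat r = wmat (half_word r) * wmat (swap_word r) / wmat (half_word r).
Proof.
move=> sr; rewrite {1}(wsym_half sr) /swap_word !wmatM mulrA mulrK //.
exact: SL2Z_unit (SL2Z_wmat _).
Qed.

Lemma swap_class r : wsym r -> conj_class (wmat (swap_word r)) = conj_class (wmat r).
Proof.
move=> sr; apply/esym; apply: conj_class_eq.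
by exists (wmat (half_word r)); [exact: SL2Z_wmat | left; exact: swap_conj].
Qed.

Lemma conj_pow (g B : 'M[int]_2) n : SL2Z g -> (g * B / g) ^+ n = g * B ^+ n / g.
Proof.
move=> sg; have ug := SL2Z_unit sg; elim: n => [|n IH]; first by rewrite !expr0 mulr1 divrr.
by rewrite !exprS IH -!mulrA mulKr.
Qed.

Lemma hyperbolic_conj (g B : 'M[int]_2) : SL2Z g -> hyperbolic B -> hyperbolic (g * B / g).
Proof.
by move=> sg [sB hB]; split; [exact: SL2Z_M (SL2Z_M sg sB) (SL2Z_V sg) | rewrite trace_conj].
Qed.

Lemma swap_prim r : wsym r -> wprim r -> wprim (swap_word r).
Proof.
move=> sr pr; have r0 := pr.1; have s0 := swap_neq0 sr r0; split=> // t n e.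
case: n e => [e|[//|n] e]; first by rewrite e in s0.
have st : wsym t by apply: (@wsym_wpow t n.+2) => //; rewrite -e; exact: swap_sym.
have t0 : t != [::].
  by apply: contra_neq s0 => t0; rewrite e t0; apply/eqP; rewrite -size_eq0 size_wpow muln0.
exfalso; apply: (prim_mat sr pr (B := wmat (half_word r) * wmat t / wmat (half_word r)) (n := n.+2)) => //.
  by apply: hyperbolic_conj; [exact: SL2Z_wmat | exact: hyperbolic_wsym].
by left; rewrite (conj_pow _ _ (SL2Z_wmat _)) -wmat_pow -e; exact: swap_conj.
Qed.

(** If the two words agreed, the half m would satisfy m^t = m, and [r] would be the square of m. *)
Lemma swap_neq r : wsym r -> wprim r -> swap_word r <> r.
Proof.
move=> sr pr e; move: (e); rewrite {2}(wsym_half sr) /swap_word => /eqP.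
rewrite eqseq_cat ?size_wtr // => /andP[_ /eqP h].
have := pr.2 (half_word r) 2%N; rewrite wpowS wpow1 {2}h -(wsym_half sr) => /(_ erefl) //.
Qed.

(* If [S' = g S g^-1] with [S], [S'] symmetric, [g^T g] is symmetric and commutes with [S],
   so it is a power of [S]; moving half of that power to [g] leaves [g^T g = 1] or [S]. *)
Lemma class_sym r r' : wsym r -> wprim r -> wsym r' -> r' != [::] ->
  conj_class (wmat r) (wmat r') -> r' = r \/ r' = swap_word r.
Proof.
move=> sr pr sr' r0' [g sg eS]; have r0 := pr.1.
set S := wmat r in eS; set S' := wmat r' in eS.
have sS : SL2Z S := SL2Z_wmat r; have uS := SL2Z_unit sS; have ug := SL2Z_unit sg.
have tS : S^T = S by exact/wsym_mat.
have tS' : S'^T = S' by exact/wsym_mat.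
have {}eS : S' * g = g * S.
  case: eS => eS; first by rewrite eS mulrVK.
  have : \tr S' = - \tr (g * S / g) by rewrite eS raddfN.
  rewrite trace_conj // !trace2 !mat2E.
  by have := wA_gt0 r; have := wA_gt0 r'; lia.
pose P := g^T * g.
have sP : SL2Z P by apply: SL2Z_M => //; exact: SL2Z_tr.
have tP : P^T = P by rewrite trM trmxK.
have cP : P * S = S * P.
  have e : g^T * S' = S * g^T by have := congr1 trmx eS; rewrite !trM tS tS'.
  by rewrite /P -mulrA -eS mulrA e mulrA.
have P0 : 0 < P 0 0.
  rewrite /P (mat2_eta g) tr2 mat2M !mat2E lt_neqAle eq_sym addr_ge0 ?sqr_ge0 // andbT -?expr2 ?addr_ge0 ?sqr_ge0 ?andbT //.
  rewrite paddr_eq0 ?sqr_ge0 // !sqrf_eq0; apply/negP => /andP[/eqP a /eqP c].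
  by move: sg; rewrite /SL2Z /= det2 a c mul0r mulr0 subr0.
have half (k : nat) : exists j (b : bool), k = (j + b + j)%N.
  by exists k./2, (odd k); rewrite -{1}(odd_double_half k) -addnn; lia.
have [h [sh eh hh]] : exists h, [/\ SL2Z h, S' * h = h * S & h^T * h = 1 \/ h^T * h = S].
  have commV (X : 'M[int]_2) : X * S = S * X -> S' * (g * X) = g * X * S.
    by move=> cX; rewrite mulrA eS -!mulrA cX.
  case: (sym_trichotomy sP tP P0) => [P1|[p [sp p0 Pp]]].
    by exists g; split=> //; left.
  have cp : p ++ r = r ++ p.
    apply: wmat_inj; rewrite !wmatM -/S; case: Pp => <- //.
    by have uP := SL2Z_unit sP; apply: (mulIr uP); rewrite mulrVK // -mulrA -/S -cP mulKr.
  have [t [i [j [ep er]]]] := words_commute cp.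
  have j1 := pr.2 _ _ er; rewrite j1 wpow1 in er.
  have eSi : wmat p = S ^+ i by rewrite ep -er wmat_pow.
  have [k [b ei]] := half i; rewrite eSi in Pp.
  have uk : S ^+ k \is a GRing.unit by rewrite unitrX.
  have bb : S ^+ b = 1 \/ S ^+ b = S by case: b {ei} => /=; rewrite ?expr1 ?expr0; [right|left].
  case: Pp => Pp.
    exists (g * (S ^+ k)^-1); split.
    - by apply: SL2Z_M => //; apply: SL2Z_V; exact: SL2Z_pow.
    - apply: commV; apply: (mulrI uk); apply: (mulIr uk).
      by rewrite mulVKr // -[RHS]mulrA mulrVK // -exprSr -exprS.
    have -> : (g * (S ^+ k)^-1)^T * (g * (S ^+ k)^-1) = S ^+ b; last by [].
    rewrite trM trV; last exact: SL2Z_pow.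
    have -> : (S ^+ k)^T = S ^+ k.
      by elim: (k) => [|q IH]; [rewrite expr0 trmx1 | rewrite exprS trM IH tS -exprSr exprS].
    by rewrite -mulrA [g^T * _]mulrA -/P Pp ei exprD exprD mulrK // mulKr.
  have {}Pp : P = (S ^+ i)^-1 by rewrite -Pp invrK.
  exists (g * S ^+ (k + b)); split.
  - by apply: SL2Z_M => //; exact: SL2Z_pow.
  - by apply: commV; rewrite -exprS -exprSr.
  have -> : (g * S ^+ (k + b))^T * (g * S ^+ (k + b)) = S ^+ b; last by [].
  have tp q : (S ^+ q)^T = S ^+ q.
    by elim: q => [|q IH]; [rewrite expr0 trmx1 | rewrite exprS trM IH tS -exprSr exprS].
  rewrite trM tp -mulrA [g^T * _]mulrA -/P Pp ei [S ^+ (k + b + k)]exprD.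
  have us : S ^+ (k + b) \is a GRing.unit by rewrite unitrX.
  by rewrite invrM // mulrVK // -[(k + b)%N]addnC exprD mulrK.
case: hh => hh.
  by left; apply: (orthogonal_conj sh hh sr r0 sr' r0').
(* As h^T h = S = M M^T, the matrix h (M^T)^-1 is orthogonal, and it conjugates M^T M to S'. *)
right; pose m := half_word r; pose M := wmat m.
have sM : SL2Z M := SL2Z_wmat m; have uM := SL2Z_unit sM.
have uMt : M^T \is a GRing.unit by apply: SL2Z_unit; exact: SL2Z_tr.
have SM : S = M * M^T by rewrite /S {1}(wsym_half sr) wmatM wmat_tr.
apply: (@orthogonal_conj (h * (M^T)^-1)) => //.
- by apply: SL2Z_M => //; apply: SL2Z_V; exact: SL2Z_tr.
- rewrite trM trV; last exact: SL2Z_tr.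
  by rewrite trmxK -mulrA [h^T * _]mulrA hh SM mulrK // mulVr.
- exact: swap_sym.
- exact: swap_neq0.
rewrite /swap_word wmatM -wmat_tr -/M -/m -/S'.
by rewrite mulrA eh SM -!mulrA mulrV // mulr1 mulKr.
Qed.

(** * Axes through the orbit of i *)

(** The sum and the product of the fixed points are expressed by the entries of A. Inserting them
    and the coordinates of g i into the equation of the half-circle leaves the integer relation
    [keyZ], which says that the off-diagonal entries of g^-1 A g agree. *)
Lemma axis_sym (A g : 'M[int]_2) : SL2Z g -> axis A (mobius g (Complex (0 : R) 1)) ->
  (g^-1 * A * g)^T = g^-1 * A * g.
Proof.
move=> sg [_ [x1 [x2 [x12 f1 f2]]]].
have [D0 ->] := @mobius_i g _ _ _ _ sg erefl erefl erefl erefl.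
rewrite /real_fixed_point in f1 f2; move=> /=.
set a : R := (A 0 0)%:~R in f1 f2; set b : R := (A 0 1)%:~R in f1 f2.
set c : R := (A 1 0)%:~R in f1 f2; set d : R := (A 1 1)%:~R in f1 f2.
set p : R := (g 0 0)%:~R in D0 *; set q : R := (g 0 1)%:~R.
set r : R := (g 1 0)%:~R in D0 *; set s : R := (g 1 1)%:~R in D0 *.
have dg : p * s - q * r = 1.
  by rewrite /p /q /r /s -!intrM -intrB -det2; move: sg; rewrite /SL2Z /= => ->.
move=> circ; set D := r ^+ 2 + s ^+ 2 in D0 circ; set n := p * r + q * s in circ.
have e1 : c * (x1 + x2) = a - d.
  have : (x2 - x1) * (c * (x1 + x2) + d - a) = 0 by move: f1 f2; clear; lra.
  move/eqP; rewrite mulf_eq0 subr_eq0 gt_eqF //= => /eqP; lra.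
have e2 : c * (x1 * x2) = - b.
  have : b = c * x1 ^+ 2 - c * (x1 + x2) * x1 by rewrite e1; lra.
  by move=> ->; ring.
have nD : n ^+ 2 + 1 = (p ^+ 2 + q ^+ 2) * D.
  by rewrite -[1](expr1n R 2) -{1}dg /n /D; ring.
have key : c * (p ^+ 2 + q ^+ 2) - (a - d) * n - b * D = 0.
  have circ' : (n / D) ^+ 2 + D^-1 ^+ 2 - (x1 + x2) * (n / D) + x1 * x2 = 0.
    have -> : x1 * x2 = ((x1 + x2) / 2) ^+ 2 - ((x2 - x1) / 2) ^+ 2 by field.
    by rewrite -circ; field; rewrite gt_eqF.
  have : c * ((n / D) ^+ 2 + D^-1 ^+ 2) - (a - d) * (n / D) - b = 0.
    have -> : b = - (c * (x1 * x2)) by rewrite e2 opprK.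
    by rewrite -e1 -[RHS](mulr0 c) -circ'; ring.
  have -> : (n / D) ^+ 2 + D^-1 ^+ 2 = (p ^+ 2 + q ^+ 2) / D.
    have -> : (n / D) ^+ 2 + D^-1 ^+ 2 = (n ^+ 2 + 1) / D ^+ 2 by field; rewrite gt_eqF.
    by rewrite nD; field; rewrite gt_eqF.
  move=> h; have := congr1 (fun z => z * D) h; rewrite mul0r => <-.
  by field; rewrite gt_eqF.
have keyZ : A 1 0 * (g 0 0 ^+ 2 + g 0 1 ^+ 2) - (A 0 0 - A 1 1) * (g 0 0 * g 1 0 + g 0 1 * g 1 1)
    - A 0 1 * (g 1 0 ^+ 2 + g 1 1 ^+ 2) = 0.
  apply: (@intr_inj R); rewrite rmorph0 -key /a /b /c /d /n /D /p /q /r /s.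
  by rewrite !(rmorphB, rmorphD, rmorphM, rmorphXn).
rewrite inv2 // (mat2_eta A) (mat2_eta g) !mat2M tr2 !mat2E.
move: keyZ; move: (A 0 0) (A 0 1) (A 1 0) (A 1 1) (g 0 0) (g 0 1) (g 1 0) (g 1 1) => *.
apply: mx2P; rewrite !mat2E //; lia.
Qed.

Lemma mobius_1 : mobius 1 (Complex (0 : R) 1) = Complex 0 1.
Proof.
have [_ ->] := @mobius_i 1 1 0 0 1 SL2Z_1 (ltac:(by rewrite mxE)) (ltac:(by rewrite mxE))
  (ltac:(by rewrite mxE)) (ltac:(by rewrite mxE)).
by rewrite expr0n expr1n add0r divr1 invr1 mulr0 mul0r addr0.
Qed.

Lemma passes_wsym s : wsym s -> s != [::] -> passes_through_Pi_i R (wmat s).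
Proof.
move=> ss s0; have [bc b0 _] := wsym_entries ss s0.
exists 1; first exact: SL2Z_1.
rewrite -/(Complex 0 1) mobius_1; split; first by rewrite /= ltr01.
rewrite /real_fixed_point !mat2E -bc.
set a : R := (wA s : int)%:~R; set d : R := (wD s : int)%:~R; set b : R := (wB s : int)%:~R.
have bp : 0 < b by rewrite /b ltr0z ltz_nat.
pose S := Num.sqrt ((a - d) ^+ 2 + 4 * b ^+ 2).
have q0 : 0 < (a - d) ^+ 2 + 4 * b ^+ 2.
  by rewrite ltr_wpDl ?sqr_ge0 // mulr_gt0 // exprn_gt0.
have S0 : 0 < S by rewrite sqrtr_gt0.
have S2 : S ^+ 2 = (a - d) ^+ 2 + 4 * b ^+ 2 by rewrite sqr_sqrtr // ltW.
(* The roots of b x^2 - (a - d) x - b = 0; their product is -1, so the half-circle over them passes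
   through i. *)
exists ((a - d - S) / (2 * b)), ((a - d + S) / (2 * b)); split => /=.
- by rewrite ltr_pM2r ?invr_gt0 ?mulr_gt0 //; lra.
- by field: S2; rewrite gt_eqF.
- by field: S2; rewrite gt_eqF.
- by field: S2; rewrite gt_eqF.
Qed.

Lemma prim_geodesics_words : prim_geodesics_through_i R =
  [set conj_class (wmat r) | r in [set r | wsym r /\ wprim r]].
Proof.
apply/seteqP; split=> [_ [A [hA pA [g sg ax]] <-]|_ [r [sr pr] <-]]; last first.
  exists (wmat r) => //; have r0 := pr.1; split; first exact: hyperbolic_wsym.
    exact: prim_mat.
  exact: passes_wsym.
have [sA tA] := hA; have sgV := SL2Z_V sg; have ug := SL2Z_unit sg.
have tB := axis_sym sg ax; set B := g^-1 * A * g in tB.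
have sB : SL2Z B by exact: SL2Z_M (SL2Z_M sgV sA) sg.
have hB : 2 < `|\tr B| by rewrite /B -{2}[g]invrK trace_conj.
have AB : conj_class A B by exists g^-1 => //; left; rewrite invrK.
clearbody B.
have [B' [sB' tB' hB' AB' B'0]] : exists B', [/\ SL2Z B', B'^T = B', 2 < `|\tr B'|,
    conj_class A B' & 0 < B' 0 0].
  have [lt0|gt0|e0] := ltgtP (B 0 0) 0.
  - exists (- B); split.
    + by rewrite /SL2Z /= det2 !mxE !mulrNN -det2.
    + by rewrite linearN /= tB.
    + by rewrite raddfN normrN.
    + by case: AB => h sh eB; exists h => //; case: eB => ->; [right | left; rewrite opprK].
    + by rewrite mxE oppr_gt0.
  - by exists B.
  have e10 : B 1 0 = B 0 1 by rewrite -{2}tB mxE.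
  by move: sB; rewrite /SL2Z /= det2 e10 e0; move: (B 0 1) (B 1 1) => b d; nia.
have [s [ss s0 As]] : exists s, [/\ wsym s, s != [::] & conj_class A (wmat s)].
  case: (sym_trichotomy sB' tB' B'0) => [B1|[s [ss s0 [e|e]]]].
  - by move: hB'; rewrite B1 trace2 !mxE.
  - by exists s; rewrite -e.
  (* Conjugation by J is inversion followed by transposition, so a symmetric matrix is conjugate to
     its inverse: the half-turn about i reverses a geodesic through i. *)
  pose J := mat2 0 (-1) 1 0.
  have sJ : SL2Z J by rewrite /SL2Z /= det2 !mat2E.
  exists s; split=> //; apply: (conj_class_sub AB'); exists J => //; left.
  have e10 : B' 1 0 = B' 0 1 by rewrite -{2}tB' mxE.
  rewrite -e !inv2 // (mat2_eta B') !mat2M !mat2E e10.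
  by apply: mx2P; rewrite !mat2E; lia.
have cs : conj_class (wmat s) = conj_class A by exact: conj_class_eq.
exists s => //; split=> //; split=> // t n e.
case: n e => [e|[//|n] e]; first by rewrite e in s0.
have st : wsym t by apply: (@wsym_wpow t n.+2) => //; rewrite -e.
have t0 : t != [::].
  by apply: contra_neq s0 => t0; rewrite e t0; apply/eqP; rewrite -size_eq0 size_wpow muln0.
have [h sh eA] := conj_class_sym As.
exfalso; apply: (pA (h * wmat t / h) n.+2) => //.
  by apply: hyperbolic_conj => //; exact: hyperbolic_wsym.
by rewrite (conj_pow _ _ sh) -wmat_pow -e.
Qed.

(** * Lengths and the sum over geodesics *)

Lemma nS_Lam m : m != [::] -> nS m = Lam m - (Lam m)^-1.
Proof.
move=> m0; have L1 := Lam_gt1 m0; have L0 : Lam m != 0 by rewrite gt_eqF //; lra.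
have -> : (Lam m)^-1 = nT m - Lam m by apply: (mulfI L0); rewrite divff // Lam_inv.
by rewrite /Lam; field.
Qed.

Lemma wt_Lam m : m != [::] -> wt m = 2 * (Lam m ^+ 2 - 1)^-1.
Proof.
move=> m0; have L1 := Lam_gt1 m0; have s0 := nS_gt0 m0.
have q0 : 0 < Lam m ^+ 2 - 1 by nra.
have nTE : nT m = nS m + 2 * (Lam m)^-1.
  by rewrite nS_Lam //; have := Lam_inv m; move/(congr1 (fun z => (Lam m)^-1 * z)); rewrite mulKf ?gt_eqF //; lra.
rewrite /wt nTE nS_Lam //.
by field; rewrite !gt_eqF //; lra.
Qed.

Lemma trace_wsym m : (\tr (wmat (m ++ wtr m)))%:~R = nT m :> R.
Proof.
rewrite wmatM trace2; have [e1 e2 e3 e4] := w_tr m.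
rewrite /wmat mat2M !mat2E e1 e2 e3 e4 !(rmorphD, rmorphM) /= /nT /n11 /n22 -/(ra m) -/(rb m) -/(rc m) -/(rd m).
by ring.
Qed.

Lemma cayley2 (S : 'M[int]_2) : SL2Z S -> S * S = S * (\tr S)%:M - 1.
Proof.
rewrite /SL2Z /= det2 => d; rewrite trace2.
have -> : (S 0 0 + S 1 1)%:M = mat2 (S 0 0 + S 1 1) 0 0 (S 0 0 + S 1 1).
  by apply: mx2P; rewrite mat2E !mxE.
rewrite [X in X * X]mat2_eta [X in _ = X * _ - _]mat2_eta !mat2M.
apply: mx2P; rewrite !mat2E ?mxE ?mat2E /=; lia.
Qed.

Lemma trace_powSS (S : 'M[int]_2) n : SL2Z S ->
  \tr (S ^+ n.+2) = \tr S * \tr (S ^+ n.+1) - \tr (S ^+ n).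
Proof.
move=> sS; have -> : S ^+ n.+2 = \tr S *: S ^+ n.+1 - S ^+ n.
  rewrite !exprSr -mulrA cayley2 // mulrBr mulr1 mulrA; congr (_ - _).
  by rewrite -[LHS]/(_ *m _) mul_mx_scalar.
by rewrite raddfB /= mxtraceZ.
Qed.

Lemma trace_pow (S : 'M[int]_2) (L : R) n : SL2Z S -> L != 0 -> (\tr S)%:~R = L + L^-1 ->
  (\tr (S ^+ n))%:~R = L ^+ n + L^-1 ^+ n /\ (\tr (S ^+ n.+1))%:~R = L ^+ n.+1 + L^-1 ^+ n.+1.
Proof.
move=> sS L0 e; elim: n => [|n [IH1 IH2]].
  by rewrite !expr0 !expr1 e trace2 !mxE.
split=> //; rewrite trace_powSS // rmorphB rmorphM /= e IH1 IH2 !exprSr.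
by field.
Qed.

(** For a symmetric word s = m m^t, [Lam m] is the larger eigenvalue of the matrix of s, whose trace
    is [nT m]; the eigenvalues of a power are the powers. *)
Lemma Lam_wpow r n : wsym r -> r != [::] -> (0 < n)%N ->
  Lam (half_word (wpow r n)) = Lam (half_word r) ^+ n.
Proof.
move=> sr r0 n0; set m := half_word _; set m0 := half_word r.
have ss : wsym (wpow r n) by rewrite /wsym wtr_wpow sr.
have s0 : wpow r n != [::].
  by rewrite -size_eq0 size_wpow muln_eq0 negb_or -lt0n n0 size_eq0.
have h0 := half_neq0 sr r0; have h1 := half_neq0 ss s0.
have L1 := Lam_gt1 h0; have Ln0 : Lam m0 != 0 by rewrite gt_eqF //; lra.
have e0 : (\tr (wmat r))%:~R = Lam m0 + (Lam m0)^-1.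
  rewrite (wsym_half sr) trace_wsym -/m0; have := Lam_inv m0.
  by move/(congr1 (fun z => (Lam m0)^-1 * z)); rewrite mulKf //; lra.
have [eT _] := trace_pow n (SL2Z_wmat r) Ln0 e0.
rewrite -wmat_pow (wsym_half ss) trace_wsym -/m exprVn in eT.
set y := Lam m0 ^+ n in eT *.
have y1 : 1 < y by rewrite expr_gt1 ?lt0n_neq0 // ltW //; exact: le_lt_trans ler01 L1.
have yi : y * y^-1 = 1 by rewrite divff // gt_eqF //; lra.
have yi1 : y^-1 < 1 by rewrite invf_lt1 //; lra.
have S : nS m = y - y^-1.
  rewrite /nS eT [X in Num.sqrt X](_ : _ = (y - y^-1) ^+ 2).
    by rewrite sqrtr_sqr ger0_norm //; lra.
  have -> : (y + y^-1) ^+ 2 - 4 = (y - y^-1) ^+ 2 + 4 * (y * y^-1 - 1) by ring.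
  by rewrite yi subrr mulr0 addr0.
by rewrite /Lam S eT; lra.
Qed.

Lemma geodesic_length_wsym r : wsym r -> r != [::] ->
  geodesic_length R (conj_class (wmat r)) = 2 * ln (Lam (half_word r)).
Proof.
move=> sr r0; rewrite /geodesic_length; congr (2 * ln _).
have [g sg eB] : conj_class (wmat r) (xget 0 (conj_class (wmat r))).
  by apply: (xgetPex 0); exists (wmat r); exact: conj_class_self.
have [h1 h2 tr2] := wsym_entries sr r0; rewrite /multiplier.
have -> : `|\tr (xget 0 (conj_class (wmat r)))| = \tr (wmat r).
  transitivity (`|\tr (wmat r)|); last by rewrite trace2 !mat2E -PoszD ger0_norm.
  by case: eB => ->; rewrite ?raddfN ?normrN /= trace_conj.
by rewrite {1 2}(wsym_half sr) trace_wsym.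
Qed.

Lemma wt_length r n : wsym r -> r != [::] -> (0 < n)%N -> wt (half_word (wpow r n)) =
  2 * (expR (n%:R * geodesic_length R (conj_class (wmat r))) - 1)^-1.
Proof.
move=> sr r0 n0.
have s0 : wpow r n != [::].
  by rewrite -size_eq0 size_wpow muln_eq0 negb_or -lt0n n0 size_eq0.
have ss : wsym (wpow r n) by rewrite /wsym wtr_wpow sr.
rewrite wt_Lam ?half_neq0 // Lam_wpow // geodesic_length_wsym //.
have L0 : 0 < Lam (half_word r) by have := Lam_gt1 (half_neq0 sr r0); lra.
by rewrite expRM_natl (expRM_natl 2) lnK ?posrE // -!exprM mulnC.
Qed.

Definition sym_prim := [set r | wsym r /\ wprim r].
Definition geo_term (C : set 'M[int]_2) (n : nat) : R :=
  (expR (n%:R * geodesic_length R C) - 1)^-1.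
Definition geo_sum C := (\esum_(n in [set n | 0 < n]%N) (geo_term C n)%:E)%E.

Lemma wt_ge0 m : m != [::] -> 0 <= wt m.
Proof.
move=> m0; have L1 := Lam_gt1 m0; rewrite wt_Lam // mulr_ge0 // invr_ge0; nra.
Qed.

Lemma wpow_neq0 r n : r != [::] -> (0 < n)%N -> wpow r n != [::].
Proof.
by move=> r0 n0; rewrite -size_eq0 size_wpow muln_eq0 negb_or -lt0n n0 size_eq0.
Qed.

Lemma wsym_wpowI r n : wsym r -> wsym (wpow r n).
Proof. by move=> sr; rewrite /wsym wtr_wpow sr. Qed.

Lemma geo_term_ge0 r n : wsym r -> r != [::] -> (0 < n)%N ->
  0 <= geo_term (conj_class (wmat r)) n.
Proof.
move=> sr r0 n0; have := wt_ge0 (half_neq0 (wsym_wpowI n sr) (wpow_neq0 r0 n0)).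
by rewrite wt_length // pmulr_rge0.
Qed.

(** The bijection takes (r, n) to the half of r^n, and conversely m to the primitive root and the
    exponent of m m^t. By [wt_length] the term for (r, n) is [wt m / 2]. *)
Lemma esum_wt_words : (\esum_(m in [set m | m != [::]]) (wt m / 2)%:E =
  \esum_(r in sym_prim) geo_sum (conj_class (wmat r)))%E.
Proof.
rewrite /geo_sum esum_esum; last first.
  by move=> r n [sr pr] n0; rewrite lee_fin geo_term_ge0 //; exact: pr.1.
rewrite (@reindex_esum _ _ _ (sym_prim `*`` (fun=> [set n | (0 < n)%N])) _
  (fun a : seq bool * nat => half_word (wpow a.1 a.2))).
  apply: eq_esum => -[r n] [/= [sr pr] n0]; rewrite wt_length //; last exact: pr.1.
  by rewrite mulrAC divff ?mul1r.
split.
- move=> [r n] [/= [sr pr] n0].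
  by apply: half_neq0; [exact: wsym_wpowI | apply: wpow_neq0 => //; exact: pr.1].
- move=> [r n] [r' n'] /[!inE] -[/= [sr pr] n0] [/= [sr' pr'] n0'] e.
  have [-> ->] // : r = r' /\ n = n'.
  apply: wprim_pow_inj => //.
  by rewrite (wsym_half (wsym_wpowI n sr)) (wsym_half (wsym_wpowI n' sr')) e.
- move=> m /= m0; have s0 : m ++ wtr m != [::] by case: (m) m0.
  have [r [n [pr n0 e]]] := wprim_root s0.
  have sr : wsym r by apply: (wsym_wpow n0); rewrite -e; exact: wsym_cat.
  by exists (r, n) => //=; rewrite -e half_wordK.
Qed.

Lemma esum_class_words : (\esum_(r in sym_prim) geo_sum (conj_class (wmat r)) =
  \esum_(C in prim_geodesics_through_i R) (geo_sum C + geo_sum C))%E.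
Proof.
have g0 r : wsym r -> wprim r -> (0 <= geo_sum (conj_class (wmat r)))%E.
  move=> sr pr; apply: esum_ge0 => n n0; rewrite lee_fin geo_term_ge0 //; exact: pr.1.
pose J C := sym_prim `&` [set r | conj_class (wmat r) = C].
transitivity (\esum_(C in prim_geodesics_through_i R) \esum_(r in J C) geo_sum C)%E; last first.
  apply: eq_esum => C; rewrite prim_geodesics_words => -[r [sr pr] <-].
  have -> : J (conj_class (wmat r)) = [set r] `|` [set swap_word r].
    apply/seteqP; split=> [r' [[sr' pr'] e]|r' [->|->]]; last first.
    - by split; [split; [exact: swap_sym | exact: swap_prim] | exact: swap_class].
    - by [].
    apply: class_sym => //; first exact: pr'.1.
    by rewrite -e; exact: conj_class_self.
  have fin (x : seq bool) : finite_set [set x] by exact: finite_set1.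
  have cst (x : seq bool) : (\esum_(i in [set x]) geo_sum (conj_class (wmat r)) = geo_sum (conj_class (wmat r)))%E.
    by rewrite esum_set1 // g0.
  rewrite (esumID [set r]); last by move=> *; exact: g0.
  rewrite -[X in _ = (X + _)%E](cst r) -[X in _ = (_ + X)%E](cst (swap_word r)).
  congr (_ + _)%E; congr esum.
    by apply/seteqP; split=> [x []//|x ->]; split=> //; left.
  apply/seteqP; split=> [x [[-> []//|//]]|x ->]; split; first by right.
  by move=> /= e; exact: (swap_neq sr pr e).
rewrite esum_esum; last first.
  by move=> C r; rewrite prim_geodesics_words => -[r' [sr' pr'] <-] _; exact: g0.
rewrite (@reindex_esum _ _ _ sym_prim _ (fun r => (conj_class (wmat r), r))) //.
split.
- move=> r pr; split; last by [].
  by rewrite prim_geodesics_words; exists r.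
- by move=> r r' _ _ [].
- by move=> [C r] [/= _ [pr e]]; exists r => //; rewrite e.
Qed.

Lemma geo_sum_series C : C \in prim_geodesics_through_i R ->
  (geo_sum C = \sum_(1 <= n <oo) ((expR (n%:R * geodesic_length R C) - 1)^-1)%:E)%E.
Proof.
rewrite inE prim_geodesics_words => -[r [sr pr] <-]; rewrite /geo_sum -nneseries_esum; last first.
  by move=> n n0; rewrite lee_fin geo_term_ge0 //; exact: pr.1.
congr (limn _); apply/funext => n; rewrite big_mkcond.
case: n => [|n]; first by rewrite !big_geq.
rewrite big_ltn //= add0e -big_mkcond big_nat_cond [RHS]big_nat_cond; apply: eq_bigl => i.
by case: i => //= i; rewrite andbT.
Qed.

Lemma second_equality : ((2 / 3)%:E * (\esum_(M in frakS)
    ((norm_sq M)%:~R / Num.sqrt ((norm_sq M)%:~R ^+ 2 - 4) - 1)%:E) =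
  (8 / 3)%:E * (\esum_(C in prim_geodesics_through_i R)
    \sum_(1 <= n <oo) ((expR (n%:R * geodesic_length R C) - 1)^-1)%:E) :> \bar R)%E.
Proof.
rewrite esum_frakS_wt.
have g0 C : prim_geodesics_through_i R C -> (0 <= geo_sum C)%E.
  rewrite prim_geodesics_words => -[r [sr pr] <-].
  by apply: esum_ge0 => n n0; rewrite lee_fin geo_term_ge0 //; exact: pr.1.
have w0 m : [set m | m != [::]] m -> (0 <= (wt m / 2)%:E)%E.
  by move=> m0; rewrite lee_fin divr_ge0 // wt_ge0.
have -> : (\esum_(m in [set m | m != [::]]) (wt m)%:E =
    \esum_(m in [set m | m != [::]]) ((wt m / 2)%:E + (wt m / 2)%:E))%E.
  by apply: eq_esum => m _; rewrite -EFinD -splitr.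
(* Each [wt] is twice a geodesic term, and each class contains two primitive symmetric words: hence
   8/3 = 2/3 * 2 * 2. *)
rewrite esumD // esum_wt_words esum_class_words esumD //.
have -> : (\esum_(C in prim_geodesics_through_i R)
    \sum_(1 <= n <oo) ((expR (n%:R * geodesic_length R C) - 1)^-1)%:E =
    \esum_(C in prim_geodesics_through_i R) geo_sum C)%E.
  by apply: eq_esum => C hC; rewrite geo_sum_series // inE.
have : (0 <= \esum_(C in prim_geodesics_through_i R) geo_sum C)%E by exact: esum_ge0.
case: (\esum_(C in _) _)%E => [z z0||//].
  by rewrite -!EFinD -!EFinM; congr EFin; lra.
(* When the sum over the geodesics is +oo, both sides are +oo. *)
by move=> _ /=; rewrite !gt0_muley // lte_fin.
Qed.

End PairCorrelationAtZero.

Theorem mainTheorem3 (R : realType)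
  (RA_exists : forall xi : R, 0 <= xi -> cvg (RA_ Q xi @[Q --> +oo]))
  (RA_C1 : C1_0y (@RA R)) :
  ((gA_at0 R)%:E =
     (2 / 3)%:E * (\esum_(M in frakS)
       ((norm_sq M)%:~R / Num.sqrt ((norm_sq M)%:~R ^+ 2 - 4) - 1)%:E))%E
  /\
  ((2 / 3)%:E * (\esum_(M in frakS)
       ((norm_sq M)%:~R / Num.sqrt ((norm_sq M)%:~R ^+ 2 - 4) - 1)%:E) =
   (8 / 3)%:E * (\esum_(C in prim_geodesics_through_i R)
       \sum_(1 <= n <oo) ((expR (n%:R * geodesic_length R C) - 1)^-1)%:E)
   :> \bar R)%E.
Proof.
split; [exact: first_equality RA_exists RA_C1 | exact: second_equality].
Qed.
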